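(* Let $\mathfrak{g}$ be a finite dimensional simple Lie algebra over an algebraically closed field $\mathbb{K}$ of characteristic $0$. If the Gelfand--Kirillov conjecture holds for $\mathfrak{g}$, then there is a $p_0$ such that for every prime $p\ge p_0$ the Gelfand--Kirillov conjecture holds for the Lie algebra $\mathfrak{g}_{\Bbbk}=\mathfrak{g}_{\mathbb{Z}}\otimes_{\mathbb{Z}}\Bbbk$, where $\Bbbk$ is the algebraic closure of $\mathbb{F}_p$.
   Context: For a finite dimensional Lie algebra $L$ over an algebraically closed field $F$ (of any characteristic), $U(L)$ denotes its universal enveloping algebra, which is a Noetherian domain, and $\mathcal{D}(L)$ denotes the skew field of fractions of $U(L)$. $\mathbf{A}_r(F)$ is the $r$-th Weyl algebra over $F$, generated by $u_1,\ldots,u_r,v_1,\ldots,v_r$ subject to $[u_i,u_j]=[v_i,v_j]=0$ and $[u_i,v_j]=\delta_{ij}$ for all $i,j\le r$. Put $\mathbf{A}_{r,s}(F):=\mathbf{A}_r(F)\otimes F[y_1,\ldots,y_s]$ with free commuting variables $y_1,\ldots,y_s$, and let $\mathcal{D}_{r,s}(F)$ be its skew field of fractions. We say that the Gelfand--Kirillov conjecture holds for $L$ if $\mathcal{D}(L)\cong\mathcal{D}_{r,s}(F)$ as $F$-algebras for some non-negative integers $r,s$. $\mathfrak{g}_{\mathbb{Z}}$ is a Chevalley $\mathbb{Z}$-form of $\mathfrak{g}$, i.e. the $\mathbb{Z}$-span of a Chevalley basis $\{h_\alpha\mid\alpha\in\Pi\}\cup\{e_\alpha\mid\alpha\in\Phi\}$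 of $\mathfrak{g}$, where $\Phi$ is the root system of $\mathfrak{g}$, $\Pi$ is a basis of simple roots, $h_\alpha$ is the coroot element and $e_\alpha$ is a root vector for $\alpha$. *)

(* Defs.v *)
From HB Require Import structures.
From mathcomp Require Import all_boot all_order all_algebra.
From mathcomp Require Import mpoly.

Set Implicit Arguments.
Unset Strict Implicit.
Unset Printing Implicit Defensive.

Import GRing.Theory.
Local Open Scope ring_scope.

(* Finite dimensional Lie algebras over a field of any characteristic; finite
   dimension comes from [Vector]. *)
HB.mixin Record Vector_isLie (F : fieldType) L of Vector F L := {
  brack : L -> L -> L;
  brack_linearl : forall y, linear (brack ^~ y);
  brack_linearr : forall x, linear (brack x);
  brackxx : forall x, brack x x = 0;
  jacobi : forall x y z,
    brack x (brack y z) + brack y (brack z x) + brack z (brack x y) = 0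
}.

#[short(type="lieType")]
HB.structure Definition Lie (F : fieldType) :=
  { L of Vector F L & Vector_isLie F L }.

Definition simple_lie (F : fieldType) (L : lieType F) : Prop :=
  (exists x y : L, brack x y != 0) /\
  forall I : {vspace L},
    (forall x y : L, y \in I -> brack x y \in I) -> I = 0%VS \/ I = fullv.

Section GelfandKirillov.
Variable F : fieldType.

(* [A], with its generators [j], is universal among the F-algebras equipped
   with a family indexed by [X] and satisfying [P]; in other words, [A] is
   presented by the generators [X] and the relations [P]. An [algType] is a
   nonzero ring; omitting the zero ring as a target changes nothing, as every
   ring has a unique morphism to it. *)
Definition universal_algebra (X : Type)
    (P : forall A : algType F, (X -> A) -> Prop)
    (A : algType F) (j : X -> A) : Prop :=
  P A j /\
  forall (B : algType F) (f : X -> B), P B f ->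
    exists phi : {lrmorphism A -> B},
      (forall x, phi (j x) = f x) /\
      forall psi : {lrmorphism A -> B},
        (forall x, psi (j x) = f x) -> psi =1 phi.

Definition lie_map (L : lieType F) (A : algType F) (j : L -> A) : Prop :=
  linear j /\ forall x y : L, j (brack x y) = j x * j y - j y * j x.

Definition is_enveloping_algebra (L : lieType F) (U : algType F) (j : L -> U) :
  Prop := universal_algebra (@lie_map L) j.

(* [w (inl i)] is u_i and [w (inr i)] is v_i. *)
Definition weyl_relations (r : nat) (A : algType F)
    (w : 'I_r + 'I_r -> A) : Prop :=
  forall i j : 'I_r,
    [/\ w (inl i) * w (inl j) - w (inl j) * w (inl i) = 0,
        w (inr i) * w (inr j) - w (inr j) * w (inr i) = 0
      & w (inl i) * w (inr j) - w (inr j) * w (inl i) = (i == j)%:R].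

Definition is_weyl_algebra (r : nat) (A : algType F) (w : 'I_r + 'I_r -> A) :
  Prop := universal_algebra (@weyl_relations r) w.

(* The tensor product of two F-algebras, by its universal property: a morphism
   out of it is a pair of morphisms with commuting images. *)
Definition is_tensor_algebra (A B T : algType F)
    (iA : {lrmorphism A -> T}) (iB : {lrmorphism B -> T}) : Prop :=
  (forall a b, GRing.comm (iA a) (iB b)) /\
  forall (C : algType F) (f : {lrmorphism A -> C}) (g : {lrmorphism B -> C}),
    (forall a b, GRing.comm (f a) (g b)) ->
    exists phi : {lrmorphism T -> C},
      ((forall a, phi (iA a) = f a) /\ (forall b, phi (iB b) = g b)) /\
      forall psi : {lrmorphism T -> C},
        (forall a, psi (iA a) = f a) -> (forall b, psi (iB b) = g b) ->
        psi =1 phi.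

Definition is_weyl_poly_algebra (r s : nat) (T : algType F) : Prop :=
  exists (A : algType F) (w : 'I_r + 'I_r -> A)
         (iA : {lrmorphism A -> T}) (iP : {lrmorphism {mpoly F[s]} -> T}),
    is_weyl_algebra w /\ is_tensor_algebra iA iP.

(* The skew field of fractions of an Ore domain [A]; it is unique up to a
   unique isomorphism over [A]. *)
Definition is_skew_field_of_fractions (A : algType F) (D : unitAlgType F)
    (i : {lrmorphism A -> D}) : Prop :=
  [/\ forall x : D, x != 0 -> x \is a GRing.unit,
      injective i
    & forall x : D, exists a s : A, s != 0 /\ x = i a / i s].

Definition is_lie_skew_field (L : lieType F) (D : unitAlgType F) : Prop :=
  exists (U : algType F) (j : L -> U) (i : {lrmorphism U -> D}),
    is_enveloping_algebra j /\ is_skew_field_of_fractions i.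

Definition is_weyl_skew_field (r s : nat) (D : unitAlgType F) : Prop :=
  exists (T : algType F) (i : {lrmorphism T -> D}),
    is_weyl_poly_algebra r s T /\ is_skew_field_of_fractions i.

Definition gelfand_kirillov (L : lieType F) : Prop :=
  exists (r s : nat) (DL Drs : unitAlgType F),
    [/\ is_lie_skew_field L DL,
        is_weyl_skew_field r s Drs
      & exists f : {lrmorphism DL -> Drs}, bijective f].

End GelfandKirillov.

Section ChevalleyBasis.
Variables (K : fieldType) (g : lieType K).

(* [foldr brack y s] is [s_1, [s_2, ... [s_n, y]]], so the first condition on
   brackets says that [H] is a subalgebra, the second that it is nilpotent, the
   third that it is its own normalizer. *)
Definition cartan_subalgebra (H : {vspace g}) : Prop :=
  [/\ forall x y, x \in H -> y \in H -> brack x y \in H,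
      exists n : nat, forall (s : seq g) (y : g),
        size s = n -> {subset s <= H} -> y \in H -> foldr brack y s = 0
    & forall x, (forall y, y \in H -> brack x y \in H) -> x \in H].

Local Notation dual H := 'Hom(subvs_of H, K^o).

Definition root_vector (H : {vspace g}) (a : dual H) (x : g) : Prop :=
  forall h : subvs_of H, brack (vsval h) x = (a h : K) *: x.

Definition is_root (H : {vspace g}) (a : dual H) : Prop :=
  a != 0 /\ exists2 x : g, x != 0 & root_vector a x.

(* For a split semisimple Lie algebra the rational span of the roots is a
   rational form of the dual of [H], so a basis of the root system is the same
   over the rationals and over [K]. *)
Definition simple_roots (H : {vspace g}) (Phi Pi : seq (dual H)) : Prop :=
  [/\ {subset Pi <= Phi},
      basis_of fullv Pi
    & forall b, b \in Phi -> exists n : dual H -> nat,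
        b = \sum_(a <- Pi) a *+ n a \/ b = - \sum_(a <- Pi) a *+ n a].

(* The element of [g_a, g_-a] on which [a] takes the value 2; the root spaces
   being lines, each element of [g_a, g_-a] is a single bracket. *)
Definition is_coroot (H : {vspace g}) (a : dual H) (h : subvs_of H) : Prop :=
  a h = 2%:R /\
  exists x y : g,
    [/\ root_vector a x, root_vector (- a) y & vsval h = brack x y].

(* The last condition is redundant in characteristic 0, by Chevalley's theorem:
   it says that the integral span of the basis is a Lie ring. *)
Record chevalley_basis := ChevalleyBasis {
  cb_cartan : {vspace g};
  cb_roots : seq (dual cb_cartan);
  cb_simple : seq (dual cb_cartan);
  cb_h : dual cb_cartan -> subvs_of cb_cartan;
  cb_e : dual cb_cartan -> g;
  cb_seq := [seq vsval (cb_h a) | a <- cb_simple] ++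
            [seq cb_e a | a <- cb_roots];
  cb_cartanP : cartan_subalgebra cb_cartan;
  cb_roots_uniq : uniq cb_roots;
  cb_rootsP : forall a, a \in cb_roots <-> is_root a;
  cb_simpleP : simple_roots cb_roots cb_simple;
  cb_basis : basis_of fullv cb_seq;
  cb_hP : forall a, a \in cb_roots -> is_coroot a (cb_h a);
  cb_eP : forall a, a \in cb_roots -> root_vector a (cb_e a);
  cb_e_opp : forall a, a \in cb_roots ->
    brack (cb_e a) (cb_e (- a)) = vsval (cb_h a);
  cb_e_sign : forall a b (c : K),
    a \in cb_roots -> b \in cb_roots -> a + b \in cb_roots ->
    brack (cb_e a) (cb_e b) = c *: cb_e (a + b) ->
    brack (cb_e (- a)) (cb_e (- b)) = - c *: cb_e (- a - b);
  cb_integral : forall x y, x \in cb_seq -> y \in cb_seq ->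
    inIntSpan (in_tuple cb_seq) (brack x y)
}.

Definition chevalley_form (B : chevalley_basis) (x : g) : Prop :=
  inIntSpan (in_tuple (cb_seq B)) x.

End ChevalleyBasis.

(* [gk], with [i : x |-> x (x) 1], is the Lie algebra obtained from the Lie ring
   [gZ] by extension of scalars from the integers to [k]: [i] is universal among
   the additive maps from [gZ] to a [k]-module, and it preserves brackets. Only
   the values of [i] on [gZ] matter. *)
Definition is_scalar_extension (K : fieldType) (g : lieType K) (gZ : g -> Prop)
    (k : fieldType) (gk : lieType k) (i : g -> gk) : Prop :=
  let additive_on (M : lmodType k) (f : g -> M) :=
    forall x y, gZ x -> gZ y -> f (x + y) = f x + f y in
  [/\ additive_on gk i,
      forall x y, gZ x -> gZ y -> i (brack x y) = brack (i x) (i y)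
    & forall (M : lmodType k) (f : g -> M), additive_on M f ->
        exists phi : {linear gk -> M},
          (forall x, gZ x -> phi (i x) = f x) /\
          forall psi : {linear gk -> M},
            (forall x, gZ x -> psi (i x) = f x) -> psi =1 phi].

Definition is_algebraic_closure_Fp (p : nat) (k : closedFieldType) : Prop :=
  exists i : {rmorphism 'F_p -> k}, integralRange i.

(* Main.v *)
(* Write [U] for the enveloping algebra of [g] and [T] for the Weyl algebra
   tensored with polynomials. Both are presented by generators [x_i] whose
   commutators are combinations of the [x_k] and 1 with integral coefficients, so
   both have a basis of ordered monomials with integral structure constants, over
   any field, and leading monomials for the degree-lexicographic order are
   multiplicative. If [U] and [T] have the same skew field of fractions over [K],
   the fractions expressing the generators of [T] by those of [U], and back,
   involve finitely many elements of [K]; these can be specialized to [k] in all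
   large characteristics, keeping the relations and the denominators nonzero, and
   one gets a morphism from [T_k] to the skew field of fractions of [U_k] whose
   image generates it. Its injectivity is a matter of growth. If [D] is the skew
   field of fractions of an algebra [A] with [N] generators [x_i] as above, then
   for any [f != 0] in [D] the products [(x_1 f)^(e_1) ... (x_N f)^(e_N) f^m]
   have distinct leading exponents, hence are independent; taking for [f] a common
   denominator of the [x_i] in another such algebra [B] with [M] generators that
   maps to [D], one finds [N <= M], and [N < M] if the map is not injective. Over
   [K] this bounds the number of generators of [T] by that of [U], and over [k] it
   then forbids a kernel. *)
Require Import Defs.
From HB Require Import structures.
From mathcomp Require Import all_boot all_order all_algebra.
From mathcomp Require Import zify ring.
From mathcomp Require Import ssrcomplements mpoly boolp.

Set Implicit Arguments.
Unset Strict Implicit.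
Unset Printing Implicit Defensive.

Import Order.TTheory GRing.Theory.
Local Open Scope ring_scope.

(** The obstacle is that injectivity over [k] cannot be had by specializing injectivity over [K]: a
    specialization preserves finitely many nonvanishing conditions, fixed before the prime is known,
    whereas a kernel may consist of elements of any degree, depending on the prime. The number of
    generators does not depend on the field, so comparing it over [K] and over [k] replaces any
    control of the kernel. For coefficients to be specialized at all, each algebra must have the
    same multiplication table over every field. This is why the Poincare-Birkhoff-Witt theorem is
    proved over the integers, in Serre's manner, by a representation on polynomials, the product of
    ordered monomials being then transported to every commutative ring. Specializations are built by
    adjoining to the integers one element of [K] at a time, as in proofs of the Nullstellensatz.
    Between the skew fields there is no reduction morphism, since a denominator may reduce to 0;
    elements are reduced through chosen fractions, and every identity wanted is one more finite
    condition on the specialization. *)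

(* A reflexive decision procedure for linear identities in abelian groups. *)
Inductive zexpr := ZVar of nat | ZZero | ZAdd of zexpr & zexpr | ZOpp of zexpr.

Fixpoint zeval (V : zmodType) (e : seq V) t := match t with
  | ZVar i => e`_i
  | ZZero => 0
  | ZAdd t1 t2 => zeval e t1 + zeval e t2
  | ZOpp t1 => - zeval e t1
  end.

Fixpoint zcoef t (i : nat) : int := match t with
  | ZVar j => (i == j)%:Z
  | ZZero => 0
  | ZAdd t1 t2 => zcoef t1 i + zcoef t2 i
  | ZOpp t1 => - zcoef t1 i
  end.

Lemma zevalE (V : zmodType) (e : seq V) t :
  zeval e t = \sum_(i < size e) e`_i *~ zcoef t i.
Proof.
elim: t => [j||t1 IH1 t2 IH2|t1 IH1] /=.
- have [ej|je] := leqP (size e) j.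
    rewrite nth_default // big1 // => i _.
    by have /negPf-> : nat_of_ord i != j by rewrite neq_ltn (leq_trans _ ej).
  rewrite (bigD1 (Ordinal je)) //= eqxx mulr1z big1 ?addr0 // => i ij.
  by have /negPf-> : nat_of_ord i != j by [].
- by rewrite big1.
- by rewrite IH1 IH2 -big_split; apply: eq_bigr => i _; rewrite mulrzDr.
- by rewrite IH1 -sumrN; apply: eq_bigr => i _; rewrite mulrNz.
Qed.

Lemma zeval_eq (V : zmodType) (e : seq V) k t1 t2 : size e = k ->
  all (fun i => zcoef t1 i == zcoef t2 i) (iota 0 k) ->
  zeval e t1 = zeval e t2.
Proof.
move=> <- /allP H; rewrite !zevalE; apply: eq_bigr => i _; congr (_ *~ _).
by apply/eqP/H; rewrite mem_iota add0n ltn_ord.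
Qed.

Ltac zindex x e :=
  lazymatch e with
  | x :: _ => constr:(0%N)
  | _ :: ?e' => let i := zindex x e' in constr:(i.+1)
  end.
Ltac zinsert x e :=
  match e with
  | _ => let i := zindex x e in constr:(e)
  | _ => constr:(x :: e)
  end.
Ltac zatoms t e :=
  lazymatch t with
  | ?a + ?b => let e' := zatoms a e in zatoms b e'
  | - ?a => zatoms a e
  | 0 => constr:(e)
  | ?x => zinsert x e
  end.
Ltac zreify t e :=
  lazymatch t with
  | ?a + ?b => let a' := zreify a e in let b' := zreify b e in
               constr:(ZAdd a' b')
  | - ?a => let a' := zreify a e in constr:(ZOpp a')
  | 0 => constr:(ZZero)
  | ?x => let i := zindex x e in constr:(ZVar i)
  end.
Ltac zgroup :=
  lazymatch goal with
  | |- @eq ?V ?s ?t =>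
    let e := zatoms s (@nil V) in let e := zatoms t e in
    let s' := zreify s e in let t' := zreify t e in
    apply: (zeval_eq (e := e) (t1 := s') (t2 := t') (erefl _));
    vm_compute; reflexivity
  end.

(** * Additive maps on polynomials and ordered monomials *)

Section ZmodMorphism.
Variables (U V : zmodType) (f : U -> V).
Hypothesis fB : zmod_morphism f.

Lemma zmorph0 : f 0 = 0.
Proof. by rewrite -[X in f X](subrr 0) fB subrr. Qed.

Lemma zmorphD x y : f (x + y) = f x + f y.
Proof. by rewrite -{2}(addrK y x) fB subrK. Qed.

Lemma zmorphN x : f (- x) = - f x.
Proof. by rewrite -[X in f X]sub0r fB zmorph0 sub0r. Qed.

Lemma zmorph_sum (I : Type) (r : seq I) (P : pred I) F :
  f (\sum_(i <- r | P i) F i) = \sum_(i <- r | P i) f (F i).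
Proof. exact: (big_morph f zmorphD zmorph0). Qed.

Lemma zmorphMz x k : f (x *~ k) = f x *~ k.
Proof.
have fMn n : f (x *+ n) = f x *+ n.
  by elim: n => [|n IHn]; rewrite ?mulr0n ?zmorph0 // !mulrS zmorphD IHn.
case: k => n; first by rewrite -!pmulrn.
by rewrite NegzE !mulrNz -!pmulrn zmorphN fMn.
Qed.

End ZmodMorphism.

Section AdditiveExtension.
Variables (n : nat) (R : nzRingType) (M : zmodType).
Implicit Types (g : 'X_{1..n} -> R -> M) (p : {mpoly R[n]}).

(** Only additivity in each coefficient is asked of [g], so that one extension covers integer
    multiples in an abelian group as well as scalar multiples in an algebra. *)
Definition mext g p := \sum_(m <- msupp p) g m p@_m.

Lemma mext_bound g k p : (forall m, zmod_morphism (g m)) -> (msize p <= k)%N ->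
  mext g p = \sum_(m : 'X_{1..n < k}) g m p@_m.
Proof.
move=> gB le_pk.
rewrite /mext (big_mksub 'X_{1..n < k}) /=; first last.
- by move=> x /msize_mdeg_lt /leq_trans; apply.
- exact: msupp_uniq.
rewrite big_rmcond //= => m /memN_msupp_eq0 ->.
exact/zmorph0/gB.
Qed.

Lemma mext_is_additive g :
  (forall m, zmod_morphism (g m)) -> zmod_morphism (mext g).
Proof.
move=> gB p q; pose k := maxn (msize p) (msize q).
have le_k : (msize (p - q) <= k)%N.
  by rewrite /k -(msizeN q) msizeD_le.
rewrite !(mext_bound (k := k)) ?leq_maxl ?leq_maxr // -sumrB.
by apply: eq_bigr => m _; rewrite mcoeffB gB.
Qed.

Lemma mextZX g c m : (forall m, zmod_morphism (g m)) ->
  mext g (c *: 'X_[m]) = g m c.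
Proof.
move=> gB; have [->|c0] := eqVneq c 0.
  by rewrite scale0r /mext msupp0 big_nil (zmorph0 (gB m)).
by rewrite /mext msuppMCX // big_seq1 mcoeffZ mcoeffX eqxx mulr1.
Qed.

Lemma eq_additive_mpoly (f g : {mpoly R[n]} -> M) :
  zmod_morphism f -> zmod_morphism g ->
  (forall c m, f (c *: 'X_[m]) = g (c *: 'X_[m])) -> f =1 g.
Proof.
move=> fB gB fg p.
rewrite (mpolyE p) (zmorph_sum fB) (zmorph_sum gB).
by apply: eq_bigr => m _; rewrite fg.
Qed.

End AdditiveExtension.

Lemma msize_le_mcoeff n (R : nzRingType) (p : {mpoly R[n]}) d :
  (forall m, p@_m != 0 -> (mdeg m < d)%N) -> (msize p <= d)%N.
Proof.
by move=> pd; rewrite msizeE; apply/bigmax_leqP_seq => m; rewrite mcoeff_msupp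
  => /pd.
Qed.

Lemma msize_mcoeff n (R : nzRingType) (p : {mpoly R[n]}) m :
  p@_m != 0 -> (mdeg m < msize p)%N.
Proof. by rewrite -mcoeff_msupp => /msize_mdeg_lt. Qed.

(** The condition under which writing [x_i] in front of the ordered monomial [m] leaves it ordered;
    see [omonU]. *)
Definition below n (i : 'I_n) (m : 'X_{1..n}) :=
  [forall j : 'I_n, (j < i)%N ==> (m j == 0%N)].

Definition low n (m : 'X_{1..n}) := [pick j | (m j != 0%N) && below j m].

Lemma belowP n (i : 'I_n) (m : 'X_{1..n}) :
  reflect (forall j : 'I_n, (j < i)%N -> m j = 0%N) (below i m).
Proof.
apply: (iffP forallP) => H j; last by apply/implyP => /H ->.
by move=> ji; apply/eqP; apply: (implyP (H j)).
Qed.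

Variant low_spec n (m : 'X_{1..n}) : option 'I_n -> Type :=
| LowNone of m = 0%MM : low_spec m None
| LowSome j of below j (m - U_(j)) & m = (U_(j) + (m - U_(j)))%MM
    : low_spec m (Some j).

Lemma lowP n (m : 'X_{1..n}) : low_spec m (low m).
Proof.
rewrite /low; case: pickP => [j /andP[mj /belowP bj]|H].
- apply: LowSome.
    by apply/belowP => i ij; rewrite mnmBE bj.
  by rewrite addmC submK // lep1mP.
- apply: LowNone; apply/mnmP => i; rewrite mnm0E; apply/eqP/contraT => mi.
  case: (arg_minnP (P := fun j => m j != 0%N) (fun j : 'I_n => nat_of_ord j) mi)
    => j mj min_j.
  have /negP[] := negbT (H j); rewrite mj; apply/belowP => l lj.
  by apply/eqP/contraT => /min_j; rewrite leqNgt lj.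
Qed.

Lemma below_add n (i j : 'I_n) (m : 'X_{1..n}) :
  (j <= i)%N -> below j m -> below j (U_(i) + m).
Proof.
move=> ji /belowP bj; apply/belowP => l lj.
rewrite mnmDE bj // mnm1E addn0; apply/eqP; rewrite eqb0.
by apply: contraTneq lj => <-; rewrite -leqNgt.
Qed.

Lemma below_le n (i j : 'I_n) (m : 'X_{1..n}) :
  (i <= j)%N -> below j m -> below i m.
Proof.
move=> ij /belowP bj; apply/belowP => l li; exact/bj/(leq_trans li).
Qed.

Section OrderedMonomials.
Variables (n : nat) (V : zmodType) (z : 'I_n -> V -> V).

(** The operators of smallest index are outermost: this is the ordered product x_1^(m_1) ...
    x_n^(m_n) acting on [v]. *)
Definition omon (m : 'X_{1..n}) v :=
  foldr (fun i w => iter (m i) (z i) w) v (enum 'I_n).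

Lemma omon0 v : omon 0%MM v = v.
Proof. by rewrite /omon; elim: (enum _) => //= i s ->; rewrite mnm0E. Qed.

Lemma omonU i m v : below i m -> omon (U_(i) + m)%MM v = z i (omon m v).
Proof.
move/belowP => im; rewrite /omon.
have: pairwise (fun a b : 'I_n => (a < b)%N) (enum 'I_n).
  have: pairwise ltn (map val (enum 'I_n)).
    by rewrite val_enum_ord -sorted_pairwise ?iota_ltn_sorted //; exact: ltn_trans.
  by rewrite pairwise_map.
have: i \in enum 'I_n by rewrite mem_enum.
elim: (enum _) => //= j s IHs; rewrite inE => /orP[/eqP<-|si] /andP[js ps].
- rewrite mnmDE mnm1E eqxx add1n iterS; congr (z i (iter _ _ _)).
  have: i \notin s by apply/negP => /(allP js); rewrite ltnn.
  elim: s {js ps IHs} => //= l s IHs; rewrite inE negb_or => /andP[il /IHs->].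
  by rewrite mnmDE mnm1E (negPf il).
- by have ji := allP js _ si; rewrite mnmDE mnm1E im // IHs //=;
    have /negPf-> : i != j by apply: contraTneq ji => ->; rewrite ltnn.
Qed.

Hypothesis zB : forall i, zmod_morphism (z i).

Lemma omon_is_additive m : zmod_morphism (omon m).
Proof.
move=> v w; rewrite /omon; elim: (enum _) => //= i s ->.
by elim: (m i) => //= k ->; rewrite zB.
Qed.

(** Normal-ordered evaluation: for left multiplications [z] it evaluates a polynomial at
    noncommuting elements, and for [z = pbw_op] it is the product [zstar]. *)
Definition zev (p : {mpoly int[n]}) v := mext (fun m c => omon m v *~ c) p.

Lemma zevB v : zmod_morphism (zev^~ v).
Proof. apply: mext_is_additive => m a b; exact: mulrzBr. Qed.

Lemma zevBr p : zmod_morphism (zev p).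
Proof.
move=> v w; rewrite /zev /mext -sumrB; apply: eq_bigr => m _.
by rewrite omon_is_additive mulrzBl.
Qed.

Lemma zevZX c m v : zev (c *: 'X_[m]) v = omon m v *~ c.
Proof. apply: (mextZX (g := fun m c => _)) => m' a b; exact: mulrzBr. Qed.

Lemma zevX m v : zev 'X_[m] v = omon m v.
Proof. by rewrite -[in LHS](scale1r 'X_[m]) zevZX. Qed.

End OrderedMonomials.

(** * The Poincare-Birkhoff-Witt theorem over the integers *)

(* Integral structure constants of generators [x_i] with commutators
   [x_i, x_j] = \sum_k cc i j k x_k + cd i j, where [cd] is a 2-cocycle. This
   covers enveloping algebras ([cd = 0]) as well as Weyl algebras ([cc = 0]). *)
Record sconst := SConst {
  rk : nat;
  cc : 'I_rk -> 'I_rk -> 'I_rk -> int;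
  cd : 'I_rk -> 'I_rk -> int;
  cc_anti : forall i j k, cc i j k = - cc j i k;
  cd_anti : forall i j, cd i j = - cd j i;
  cc_jacobi : forall i j l m, \sum_k
    (cc i j k * cc k l m + cc j l k * cc k i m + cc l i k * cc k j m) = 0;
  cd_cocycle : forall i j l, \sum_k
    (cc i j k * cd k l + cc j l k * cd k i + cc l i k * cd k j) = 0
}.

Section CommutingOperators.
Variable c : sconst.
Notation n := (rk c).

Definition brop (V : zmodType) (z : 'I_n -> V -> V) i j v :=
  \sum_k z k v *~ cc i j k + v *~ cd i j.

(** Stated at a single vector [v], since the relations for [pbw_op] are established by induction on
    the degree of [v]. *)
Definition commrel (V : zmodType) (z : 'I_n -> V -> V) i j v :=
  z i (z j v) - z j (z i v) = brop z i j v.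

Lemma cc0 i k : cc (s := c) i i k = 0.
Proof. have := cc_anti (s := c) i i k; lia. Qed.

Lemma cd0 i : cd (s := c) i i = 0.
Proof. have := cd_anti (s := c) i i; lia. Qed.

Section OneRepresentation.
Variables (V : zmodType) (z : 'I_n -> V -> V).
Hypothesis zB : forall i, zmod_morphism (z i).

Lemma brop_anti i j v : brop z i j v = - brop z j i v.
Proof.
rewrite /brop opprD -sumrN cd_anti mulrNz; congr (_ + _).
by apply: eq_bigr => k _; rewrite cc_anti mulrNz.
Qed.

Lemma brop0 i v : brop z i i v = 0.
Proof. by rewrite /brop cd0 mulr0z addr0 big1 // => k _; rewrite cc0 mulr0z. Qed.

Lemma bropB i j : zmod_morphism (brop z i j).
Proof.
move=> v w; rewrite /brop mulrzBl opprD addrACA -sumrB; congr (_ + _).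
by apply: eq_bigr => k _; rewrite zB mulrzBl.
Qed.

Lemma commrelxx i v : commrel z i i v.
Proof. by rewrite /commrel subrr brop0. Qed.

Lemma commrelC i j v : commrel z i j v -> commrel z j i v.
Proof. by rewrite /commrel => H; rewrite -opprB H -brop_anti. Qed.

Lemma commrelB i j v w : commrel z i j v -> commrel z i j w ->
  commrel z i j (v - w).
Proof.
by rewrite /commrel bropB !zB => <- <-; zgroup.
Qed.

Lemma commrelD i j v w : commrel z i j v -> commrel z i j w ->
  commrel z i j (v + w).
Proof.
move=> Hv Hw; rewrite -[w]opprK; apply: commrelB => //.
rewrite -sub0r; apply: commrelB => //.
by rewrite /commrel (zmorph0 (bropB i j)) !(zmorph0 (zB _)) subrr.
Qed.

Lemma brop_comm i j l v : (forall a b, commrel z a b v) ->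
  brop z i j (z l v) - z l (brop z i j v) =
  \sum_k brop z k l v *~ cc i j k.
Proof.
move=> H; rewrite /brop (zmorphD (zB l)) (zmorph_sum (zB l)).
rewrite [z l (v *~ _)](zmorphMz (zB l)) opprD addrACA subrr addr0 -sumrB.
apply: eq_bigr => k _.
by rewrite (zmorphMz (zB l)) -mulrzBl H.
Qed.

(** The terms in [z m v] cancel by [cc_jacobi] and the multiples of [v] by [cd_cocycle]: this is
    where these two conditions on the structure constants enter. *)
Lemma brop_jacobi i j l v : \sum_k (brop z k l v *~ cc i j k
  + brop z k i v *~ cc j l k + brop z k j v *~ cc l i k) = 0.
Proof.
rewrite /brop; under eq_bigr => k _ do rewrite !mulrzDl.
have E (a b d e f g : V) : a + b + (d + e) + (f + g) = (a + d + f) + (b + e + g).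
  by zgroup.
under eq_bigr => k _ do rewrite E.
rewrite big_split /=.
under [X in _ + X]eq_bigr => k _ do
  rewrite -!mulrzA -!mulrzDr ![cd _ _ * _]mulrC.
rewrite -mulrz_sumr cd_cocycle mulr0z addr0.
under eq_bigr => k _ do rewrite !mulrz_suml -!big_split /=.
rewrite exchange_big big1 // => m _ /=.
under eq_bigr => k _ do rewrite -!mulrzA -!mulrzDr.
rewrite -mulrz_sumr -[RHS](mulr0z (z m v)); congr (_ *~ _).
rewrite -[RHS](cc_jacobi i j l m); apply: eq_bigr => k _.
by congr (_ + _ + _); rewrite mulrC.
Qed.

(* The step of Serre's proof of the Poincare-Birkhoff-Witt theorem where the
   Jacobi identity is used. *)
Lemma commrel_step i j l v : (forall a b, commrel z a b v) ->
  commrel z i l (z j v) -> commrel z j l (z i v) -> commrel z i j (z l v).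
Proof.
move=> Hv Hil Hjl.
(* Both orders of the triple product are rewritten with [z l] in front; the leftover brackets then
   cancel by [brop_jacobi]. *)
have swap a b : commrel z a l (z b v) ->
    z a (z b (z l v)) = z l (z a (z b v)) + brop z a l (z b v) + z a (brop z b l v).
  move=> Hal; have /eqP := Hv b l; rewrite subr_eq => /eqP ->.
  move/eqP: Hal; rewrite subr_eq (zmorphD (zB a)) => /eqP ->.
  by rewrite addrC [brop _ _ _ _ + _]addrC.
rewrite /commrel (swap i j) // (swap j i) //.
have E : z l (z i (z j v)) - z l (z j (z i v)) = z l (brop z i j v).
  by rewrite -zB Hv.
have B1 := brop_comm i j l Hv.
have B2 := brop_comm i l j Hv.
have B3 := brop_comm j l i Hv.
have J := brop_jacobi i j l v.
rewrite !big_split /= in J.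
have Eli : \sum_k brop z k j v *~ cc l i k = - \sum_k brop z k j v *~ cc i l k.
  by rewrite -sumrN; apply: eq_bigr => k _; rewrite cc_anti mulrNz.
rewrite Eli -B1 -B2 -B3 -E in J.
apply/eqP; rewrite -subr_eq0 -oppr_eq0; apply/eqP; rewrite -[RHS]J.
zgroup.
Qed.

End OneRepresentation.

(* [pact d i m] is the action of [x_i] on the ordered monomial [m], for a fuel
   [d >= mdeg m]: if [m = x_j m'] with [j] minimal and [j < i], it is read off
   [x_i x_j m' = x_j (x_i m') + [x_i, x_j] m'], where [x_i m'] differs from the
   commutative product by terms of degree at most that of [m']. *)
Fixpoint pact (d : nat) (i : 'I_n) (m : 'X_{1..n}) : {mpoly int[n]} :=
  let straight := 'X_[U_(i) + m] in
  if d is d'.+1 then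
    if low m is Some j then
      if (j < i)%N then
        let m' := (m - U_(j))%MM in
        straight
        + mext (fun q a => pact d' j q *~ a) (pact d' i m' - 'X_[U_(i) + m'])
        + (\sum_k pact d' k m' *~ cc i j k + 'X_[m'] *~ cd i j)
      else straight
    else straight
  else straight.

Lemma mextMz_B (V : zmodType) (f : 'X_{1..n} -> V) :
  zmod_morphism (mext (fun q (a : int) => f q *~ a)).
Proof. by apply: mext_is_additive => m a b; exact: mulrzBr. Qed.

Lemma msizeMz (p : {mpoly int[n]}) k d :
  (msize p <= d)%N -> (msize (p *~ k) <= d)%N.
Proof.
move=> pd; apply/(leq_trans _ pd)/msize_le_mcoeff => m.
rewrite (zmorphMz (@mcoeffB _ _ m)) => H; apply: msize_mcoeff.
by apply: contraNneq H => ->; rewrite mul0rz.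
Qed.

Lemma msizeD_bound (p q : {mpoly int[n]}) d :
  (msize p <= d)%N -> (msize q <= d)%N -> (msize (p + q) <= d)%N.
Proof. by move=> pd qd; rewrite (leq_trans (msizeD_le _ _)) // geq_max pd. Qed.

Lemma msize_sum_bound (I : Type) (r : seq I) (P : pred I)
    (F : I -> {mpoly int[n]}) d :
  (forall i, P i -> (msize (F i) <= d)%N) ->
  (msize (\sum_(i <- r | P i) F i) <= d)%N.
Proof.
by move=> H; elim/big_ind: _ => // [|p q]; [rewrite msize0|exact: msizeD_bound].
Qed.

(** The inner call of [pact] is made on the monomials of a correction, which by this bound have
    degree at most [mdeg m']; so the remaining fuel suffices there. *)
Lemma pact_bound d i m : (mdeg m <= d)%N ->
  (msize (pact d i m - 'X_[U_(i) + m]) <= (mdeg m).+1)%N.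
Proof.
elim: d i m => [|d IHd] i m md /=; first by rewrite subrr msize0.
case: lowP => [_|j _ Em]; first by rewrite subrr msize0.
case: ifP => ji; last by rewrite subrr msize0.
set m' := (m - U_(j))%MM in Em *.
have Edeg : mdeg m = (mdeg m').+1 by rewrite Em mdegD mdeg1.
have m'd : (mdeg m' <= d)%N by lia.
have pact_size k q : (mdeg q <= d)%N -> (msize (pact d k q) <= (mdeg q).+2)%N.
  move=> qd; rewrite -(subrK 'X_[U_(k) + q] (pact d k q)) msizeD_bound //.
    exact/leqW/IHd.
  by rewrite msizeX mdegD mdeg1.
rewrite addrC -addrA addKr; apply: msizeD_bound.
  rewrite /mext big_seq; apply: msize_sum_bound => q q_in.
  have := leq_trans (msize_mdeg_lt q_in) (IHd i m' m'd) => qd.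
  apply/msizeMz/(leq_trans (pact_size _ _ _)); lia.
apply: msizeD_bound; last by apply: msizeMz; rewrite msizeX Edeg.
by apply: msize_sum_bound => k _; apply: msizeMz; rewrite Edeg pact_size.
Qed.

Lemma pact_stable d e i m : (mdeg m <= d)%N -> (mdeg m <= e)%N ->
  pact d i m = pact e i m.
Proof.
elim: d e i m => [|d IHd] [|e] i m md me //=.
- by move: md; rewrite leqn0 mdeg_eq0 => /eqP->; case: lowP => // j _ /esym/eqP;
    rewrite mnmD_eq0 mnm1_eq0.
- by move: me; rewrite leqn0 mdeg_eq0 => /eqP->; case: lowP => // j _ /esym/eqP;
    rewrite mnmD_eq0 mnm1_eq0.
case: lowP => // j _ Em; case: ifP => // ji.
set m' := (m - U_(j))%MM in Em *.
have Edeg : mdeg m = (mdeg m').+1 by rewrite Em mdegD mdeg1.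
have [m'd m'e] : (mdeg m' <= d)%N /\ (mdeg m' <= e)%N by lia.
rewrite (IHd e) //; congr (_ + _ + (_ + _)); last first.
  by apply: eq_bigr => k _; rewrite (IHd e).
rewrite /mext !big_seq; apply: eq_bigr => q q_in.
have := leq_trans (msize_mdeg_lt q_in) (pact_bound i m'e) => qd.
by rewrite (IHd e) //; lia.
Qed.

Definition pbw_op (i : 'I_n) : {mpoly int[n]} -> {mpoly int[n]} :=
  mext (fun m a => pact (mdeg m) i m *~ a).

Lemma pbw_opB i : zmod_morphism (pbw_op i).
Proof. exact: mextMz_B. Qed.

Lemma pbw_opX i m : pbw_op i 'X_[m] = pact (mdeg m) i m.
Proof.
rewrite -[in LHS](scale1r 'X_[m]) /pbw_op mextZX ?mulr1z // => q a b.
exact: mulrzBr.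
Qed.

Lemma pbw_op_bound i m :
  (msize (pbw_op i 'X_[m] - 'X_[U_(i) + m]) <= (mdeg m).+1)%N.
Proof. by rewrite pbw_opX; exact: pact_bound. Qed.

Lemma pbw_op_below i m : below i m -> pbw_op i 'X_[m] = 'X_[U_(i) + m].
Proof.
move=> /belowP im; rewrite pbw_opX; case: (mdeg m) => //= d.
case: lowP => // j _ Em; case: ifP => // /im.
by rewrite Em mnmDE mnm1E eqxx.
Qed.

(** The recursive equation of [pact], freed from its fuel. The straight term there is the value of
    [pbw_op j] at ['X_[U_(i) + m]], as [j] is below that monomial. *)
Lemma pbw_op_low (i j : 'I_n) m : (j < i)%N -> below j m ->
  pbw_op i 'X_[U_(j) + m] =
  pbw_op j (pbw_op i 'X_[m]) + brop pbw_op i j 'X_[m].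
Proof.
move=> ji jm; rewrite (pbw_opX i (U_(j) + m)) mdegD mdeg1 /=.
case: lowP => [/eqP|j' j'b E]; first by rewrite mnmD_eq0 mnm1_eq0.
have Ej : j' = j.
  apply/val_inj; case: (ltngtP (val j') (val j)) => // [j'j|jj'].
    have : (U_(j) + m)%MM j' = 0%N.
      by apply: (belowP _ _ _ _ j'j); exact: below_add.
    by rewrite E mnmDE mnm1E eqxx.
  have : (U_(j) + m)%MM j = 0%N.
    by apply: (belowP _ _ _ _ jj'); rewrite E; exact: below_add.
  by rewrite mnmDE mnm1E eqxx.
subst j'; rewrite ji {E j'b}.
have -> : (U_(j) + m - U_(j))%MM = m by rewrite addmC addmK.
rewrite -(pbw_opX i m); congr (_ + _); last first.
  by rewrite /brop; congr (_ + _); apply: eq_bigr => k _; rewrite pbw_opX.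
have Em : pbw_op i 'X_[m] = 'X_[U_(i) + m] + (pbw_op i 'X_[m] - 'X_[U_(i) + m]).
  by rewrite addrC subrK.
rewrite [in RHS]Em (zmorphD (pbw_opB j)).
rewrite (pbw_op_below (i := j)) ?below_add 1?ltnW //.
congr ('X_[_] + _); first by rewrite !addmA (addmC U_(i)%MM).
move: (pbw_op_bound i m); move: (pbw_op i 'X_[m] - _) => w w_bound.
rewrite /pbw_op /mext !big_seq; apply: eq_bigr => q q_in; congr (_ *~ _).
apply: pact_stable => //; have := leq_trans (msize_mdeg_lt q_in) w_bound; lia.
Qed.

(** Closure under subtraction suffices because the coefficients are integers: every term is a
    repeated sum of a monomial or of its opposite. *)
Lemma monomial_ind (P : {mpoly int[n]} -> Prop) d :
  (forall p q, P p -> P q -> P (p - q)) -> P 0 ->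
  (forall m, (mdeg m < d)%N -> P 'X_[m]) ->
  forall p, (msize p <= d)%N -> P p.
Proof.
move=> PB P0 PX p pd.
have PN q : P q -> P (- q) by move=> Pq; rewrite -sub0r; exact: PB.
have PD q r : P q -> P r -> P (q + r).
  by move=> Pq Pr; rewrite -[r]opprK; exact/PB/PN.
rewrite (mpolyE p) big_seq; apply: big_ind => // m m_in.
have /PX : (mdeg m < d)%N by exact: leq_trans (msize_mdeg_lt m_in) pd.
move: (p@_m) => a Pm.
have PMn k : P (k%:R *: 'X_[m]).
  elim: k => [|k IHk]; first by rewrite scale0r.
  by rewrite mulrS scalerDl scale1r; exact: PD.
case: a => k; first by rewrite -(natz k); exact: PMn.
by rewrite NegzE -natz scaleNr; exact/PN/PMn.
Qed.

(** If one of the two indices is below the monomial, the relation is [pbw_op_low]. Otherwise the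
    monomial starts with some [x_l], with [l] smaller than both, and [commrel_step] reduces the
    claim to relations involving [x_l]. *)
Lemma pbw_op_commrel i j p : commrel pbw_op i j p.
Proof.
have zero a b : commrel pbw_op a b 0.
  rewrite /commrel !(zmorph0 (pbw_opB _)) subrr.
  by rewrite (zmorph0 (bropB pbw_opB a b)).
have side a b m : below a m -> commrel pbw_op a b 'X_[m].
  move=> am; case: (ltngtP (val a) b) => [ab|ba|/val_inj ->].
  - apply: commrelC; rewrite /commrel [pbw_op a _]pbw_op_below //.
    by rewrite pbw_op_low // addrC addKr.
  - have bm : below b m by exact/below_le/am/ltnW.
    rewrite /commrel [pbw_op b _]pbw_op_below // pbw_op_low //.
    by rewrite addrC addKr.
  - exact: commrelxx.
suff H d m a b : (mdeg m < d)%N -> commrel pbw_op a b 'X_[m].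
  apply: (monomial_ind (d := msize p)) => [q r||m _|//].
  - exact/commrelB/pbw_opB.
  - exact: zero.
  exact: H (ltnSn _).
elim: d m a b => // d IHd m a b md.
case: (boolP (below a m)) => [am|nam]; first exact: side.
case: (boolP (below b m)) => [bm|nbm]; first exact/commrelC/side.
case: (lowP m) => [Em|l lm' Em].
  by case/negP: nam; rewrite Em; apply/belowP => ? _; rewrite mnm0E.
set m' := (m - U_(l))%MM in lm' Em.
have m'd : (mdeg m' < d)%N.
  by rewrite -ltnS (leq_trans _ md) // Em mdegD mdeg1.
have lt_l (x : 'I_n) : ~~ below x m -> (l < x)%N.
  move=> nx; rewrite ltnNge; apply: contra nx => xl.
  by apply: (below_le xl); rewrite Em; exact: below_add.
have [la lb] := (lt_l a nam, lt_l b nbm).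
(* Up to terms of degree less than [d], covered by induction, [pbw_op x 'X_[m']] is a monomial that
   [l] is below, to which [side] applies. *)
have aux (x y : 'I_n) : (l < x)%N -> commrel pbw_op y l (pbw_op x 'X_[m']).
  move=> lx; rewrite -(subrK 'X_[U_(x) + m'] (pbw_op x 'X_[m'])).
  apply: commrelD; first exact: pbw_opB.
    apply: (monomial_ind (d := d)) => [q r||q qd|].
    - exact/commrelB/pbw_opB.
    - exact: zero.
    - exact: IHd.
    exact: leq_trans (pbw_op_bound _ _) m'd.
  by apply/commrelC/side/below_add => //; exact: ltnW.
rewrite Em -(pbw_op_below lm').
by apply: commrel_step; [exact: pbw_opB | move=> *; exact: IHd | exact: aux..].
Qed.

(** The independence half of the Poincare-Birkhoff-Witt theorem: the ordered products of the
    operators send 1 to distinct basis elements. *)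
Lemma omon_pbw_op m : omon pbw_op m 1 = 'X_[m].
Proof.
elim: {m}(mdeg m) {-2}m (leqnn (mdeg m)) => [|d IHd] m md.
  by move: md; rewrite leqn0 mdeg_eq0 => /eqP ->; rewrite omon0 mpolyX0.
case: (lowP m) => [->|j jm' Em]; first by rewrite omon0 mpolyX0.
rewrite Em omonU // IHd ?pbw_op_below //.
by rewrite -ltnS (leq_trans _ md) // [X in (_ < mdeg X)%N]Em mdegD mdeg1.
Qed.

Section Straightening.
Variables (V : zmodType) (z : 'I_n -> V -> V).
Hypotheses (zB : forall i, zmod_morphism (z i)).
Hypothesis zC : forall i j v, commrel z i j v.

Lemma zev_brop i j p v : (forall k, zev z (pbw_op k p) v = z k (zev z p v)) ->
  zev z (brop pbw_op i j p) v = brop z i j (zev z p v).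
Proof.
move=> H; have fB := zevB z v.
rewrite /brop (zmorphD fB) (zmorphMz fB) (zmorph_sum fB); congr (_ + _).
by apply: eq_bigr => k _; rewrite (zmorphMz fB) H.
Qed.

(** Straightening by [pbw_op] uses only the relations, which hold for [z] too; so every
    representation receives an equivariant map from the one on polynomials. *)
Lemma zev_pbw_op i p v : zev z (pbw_op i p) v = z i (zev z p v).
Proof.
have fB := zevB z v.
have eB := pbw_opB.
have zero k : zev z (pbw_op k 0) v = z k (zev z 0 v).
  by rewrite (zmorph0 (eB k)) (zmorph0 fB) (zmorph0 (zB k)).
have sub k q r : zev z (pbw_op k q) v = z k (zev z q v) ->
    zev z (pbw_op k r) v = z k (zev z r v) ->
    zev z (pbw_op k (q - r)) v = z k (zev z (q - r) v).
  by move=> Hq Hr; rewrite eB !fB zB Hq Hr.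
have side k m : below k m -> zev z (pbw_op k 'X_[m]) v = z k (zev z 'X_[m] v).
  by move=> km; rewrite pbw_op_below // !zevX omonU.
suff H d m k : (mdeg m < d)%N ->
    zev z (pbw_op k 'X_[m]) v = z k (zev z 'X_[m] v).
  apply: (monomial_ind (d := msize p)
    (P := fun p => zev z (pbw_op i p) v = z i (zev z p v))) =>
    [q r||m _|//]; [exact: sub|exact: zero|].
  exact: H (ltnSn _).
elim: d m k => // d IHd m k md.
case: (lowP m) => [->|l lm' Em].
  by apply: side; apply/belowP => j _; rewrite mnm0E.
set m' := (m - U_(l))%MM in lm' Em; rewrite Em.
have m'd : (mdeg m' < d)%N.
  by rewrite -ltnS (leq_trans _ md) // Em mdegD mdeg1.
have [kl|lk] := leqP k l; first exact/side/below_add/below_le/lm'.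
rewrite pbw_op_low // (zmorphD fB) zev_brop; last by move=> j; exact: IHd.
have -> : zev z (pbw_op l (pbw_op k 'X_[m'])) v = z l (z k (zev z 'X_[m'] v)).
  rewrite -(IHd m' k) //.
  rewrite -(subrK 'X_[U_(k) + m'] (pbw_op k 'X_[m'])) (zmorphD (eB l)).
  move: (pbw_op_bound k m'); move: (pbw_op k 'X_[m'] - _) => w w_bound.
  rewrite !(zmorphD fB) (zmorphD (zB l)); congr (_ + _).
    apply: (monomial_ind (d := d)
      (P := fun p => zev z (pbw_op l p) v = z l (zev z p v))) =>
      [q r||q qd|]; [exact: sub|exact: zero|exact: IHd|].
    exact: leq_trans w_bound m'd.
  by apply/side/below_add => //; exact: ltnW.
by rewrite -zC addrC subrK !zevX omonU.
Qed.

Lemma zev_omon m p v : zev z (omon pbw_op m p) v = omon z m (zev z p v).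
Proof.
rewrite /omon; elim: (enum _) => //= i s IHs.
by elim: (m i) => //= k IHk; rewrite zev_pbw_op IHk.
Qed.

Lemma zev_zev p q v : zev z (zev pbw_op p q) v = zev z p (zev z q v).
Proof.
have fB := zevB z v.
rewrite {2}/zev /mext (zmorph_sum fB); apply: eq_bigr => m _.
by rewrite (zmorphMz fB) zev_omon.
Qed.

End Straightening.

Definition zstar p q := zev pbw_op p q.

(** [pbw_op] is itself a representation of the relations, so that associativity is [zev_zev] applied
    to it. *)
Lemma zstarA p q r : zstar (zstar p q) r = zstar p (zstar q r).
Proof. by rewrite /zstar zev_zev //; [exact: pbw_opB|exact: pbw_op_commrel]. Qed.

Lemma zstar1 p : zstar p 1 = p.
Proof.
rewrite /zstar; pose f := zev pbw_op ^~ 1.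
apply: (eq_additive_mpoly (f := f) (g := id)) => // [|a m]; first exact: zevB.
by rewrite /f zevZX omon_pbw_op -scaler_int intz.
Qed.

Lemma zstar1l p : zstar 1 p = p.
Proof. by rewrite /zstar -mpolyX0 zevX omon0. Qed.

End CommutingOperators.

(** * The algebra with given structure constants *)

Section MapCoefficients.
Variables (n : nat) (R S : nzRingType) (f : R -> S).

(** [f] is a bare function because it will also be a specialization, which respects the operations
    on a subring only. *)
Definition mcoefmap (p : {mpoly R[n]}) : {mpoly S[n]} :=
  \sum_(m <- msupp p) f p@_m *: 'X_[m].

Lemma mcoeff_coefmap p m : f 0 = 0 -> (mcoefmap p)@_m = f p@_m.
Proof.
move=> f0; rewrite /mcoefmap raddf_sum /=.
under eq_bigr => q _ do rewrite mcoeffZ mcoeffX.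
have [mp|mp] := boolP (m \in msupp p).
  rewrite (bigD1_seq m) ?msupp_uniq //= eqxx mulr1 big1 ?addr0 // => q /negPf->.
  by rewrite mulr0.
rewrite big_seq big1 => [|q qp]; first by rewrite (memN_msupp_eq0 mp) f0.
by have /negPf-> : q != m by [apply: contraNneq mp => <-]; rewrite mulr0.
Qed.

End MapCoefficients.

Section Star.
Variables (c : sconst).
Notation n := (rk c).

(** Up to strictly lower degree, ordered monomials multiply like commutative ones; the
    multiplicativity of leading monomials rests on this. *)
Lemma omon_pbw_op_bound a b :
  (msize (omon (@pbw_op c) a 'X_[b] - 'X_[a + b]) <= mdeg a + mdeg b)%N.
Proof.
elim: {a}(mdeg a) {-2}a (leqnn (mdeg a)) => [|d IHd] a ad.
  move: ad; rewrite leqn0 mdeg_eq0 => /eqP ->.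
  by rewrite omon0 add0m subrr msize0.
case: (lowP a) => [->|j ja Ea]; first by rewrite omon0 add0m subrr msize0.
set a' := (a - U_(j))%MM in ja Ea; rewrite Ea omonU //.
have a'd : (mdeg a' <= d)%N by rewrite -ltnS (leq_trans _ ad) // Ea mdegD mdeg1.
have := IHd a' a'd.
rewrite -{2}(subrK 'X_[a' + b] (omon _ a' _)).
move: (omon _ a' _ - _) => w w_bound; rewrite (zmorphD (pbw_opB j)) -addrA.
rewrite mdegD mdeg1 add1n addSn; apply: msizeD_bound; last first.
  by have := pbw_op_bound j (a' + b); rewrite mdegD addmA.
rewrite /pbw_op /mext big_seq; apply: msize_sum_bound => q q_in.
have := leq_trans (msize_mdeg_lt q_in) w_bound => qd.
apply/msizeMz; rewrite -(subrK 'X_[U_(j) + q] (pact _ _ _)); apply: msizeD_bound.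
  by apply: (leq_trans (pact_bound _ _)) => //; lia.
by rewrite msizeX mdegD mdeg1.
Qed.

Variable R : comNzRingType.
Implicit Types p q r : {mpoly R[n]}.

Definition star_mon a b : {mpoly R[n]} := mcoefmap intr (omon (@pbw_op c) a 'X_[b]).

Lemma mcoeff_star_mon a b m :
  (star_mon a b)@_m = ((omon (@pbw_op c) a 'X_[b])@_m)%:~R.
Proof. by rewrite mcoeff_coefmap. Qed.

Lemma star_mon_bound a b : (msize (star_mon a b - 'X_[a + b]) <= mdeg a + mdeg b)%N.
Proof.
apply: leq_trans (omon_pbw_op_bound a b); apply: msize_le_mcoeff => m H.
apply: msize_mcoeff; apply: contraNneq H; rewrite !mcoeffB mcoeff_star_mon.
by rewrite !mcoeffX => /eqP; rewrite subr_eq0 => /eqP ->; rewrite mulrz_nat subrr.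
Qed.

(* The product of two ordered monomials has integral coefficients that depend
   neither on [R] nor on the ring where the generators are evaluated. *)
Definition star p q :=
  mext (fun a x => mext (fun b y => (x * y) *: star_mon a b) q) p.

Lemma star_inner a x :
  forall b, zmod_morphism (fun y : R => (x * y) *: star_mon a b).
Proof. by move=> b y z; rewrite mulrBr scalerBl. Qed.

Lemma star_outer q : forall a, zmod_morphism
  (fun x : R => mext (fun b y => (x * y) *: star_mon a b) q).
Proof.
move=> a x y; rewrite /mext -sumrB; apply: eq_bigr => b _.
by rewrite mulrBl scalerBl.
Qed.

Lemma starBl q : zmod_morphism (star^~ q).
Proof. by apply: mext_is_additive; exact: star_outer. Qed.

Lemma starBr p : zmod_morphism (star p).
Proof.
move=> q r; rewrite /star /mext -sumrB; apply: eq_bigr => a _.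
exact: (mext_is_additive (star_inner a _)).
Qed.

Lemma starZX x a y b : star (x *: 'X_[a]) (y *: 'X_[b]) = (x * y) *: star_mon a b.
Proof. by rewrite /star (mextZX _ _ (star_outer _)) mextZX //; exact: star_inner. Qed.

Lemma eq_biadditive (f g : {mpoly R[n]} -> {mpoly R[n]} -> {mpoly R[n]}) :
  (forall q, zmod_morphism (f^~ q)) -> (forall p, zmod_morphism (f p)) ->
  (forall q, zmod_morphism (g^~ q)) -> (forall p, zmod_morphism (g p)) ->
  (forall x a y b, f (x *: 'X_[a]) (y *: 'X_[b]) = g (x *: 'X_[a]) (y *: 'X_[b])) ->
  f =2 g.
Proof.
move=> fl fr gl gr H p q; apply: (eq_additive_mpoly (fl q) (gl q)) => x a.
by apply: (eq_additive_mpoly (fr _) (gr _)) => y b.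
Qed.

Lemma starZl t p q : star (t *: p) q = t *: star p q.
Proof.
move: p q; apply: eq_biadditive => [q x y|p x y|q x y|p x y|x a y b].
- by rewrite scalerBr starBl.
- by rewrite starBr.
- by rewrite starBl scalerBr.
- by rewrite starBr scalerBr.
- by rewrite scalerA !starZX scalerA mulrA.
Qed.

Lemma starZr t p q : star p (t *: q) = t *: star p q.
Proof.
move: p q; apply: eq_biadditive => [q x y|p x y|q x y|p x y|x a y b].
- by rewrite starBl.
- by rewrite scalerBr starBr.
- by rewrite starBl scalerBr.
- by rewrite starBr scalerBr.
- by rewrite scalerA !starZX scalerA mulrCA mulrA.
Qed.

Lemma starXX a b : star 'X_[a] 'X_[b] = star_mon a b.
Proof. by rewrite -['X_[a]]scale1r -['X_[b]]scale1r starZX mulr1 scale1r. Qed.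

End Star.

Section StarRing.
Variables (c : sconst) (R : comNzRingType).
Notation n := (rk c).
Local Notation base := (@mcoefmap n int R intr).
Local Notation star := (@star c R).

Lemma baseB : zmod_morphism base.
Proof.
by move=> p q; apply/mpolyP => m; rewrite mcoeffB !mcoeff_coefmap // mcoeffB intrB.
Qed.

Lemma baseZX k m : base (k *: 'X_[m]) = k%:~R *: 'X_[m].
Proof.
apply/mpolyP => q; rewrite mcoeff_coefmap // !mcoeffZ !mcoeffX intrM.
by case: (m == q).
Qed.

Lemma baseX m : base 'X_[m] = 'X_[m].
Proof. by rewrite -[LHS]/(base _) -['X_[m]]scale1r baseZX !scale1r. Qed.

Lemma base_star p q : base (zstar (c := c) p q) = star (base p) (base q).
Proof.
have zB := baseB; have [sl sr] := (@starBl c R, @starBr c R).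
have zl (x : {mpoly int[n]}) : zmod_morphism (@zstar c ^~ x) by exact: zevB.
have zr (x : {mpoly int[n]}) : zmod_morphism (@zstar c x).
  by apply: zevBr; exact: pbw_opB.
pose f := fun x => base (zstar x q); pose g := fun x => star (base x) (base q).
apply: (eq_additive_mpoly (f := f) (g := g)) => [x y|x y|k a].
- by rewrite /f zl zB.
- by rewrite /g zB sl.
pose f' := fun x => base (zstar (k *: 'X_[a]) x).
pose g' := fun x => star (base (k *: 'X_[a])) (base x).
apply: (eq_additive_mpoly (f := f') (g := g')) => [x y|x y|l b].
- by rewrite /f' zr zB.
- by rewrite /g' zB sr.
rewrite /f' /g' !baseZX starZX /zstar zevZX.
have -> : l *: 'X_[b] = 'X_[b] *~ l :> {mpoly int[n]} by rewrite -scaler_int intz.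
rewrite (zmorphMz (omon_is_additive (@pbw_opB c) a)) -mulrzA mulrC.
by rewrite (zmorphMz zB) -scaler_int intrM.
Qed.

Lemma starA : associative star.
Proof.
move=> p q r; apply/esym.
have [sl sr] := (@starBl c R, @starBr c R).
pose f x := star (star x q) r; pose g x := star x (star q r).
apply: (eq_additive_mpoly (f := f) (g := g)) => [x y|x y|t a].
- by rewrite /f !sl.
- by rewrite /g !sl.
rewrite /f /g {f g} !starZl; congr (_ *: _).
pose f x := star (star 'X_[a] x) r; pose g x := star 'X_[a] (star x r).
apply: (eq_additive_mpoly (f := f) (g := g)) => [x y|x y|u b].
- by rewrite /f sr sl.
- by rewrite /g sl sr.
rewrite /f /g {f g} starZl !starZr starZl; congr (_ *: _).
pose f x := star (star 'X_[a] 'X_[b]) x; pose g x := star 'X_[a] (star 'X_[b] x).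
apply: (eq_additive_mpoly (f := f) (g := g)) => [x y|x y|v d].
- by rewrite /f sr.
- by rewrite /g !sr.
rewrite /f /g {f g} !starZr; congr (_ *: _).
(* On monomials both sides are images of integral polynomials, for which associativity is known. *)
by rewrite -!baseX -!base_star zstarA.
Qed.

Lemma base1 : base 1 = 1.
Proof. by rewrite -!mpolyX0 baseX. Qed.

Lemma star1p : left_id 1 star.
Proof.
apply: eq_additive_mpoly => [x y|//|t a]; first exact: starBr.
by rewrite starZr -base1 -baseX -base_star zstar1l.
Qed.

Lemma starp1 : right_id 1 star.
Proof.
apply: eq_additive_mpoly => [x y|//|t a]; first exact: starBl.
by rewrite starZl -base1 -baseX -base_star zstar1.
Qed.

Lemma starDl : left_distributive star +%R.
Proof. by move=> p q r; rewrite (zmorphD (starBl r)). Qed.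

Lemma starDr : right_distributive star +%R.
Proof. by move=> p q r; rewrite (zmorphD (starBr p)). Qed.

End StarRing.

(* The algebra presented by the generators and relations of [c], realized on the
   span of the ordered monomials; it has the product [star], not the product of
   the polynomial ring. *)
Definition pbw (c : sconst) (R : comNzRingType) : Type := {mpoly R[rk c]}.

Section PbwAlgebra.
Variables (c : sconst) (R : comNzRingType).

HB.instance Definition _ := GRing.Lmodule.copy (pbw c R) {mpoly R[rk c]}.

Lemma pbw1_neq0 : (1 : {mpoly R[rk c]}) != 0 :> pbw c R.
Proof. exact: oner_neq0. Qed.

HB.instance Definition _ := GRing.Zmodule_isNzRing.Build (pbw c R)
  (@starA c R) (@star1p c R) (@starp1 c R) (@starDl c R) (@starDr c R) pbw1_neq0.

Fact pbw_scaleAl (a : R) (u v : pbw c R) : a *: (u * v) = (a *: u : pbw c R) * v.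
Proof. exact: (esym (@starZl c R a u v)). Qed.

HB.instance Definition _ := GRing.Lmodule_isLalgebra.Build R (pbw c R) pbw_scaleAl.

Fact pbw_scaleAr (a : R) (u v : pbw c R) : a *: (u * v) = u * (a *: v : pbw c R).
Proof. exact: (esym (@starZr c R a u v)). Qed.

HB.instance Definition _ := GRing.Lalgebra_isAlgebra.Build R (pbw c R) pbw_scaleAr.

Definition pmon (m : 'X_{1..rk c}) : pbw c R := 'X_[m].

Definition pgen i := pmon U_(i).

End PbwAlgebra.

Lemma lrmorphism_pack (R : nzRingType) (A B : lalgType R) (f : A -> B) :
  linear f -> monoid_morphism f -> exists g : {lrmorphism A -> B}, g =1 f.
Proof.
move=> fl fm; pose L := GRing.isLinear.Build R A B _ f fl.
pose M := GRing.isMonoidMorphism.Build A B f fm.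
by exists (HB.pack f L M : {lrmorphism A -> B}).
Qed.

Lemma low_ind n (P : 'X_{1..n} -> Prop) : P 0%MM ->
  (forall j m, below j m -> P m -> P (U_(j) + m)%MM) -> forall m, P m.
Proof.
move=> P0 PU m; elim: {m}(mdeg m) {-2}m (leqnn (mdeg m)) => [|d IHd] m md.
  by move: md; rewrite leqn0 mdeg_eq0 => /eqP ->.
case: (lowP m) => [-> //|j jm Em]; rewrite Em; apply: PU => //; apply: IHd.
by rewrite -ltnS (leq_trans _ md) // [X in (_ < mdeg X)%N]Em mdegD mdeg1.
Qed.

(** * Evaluation of the presented algebra at elements satisfying its relations *)

Section Evaluation.
Variables (c : sconst) (R : comNzRingType).
Notation n := (rk c).

Definition srel (B : nzRingType) (z : 'I_n -> B) := forall i j,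
  z i * z j - z j * z i = \sum_k z k *~ cc i j k + (cd i j)%:~R.

Section InAlgebra.
Variables (B : algType R) (z : 'I_n -> B).

Lemma mulB i : zmod_morphism (fun v : B => z i * v).
Proof. by move=> v w; rewrite mulrBr. Qed.

Definition zmon m : B := omon (fun i v => z i * v) m 1.

Lemma zmon0 : zmon 0%MM = 1. Proof. exact: omon0. Qed.

Lemma zmonU i m : below i m -> zmon (U_(i) + m)%MM = z i * zmon m.
Proof. by move=> im; rewrite /zmon omonU. Qed.

Lemma omon_zmon m v : omon (fun i v => z i * v) m v = zmon m * v.
Proof.
rewrite /zmon /omon; elim: (enum _) => /= [|i s ->]; first by rewrite mul1r.
by elim: (m i) => //= k ->; rewrite mulrA.
Qed.

Definition pev (p : pbw c R) : B := mext (fun m a => a *: zmon m) p.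

Lemma pev_scale m : zmod_morphism (fun a : R => a *: zmon m).
Proof. by move=> a b; rewrite scalerBl. Qed.

Lemma pevZ a m : pev (a *: pmon R m) = a *: zmon m.
Proof. by rewrite /pev mextZX //; exact: pev_scale. Qed.

Lemma pev_mon m : pev (pmon R m) = zmon m.
Proof. by rewrite -[pmon R m]scale1r pevZ scale1r. Qed.

Lemma pevB : zmod_morphism pev.
Proof. exact/mext_is_additive/pev_scale. Qed.

Lemma pev_linear : linear pev.
Proof.
move=> a p q; rewrite (zmorphD pevB); congr (_ + _).
pose f (x : pbw c R) := pev (a *: x); pose g x := a *: pev x.
apply: (eq_additive_mpoly (f := f) (g := g)) => [x y|x y|b m].
- by rewrite /f scalerBr pevB.
- by rewrite /g pevB scalerBr.
by rewrite /f /g -[b *: _]/(b *: pmon R m) scalerA !pevZ scalerA.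
Qed.

Lemma pev_base (p : {mpoly int[n]}) :
  pev (mcoefmap intr p : {mpoly R[n]}) = zev (fun i v => z i * v) p 1.
Proof.
pose f (x : {mpoly int[n]}) := pev (mcoefmap intr x : {mpoly R[n]}).
pose g x := zev (fun i v => z i * v) x 1.
apply: (eq_additive_mpoly (f := f) (g := g)) => [x y|x y|k m].
- by rewrite /f baseB pevB.
- exact: zevB.
by rewrite /f /g baseZX -[_ *: _]/(_ *: pmon R m) pevZ zevZX scaler_int.
Qed.

Lemma pev_scalable a p : pev (a *: p) = a *: pev p.
Proof.
by rewrite -[a *: p]addr0 pev_linear (zmorph0 pevB) addr0.
Qed.

Hypothesis zrel : srel z.

(** Left multiplications by the [z i] represent the relations, so that [zev_omon] computes the
    product of two monomials. *)
Lemma pev_mul (p q : pbw c R) : pev (p * q) = pev p * pev q.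
Proof.
have zC i j v : commrel (fun i v => z i * v) i j v.
  rewrite /commrel /brop !mulrA -mulrBl zrel mulrDl mulrzl.
  by congr (_ + _); rewrite mulr_suml; apply: eq_bigr => k _; rewrite mulrzAl.
pose f x := pev (x * q); pose g x := pev x * pev q.
apply: (eq_additive_mpoly (f := f) (g := g)) => [x y|x y|a m].
- by rewrite /f -[x - y]/(x - y : pbw c R) mulrBl pevB.
- by rewrite /g pevB mulrBl.
rewrite /f /g -[_ *: _]/(a *: pmon R m) -scalerAl !pev_scalable -scalerAl.
congr (_ *: _).
pose f' x := pev (pmon R m * x); pose g' x := pev (pmon R m) * pev x.
apply: (eq_additive_mpoly (f := f') (g := g')) => [x y|x y|b l].
- by rewrite /f' -[x - y]/(x - y : pbw c R) mulrBr pevB.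
- by rewrite /g' pevB mulrBr.
rewrite /f' /g' -[_ *: _]/(b *: pmon R l) -scalerAr !pev_scalable -scalerAr.
congr (_ *: _); rewrite !pev_mon -omon_zmon.
rewrite -[pmon R m * pmon R l]/(star _ _) starXX /star_mon pev_base.
by rewrite (zev_omon mulB) // zevX omon_zmon /zmon omon_zmon mulr1.
Qed.

Lemma pev1 : pev 1 = 1.
Proof. by rewrite -zmon0 -pev_mon /pmon mpolyX0. Qed.

Lemma pev_hom : exists h : {lrmorphism pbw c R -> B}, h =1 pev.
Proof.
by apply: lrmorphism_pack; [exact: pev_linear|split; [exact: pev1|exact: pev_mul]].
Qed.

End InAlgebra.

Lemma pmonU i m : below i m -> pmon R (U_(i) + m) = pgen R i * pmon R m :> pbw c R.
Proof.
move=> im; rewrite -[RHS]/(star _ _) starXX /star_mon.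
rewrite -[U_(i)%MM]addm0 omonU; last by apply/belowP => j; rewrite mnm0E.
by rewrite omon0 pbw_op_below // baseX addm0.
Qed.

Lemma pmon0 : pmon R 0 = 1 :> pbw c R.
Proof. exact: mpolyX0. Qed.

Lemma zmon_pgen m : zmon (@pgen c R) m = pmon R m.
Proof.
elim/low_ind: m => [|j m jm IHm]; first by rewrite zmon0 pmon0.
by rewrite zmonU // IHm pmonU.
Qed.

Lemma hom_zmon (A B : algType R) (f : {lrmorphism A -> B}) (z : 'I_n -> A) m :
  f (zmon z m) = zmon (f \o z) m.
Proof.
elim/low_ind: m => [|j m jm IHm]; first by rewrite !zmon0 rmorph1.
by rewrite !zmonU // rmorphM /= IHm.
Qed.

Lemma eq_zmon (B : algType R) (z z' : 'I_n -> B) : z =1 z' -> zmon z =1 zmon z'.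
Proof.
move=> zz' m; elim/low_ind: m => [|j m jm IHm]; first by rewrite !zmon0.
by rewrite !zmonU // IHm zz'.
Qed.

Lemma pbwE (p : pbw c R) :
  p = \sum_(m <- msupp (p : {mpoly R[n]})) (p : {mpoly R[n]})@_m *: pmon R m.
Proof. exact: mpolyE. Qed.

Lemma hom_pev (A B : algType R) (f : {lrmorphism A -> B}) (z : 'I_n -> A) p :
  f (pev z p) = pev (f \o z) p.
Proof.
rewrite /pev /mext linear_sum /=; apply: eq_bigr => m _.
by rewrite linearZ_LR /= hom_zmon.
Qed.

Lemma pev_pgen p : pev (@pgen c R) p = p.
Proof.
by rewrite [RHS]pbwE; apply: eq_bigr => m _; rewrite zmon_pgen.
Qed.

Lemma pbw_homE (B : algType R) (f : {lrmorphism pbw c R -> B}) p :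
  f p = pev (f \o @pgen c R) p.
Proof. by rewrite -[in LHS](pev_pgen p) hom_pev. Qed.

Lemma eq_pev (B : algType R) (z z' : 'I_n -> B) : z =1 z' -> pev z =1 pev z'.
Proof.
by move=> zz' p; apply: eq_bigr => m _; rewrite (eq_zmon zz').
Qed.

(** A product of two generators is a value of [pbw_op], so that the relations are those of [pbw_op]
    at 1. *)
Lemma pgen_srel : srel (@pgen c R).
Proof.
move=> i j.
have E a b : pgen R a * pgen R b = mcoefmap intr (pbw_op a 'X_b).
  rewrite -[LHS]/(star _ _) starXX /star_mon -[U_(a)%MM]addm0 omonU ?omon0 //.
  by apply/belowP => k; rewrite mnm0E.
have bB := @baseB c R.
rewrite !E -bB -(omon_pbw_op U_(i)) -(omon_pbw_op U_(j)).
have op1 a : omon (@pbw_op c) U_(a) 1 = pbw_op a 1.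
  rewrite -[U_(a)%MM]addm0 omonU ?omon0 //.
  by apply/belowP => k; rewrite mnm0E.
rewrite !op1 pbw_op_commrel /brop (zmorphD bB) (zmorph_sum bB); congr (_ + _).
  by apply: eq_bigr => k _; rewrite (zmorphMz bB) -op1 omon_pbw_op baseX.
by rewrite (zmorphMz bB) base1.
Qed.

Lemma hom_srel (A B : algType R) (f : {lrmorphism A -> B}) (z : 'I_n -> A) :
  srel z -> srel (f \o z).
Proof.
move=> zrel i j /=; rewrite -!rmorphM -rmorphB zrel rmorphD rmorph_int.
by rewrite rmorph_sum; congr (_ + _); apply: eq_bigr => k _; rewrite raddfMz.
Qed.

End Evaluation.

(** * Leading monomials and the Ore condition *)

(** The spanning family is indexed by a subset [S], so that the bound can also count only the
    monomials outside a monomial ideal. *)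
Lemma steinitz (F : fieldType) (E : lmodType F) (I J : finType) (S : {set J})
    (e : I -> E) (w : J -> E) (a : I -> J -> F) :
  (forall u : I -> F, \sum_i u i *: e i = 0 -> forall i, u i = 0) ->
  (forall i, e i = \sum_(j in S) a i j *: w j) -> (#|I| <= #|S|)%N.
Proof.
move=> e_free eE; rewrite leqNgt; apply/negP => ltSI.
pose A := \matrix_(i < #|I|, j < #|S|) a (enum_val i) (enum_val j).
have : kermx A != 0.
  rewrite kermx_eq0 /row_free neq_ltn.
  by rewrite (leq_ltn_trans (rank_leq_col A)).
case/rowV0Pn => v /sub_kermxP vA; apply/negP; rewrite negbK.
apply/eqP/rowP => k; rewrite [RHS]mxE.
rewrite -[k]enum_valK; apply: (e_free (fun i => v 0 (enum_rank i))).
rewrite (reindex _ (onW_bij _ (enum_val_bij I))) /=.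
under eq_bigr => i _ do rewrite enum_valK eE scaler_sumr.
rewrite exchange_big big_enum_val big1 //= => j _.
under eq_bigr => i _ do rewrite scalerA.
rewrite -scaler_suml; have := congr1 (fun M : 'rV_ _ => M 0 j) vA.
by rewrite !mxE; under eq_bigr => i _ do rewrite mxE; move=> ->; rewrite scale0r.
Qed.

Lemma mlead_free n (F : fieldType) (I : finType) (p : I -> {mpoly F[n]}) :
  (forall i, p i != 0) -> injective (fun i => mlead (p i)) ->
  forall u : I -> F, \sum_i u i *: p i = 0 -> forall i, u i = 0.
Proof.
move=> p0 inj_p u up i0; apply/eqP/contraT => ui0.
case: (@arg_maxP _ _ _ i0 (fun i => u i != 0) (fun i => mlead (p i)) ui0).
move=> i ui max_i.
have := congr1 (mcoeff (mlead (p i))) up.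
rewrite raddf_sum /= (bigD1 i) //= big1 ?addr0 => [|j ji].
  rewrite mcoeffZ mcoeff0 => /eqP; rewrite mulf_eq0 (negPf ui) mleadc_eq0.
  by rewrite (negPf (p0 i)).
rewrite mcoeffZ; have [->|uj] := eqVneq (u j) 0; first by rewrite mul0r.
rewrite mcoeff_gt_mlead ?mulr0 // lt_neqAle; apply/andP; split; last exact: max_i.
by apply: contraNneq ji => /inj_p ->.
Qed.

Lemma exp_gt_poly d n : exists j, ((j * d).+1 ^ n < 2 ^ j)%N.
Proof.
(* For j = 2^(2l) the left side is at most 2^((2l + d)n), and (2l + d)n < 2^l 2^l = j because 2l + d
   <= 3l <= 2^l and n < l; the 4 ensures 3l <= 2^l. *)
pose l := (n + d + 4)%N; exists (2 ^ (2 * l))%N.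
have l2 : (3 * l <= 2 ^ l)%N.
  rewrite /l addnC; elim: (n + d)%N => // k IHk.
  rewrite addnS expnS; have : (16 <= 2 ^ (4 + k))%N by rewrite expnD leq_pmulr ?expn_gt0.
  lia.
have d2 : (d < 2 ^ d)%N by exact: ltn_expl.
have B : ((2 ^ (2 * l) * d).+1 <= 2 ^ (2 * l + d))%N.
  rewrite expnD; have : (0 < 2 ^ (2 * l))%N by rewrite expn_gt0.
  by move: (2 ^ (2 * l))%N => k; nia.
apply: (@leq_ltn_trans (2 ^ ((2 * l + d) * n))).
  by rewrite [X in (_ <= X)%N]expnM; case: (n) => // k; rewrite leq_exp2r.
rewrite ltn_exp2l // mul2n -addnn expnD.
have -> : ((l + l + d) * n < 2 ^ l * 2 ^ l)%N = true by rewrite /l in l2 *; nia.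
by [].
Qed.

Lemma card_bmultinom n m : (#|{: 'X_{1..n < m.+1}}| <= m.+1 ^ n)%N.
Proof.
rewrite -[X in (_ <= X ^ _)%N]card_ord -[X in (_ <= _ ^ X)%N]card_ord.
rewrite -card_ffun.
pose f (a : 'X_{1..n < m.+1}) := [ffun i : 'I_n => (inord (a i) : 'I_m.+1)].
apply: (leq_card f) => a b /ffunP ab; apply/val_inj/mnmP => i.
have bound (x : 'X_{1..n < m.+1}) : (x i < m.+1)%N.
  apply: leq_ltn_trans (bmdeg x); rewrite mdegE (bigD1 i) //=; exact: leq_addr.
have := congr1 val (ab i); rewrite !ffunE /=.
by rewrite !inordK.
Qed.

Section Domain.
Variables (c : sconst) (F : fieldType).
Notation n := (rk c).
Implicit Types p q : pbw c F.
Local Notation mp p := (p : {mpoly F[n]}).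

Definition plead p : 'X_{1..n} := mlead (mp p).

Lemma star_bound p q d e : (msize (mp p) <= d.+1)%N -> (msize (mp q) <= e.+1)%N ->
  (msize (star (mp p) (mp q) - (mp p) * (mp q)) <= d + e)%N.
Proof.
move=> pd qe; rewrite /star /mext mpolyME big_allpairs -sumrB /= big_seq.
elim/big_ind: _ => [|x y xb yb|a ap]; first by rewrite msize0.
  by rewrite (leq_trans (msizeD_le _ _)) // geq_max xb.
rewrite -sumrB big_seq; elim/big_ind: _ => [|x y xb yb|b bq].
- by rewrite msize0.
- by rewrite (leq_trans (msizeD_le _ _)) // geq_max xb.
rewrite -scalerBr (leq_trans (msizeZ_le _ _)) // (leq_trans (star_mon_bound _ _ _)) //.
have := leq_trans (msize_mdeg_lt ap) pd; have := leq_trans (msize_mdeg_lt bq) qe.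
lia.
Qed.

(** [star] agrees with the commutative product in top degree, and the monomial order compares
    degrees first. *)
Lemma pmul_lead p q : p != 0 -> q != 0 ->
  p * q != 0 /\ plead (p * q) = (plead p + plead q)%MM.
Proof.
move=> p0 q0; rewrite /plead -[p * q]/(star (mp p) (mp q)).
have := star_bound (p := p) (q := q) (d := mdeg (mlead (mp p)))
  (e := mdeg (mlead (mp q))).
rewrite !mlead_deg // -mdegD => /(_ (leqnn _) (leqnn _)).
set L := (mlead (mp p) + mlead (mp q))%MM.
have pq0 : mp p * mp q != 0 by rewrite mulf_neq0.
have leadL : mlead (mp p * mp q) = L by rewrite mleadM.
move=> e_bound; pose e := star (mp p) (mp q) - mp p * mp q.
have coefE m : (mdeg L <= mdeg m)%N -> (star (mp p) (mp q))@_m = (mp p * mp q)@_m.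
  move=> Lm; apply/eqP; rewrite -subr_eq0 -mcoeffB mcoeff_eq0.
  exact/msize_mdeg_ge/(leq_trans e_bound).
have SL : L \in msupp (star (mp p) (mp q)).
  by rewrite mcoeff_msupp coefE // -leadL mleadc_eq0.
have S0 : star (mp p) (mp q) != 0 by apply: contraTneq SL => ->; rewrite msupp0.
split=> //; apply/eqP; rewrite eq_le msupp_le_mlead // andbT leNgt; apply/negP => lt.
have := mlead_supp S0; rewrite mcoeff_msupp coefE; last exact/lemc_mdeg/ltW.
by rewrite mcoeff_gt_mlead ?eqxx // leadL.
Qed.

Lemma pmul_eq0 p q : p * q = 0 -> p = 0 \/ q = 0.
Proof.
move=> pq; have [->|p0] := eqVneq p 0; first by left.
have [->|q0] := eqVneq q 0; first by right.
by have [] := pmul_lead p0 q0; rewrite pq eqxx.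
Qed.

Lemma pmul_size p q d e : (msize (mp p) <= d.+1)%N -> (msize (mp q) <= e.+1)%N ->
  (msize (mp (p * q)%R) <= (d + e).+1)%N.
Proof.
move=> pd qe.
have [->|p0] := eqVneq p 0; first by rewrite mul0r msize0.
have [->|q0] := eqVneq q 0; first by rewrite mulr0 msize0.
have [pq0 L] := pmul_lead p0 q0; rewrite -mlead_deg // -/(plead _) L mdegD ltnS.
by rewrite leq_add // -ltnS mlead_deg.
Qed.

Lemma pbw_spanE p d : (msize (mp p) <= d.+1)%N ->
  p = \sum_(m : 'X_{1..n < d.+1}) (mp p)@_m *: pmon F m.
Proof. exact: mpolywE. Qed.

(** Otherwise [a] and [s] times the monomials of degree at most [m] would together be independent;
    the number of monomials would then at least double every [d] degrees, against its polynomial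
    growth. *)
Lemma pbw_ore (a s : pbw c F) : s != 0 -> exists t b, t != 0 /\ a * t = s * b.
Proof.
move=> s0; apply: contrapT => no_tb.
have ann t b : a * t = s * b -> t = 0.
  by move=> E; apply: contrapT => /eqP t0; apply: no_tb; exists t, b.
pose d := maxn (msize (mp a)) (msize (mp s)).
pose f m := #|{: 'X_{1..n < m.+1}}|.
have step m : (2 * f m <= f (m + d))%N.
  pose e (i : bool * 'X_{1..n < m.+1}) : pbw c F :=
    (if i.1 then a else s) * pmon F i.2.
  have msize_e i : (msize (mp (e i)) <= (m + d).+1)%N.
    rewrite addnC; apply: pmul_size; last by rewrite msizeX bmdeg.
    by rewrite leqW //; case: i.1; rewrite leq_max leqnn ?orbT.
  have := @steinitz F (pbw c F) (bool * 'X_{1..n < m.+1})%type _ setT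
    e (fun b : 'X_{1..n < (m + d).+1} => pmon F b) (fun i b => (mp (e i))@_b).
  rewrite card_prod card_bool cardsT; apply; last first.
    by move=> i; rewrite [LHS](pbw_spanE (msize_e i)); apply: eq_bigl => b; rewrite inE.
  move=> u; rewrite (eq_bigr (fun i => u (i.1, i.2) *: e (i.1, i.2))); last by case.
  rewrite -(pair_bigA _ (fun i j => u (i, j) *: e (i, j))) /= big_bool /e /=.
  under eq_bigr => j _ do rewrite scalerAr; rewrite -mulr_sumr.
  under [X in _ + X]eq_bigr => j _ do rewrite scalerAr; rewrite -mulr_sumr.
  set t := \sum_j _; set b := \sum_j _ => /eqP; rewrite addr_eq0 -mulrN => /eqP E.
  have t0 := ann _ _ E.
  have b0 : b = 0.
    move: E; rewrite t0 mulr0 => /esym/pmul_eq0[/eqP|/eqP].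
      by rewrite (negPf s0).
    by rewrite oppr_eq0 => /eqP.
  have free v : \sum_(j : 'X_{1..n < m.+1}) v j *: pmon F j = 0 ->
      forall j, v j = 0.
    apply: mlead_free => [j|i j]; last by rewrite !mleadXm => /val_inj.
    by rewrite -msize_poly_eq0 msizeX.
  by case=> [[]] j; [exact: free t0 j|exact: free b0 j].
have grow j : (2 ^ j <= f (j * d))%N.
  elim: j => [|j IHj]; last first.
    by rewrite mulSnr expnS (leq_trans _ (step _)) // leq_mul2l.
  by rewrite expn0 mul0n; apply/card_gt0P; exists (BMultinom (bm0_proof n 0)).
have [j] := exp_gt_poly d n; apply/negP; rewrite -leqNgt.
exact: leq_trans (grow j) (card_bmultinom _ _).
Qed.

End Domain.

(** * Ore localization *)

Section OreLocalization.
Variables (F : fieldType) (A : algType F).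
Hypothesis dom : forall a b : A, a * b = 0 -> a = 0 \/ b = 0.
Hypothesis ore : forall a s : A, s != 0 -> exists t b, t != 0 /\ a * t = s * b.

(* The fraction [y / x] is encoded by the relation "[q x' = y']" between
   elements of [A], where [q] is the fraction; equal fractions are then equal
   relations, and two fractions are equal as soon as they share a pair [(x, y)]
   with [x != 0]. *)
Record is_fraction (G : A -> A -> Prop) : Prop := IsFraction {
  fr_sub : forall x y x' y', G x y -> G x' y' -> G (x - x') (y - y');
  fr_mul : forall x y t, G x y -> G (x * t) (y * t);
  fr_sat : forall x y t, t != 0 -> G (x * t) (y * t) -> G x y;
  fr_fun0 : forall y, G 0 y -> y = 0;
  fr_dense : forall x, exists t y, t != 0 /\ G (x * t) y
}.

Lemma dom_neq0 (a b : A) : a != 0 -> b != 0 -> a * b != 0.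
Proof.
by move=> a0 b0; apply/eqP => /dom[] E; [move: a0|move: b0]; rewrite E eqxx.
Qed.

Lemma fr_fun G x y y' : is_fraction G -> G x y -> G x y' -> y = y'.
Proof.
move=> fG Gy Gy'; apply/eqP; rewrite -subr_eq0; apply/eqP/(fr_fun0 fG).
by rewrite -(subrr x); exact: fr_sub.
Qed.

(** By the Ore condition any pair of [G] has a common right multiple with [(x, y)], which therefore
    lies in [H]; saturation cancels the factor. *)
Lemma fr_eq G H x y : is_fraction G -> is_fraction H ->
  x != 0 -> G x y -> H x y -> G = H.
Proof.
have main G' H' : is_fraction G' -> is_fraction H' -> x != 0 ->
    G' x y -> H' x y -> forall a b, G' a b -> H' a b.
  move=> fG fH x0 Gxy Hxy a b Gab.
  have [t [u [t0 E]]] := ore a x0.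
  have Eb : b * t = y * u.
    by apply: (fr_fun (x := a * t) fG); rewrite ?E; [rewrite -E|]; exact: fr_mul.
  by apply: (fr_sat fH t0); rewrite E Eb; exact: fr_mul.
move=> fG fH x0 Gxy Hxy; apply/funext => a; apply/funext => b; apply/propext.
by split; apply: main.
Qed.

Definition fraction_rel (x y : A) (x' y' : A) :=
  exists t u, [/\ t != 0, x' * t = x * u & y' * t = y * u].

Lemma fraction_relP x y : x != 0 -> is_fraction (fraction_rel x y).
Proof.
move=> x0; split.
- move=> x1 y1 x2 y2 [t1 [u1 [t10 E1 E1']]] [t2 [u2 [t20 E2 E2']]].
  have [a [b [a0 E]]] := ore t1 t20.
  exists (t1 * a), (u1 * a - u2 * b); split; first exact: dom_neq0.
    by rewrite mulrBl mulrBr !mulrA -E1 -E2 -!mulrA -E.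
  by rewrite mulrBl mulrBr !mulrA -E1' -E2' -!mulrA -E.
- move=> x' y' s [t [u [t0 E E']]]; have [a [b [a0 Eab]]] := ore s t0.
  by exists a, (u * b); rewrite -!mulrA Eab !mulrA -E -E'.
- move=> x' y' s s0 [t [u [t0 E E']]]; exists (s * t), u.
  by rewrite !mulrA E E' dom_neq0.
- move=> y' [t [u [t0]]]; rewrite mul0r => /esym/dom[Ex|->]; first by rewrite Ex eqxx in x0.
  by rewrite mulr0 => /dom[//|Et]; rewrite Et eqxx in t0.
- move=> x'; have [t [u [t0 E]]] := ore x' x0.
  by exists t, (y * u); split=> //; exists 1, u; rewrite !mulr1 oner_neq0.
Qed.

(** The two hypotheses are arguments of the type because the ring structures declared on it depend
    on them. *)
Definition fraction_of
  of (forall a b : A, a * b = 0 -> a = 0 \/ b = 0)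
   & (forall a s : A, s != 0 -> exists t b, t != 0 /\ a * t = s * b) : Type :=
  {G : A -> A -> Prop | is_fraction G}.
Local Notation fraction := (fraction_of dom ore).
Implicit Types q r s : fraction.

HB.instance Definition _ := gen_eqMixin fraction.
HB.instance Definition _ := gen_choiceMixin fraction.

Definition fval q : A -> A -> Prop := proj1_sig q.

Lemma fvalP q : is_fraction (fval q). Proof. exact: proj2_sig q. Qed.

Lemma fval_mul q x y t : fval q x y -> fval q (x * t) (y * t).
Proof. by have [_ H _ _ _] := fvalP q; exact: H. Qed.

Lemma fval_fun q x y y' : fval q x y -> fval q x y' -> y = y'.
Proof. by move=> qy; exact: (fr_fun (fvalP q) qy). Qed.

Lemma fval_eq q r x y : x != 0 -> fval q x y -> fval r x y -> q = r.
Proof.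
case: q r => [G fG] [H fH] x0 /= Gxy Hxy.
have E := fr_eq fG fH x0 Gxy Hxy; subst H; congr exist; exact: Prop_irrelevance.
Qed.

Lemma fval_dense q x : exists t y, t != 0 /\ fval q (x * t) y.
Proof. by have [_ _ _ _ H] := fvalP q; exact: H. Qed.

Lemma fval_pick q : exists x y, x != 0 /\ fval q x y.
Proof.
have [t [y [t0 qy]]] := fval_dense q 1.
by exists (1 * t), y; rewrite mul1r in qy *.
Qed.

Lemma fval_pick2 q r : exists x y z, [/\ x != 0, fval q x y & fval r x z].
Proof.
have [x [y [x0 qy]]] := fval_pick q; have [t [z [t0 rz]]] := fval_dense r x.
by exists (x * t), (y * t), z; split=> //; [exact: dom_neq0|exact: fval_mul].
Qed.

Lemma fval_pick3 q r s :
  exists x y z w, [/\ x != 0, fval q x y, fval r x z & fval s x w].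
Proof.
have [x [y [z [x0 qy rz]]]] := fval_pick2 q r.
have [t [w [t0 sw]]] := fval_dense s x.
exists (x * t), (y * t), (z * t), w.
by split=> //; [exact: dom_neq0|exact: fval_mul..].
Qed.

(** Each operation is specified by the relation [P] that its result should contain. The pair
    [(x0, y0)] defines the fraction, and the second hypothesis is independence of the
    representatives. *)
Lemma fraction_ex x0 y0 (P : A -> A -> Prop) : x0 != 0 ->
  (forall x y t u, P x y -> x * t = x0 * u -> y * t = y0 * u) ->
  exists s, forall x y, P x y -> fval s x y.
Proof.
move=> x00 H; exists (exist _ _ (fraction_relP y0 x00)) => x y Pxy.
have [t [u [t0 E]]] := ore x x00; exists t, u; split=> //; exact: H Pxy E.
Qed.

Lemma fval_transport q x y x0 y0 t u : fval q x y -> fval q x0 y0 ->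
  x * t = x0 * u -> y * t = y0 * u.
Proof.
move=> qy qy0 E; apply: (@fval_fun q (x * t)); first exact: fval_mul.
by rewrite E; exact: fval_mul.
Qed.

Lemma fadd_ex q r : exists s, forall x y,
  (exists2 a, fval q x a & exists2 b, fval r x b & y = a + b) -> fval s x y.
Proof.
have [x0 [a0 [b0 [x00 qa0 rb0]]]] := fval_pick2 q r.
apply: (@fraction_ex x0 (a0 + b0)) => // x y t u [a qa [b rb ->]] E.
by rewrite !mulrDl (fval_transport qa qa0 E) (fval_transport rb rb0 E).
Qed.

Lemma flin_ex (k : F) q : exists s, forall x y,
  (exists2 a, fval q x a & y = k *: a) -> fval s x y.
Proof.
have [x0 [a0 [x00 qa0]]] := fval_pick q.
apply: (@fraction_ex x0 (k *: a0)) => // x y t u [a qa ->] E.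
by rewrite -!scalerAl (fval_transport qa qa0 E).
Qed.

Lemma fmul_ex q r : exists s, forall x y,
  (exists2 a, fval r x a & fval q a y) -> fval s x y.
Proof.
have [x0 [a0 [x00 ra0]]] := fval_pick r.
have [v [y0 [v0 qy0]]] := fval_dense q a0.
apply: (@fraction_ex (x0 * v) y0); first exact: dom_neq0.
move=> x y t u [a ra qy] E; apply: (fval_transport qy qy0).
by apply: (fval_transport ra _ E); exact: fval_mul.
Qed.

Lemma fcst_ex a : exists s, forall x y, y = a * x -> fval s x y.
Proof.
apply: (@fraction_ex 1 a); first exact: oner_neq0.
by move=> x y t u -> E; rewrite -mulrA E mul1r.
Qed.

Definition fadd q r := projT1 (cid (fadd_ex q r)).
Definition fscale k q := projT1 (cid (flin_ex k q)).
Definition fmul q r := projT1 (cid (fmul_ex q r)).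
Definition fcst a := projT1 (cid (fcst_ex a)).

Lemma faddP q r x a b : fval q x a -> fval r x b -> fval (fadd q r) x (a + b).
Proof.
by move=> qa rb; apply: (projT2 (cid (fadd_ex q r))); exists a => //; exists b.
Qed.

Lemma fscaleP k q x a : fval q x a -> fval (fscale k q) x (k *: a).
Proof. by move=> qa; apply: (projT2 (cid (flin_ex k q))); exists a. Qed.

Lemma fmulP q r x a b : fval r x a -> fval q a b -> fval (fmul q r) x b.
Proof. by move=> ra qb; apply: (projT2 (cid (fmul_ex q r))); exists a. Qed.

Lemma fcstP a x : fval (fcst a) x (a * x).
Proof. exact: (projT2 (cid (fcst_ex a))). Qed.

Lemma fcst0P x : fval (fcst 0) x 0.
Proof. by have := fcstP 0 x; rewrite mul0r. Qed.

Lemma fcst1P x : fval (fcst 1) x x.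
Proof. by have := fcstP 1 x; rewrite mul1r. Qed.

Lemma finv_ex q : exists s, (q = fcst 0 -> s = q) /\
  (q <> fcst 0 -> forall x y, fval q x y -> fval s y x).
Proof.
have [->|q0] := pselect (q = fcst 0); first by exists (fcst 0).
have [x0 [y0 [x00 qy0]]] := fval_pick q.
have y00 : y0 != 0.
  by apply: contra_notN q0 => /eqP E; apply: (fval_eq x00 qy0); rewrite E; exact: fcst0P.
have [s sP] : exists s, forall y x, fval q x y -> fval s y x.
  apply: (@fraction_ex y0 x0) => // y x t u qy E.
  (* If [x * t] and [x0 * u] differed, [q] would send their nonzero difference to 0, hence be 0. *)
  apply: contrapT => /eqP; rewrite -subr_eq0 => nz.
  apply: q0; apply: (fval_eq nz (r := fcst 0) (y := 0)); last exact: fcst0P.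
  rewrite -(subrr (y * t)); apply: fr_sub; [exact: fvalP|exact: fval_mul|].
  by rewrite E; exact: fval_mul.
by exists s; split=> // _ x y; exact: sP.
Qed.

Definition finv q := projT1 (cid (finv_ex q)).

Lemma finvP q x y : q <> fcst 0 -> fval q x y -> fval (finv q) y x.
Proof. by rewrite /finv; case: cid => s /= [_ H] /H; apply. Qed.

Lemma finv0 : finv (fcst 0) = fcst 0.
Proof. by rewrite /finv; case: cid => s /= [H _]; exact: H. Qed.

Lemma faddA : associative fadd.
Proof.
move=> q r s; have [x [a [b [d [x0 qa rb sd]]]]] := fval_pick3 q r s.
apply: (fval_eq x0 (y := a + (b + d))); first by do !apply: faddP.
by rewrite addrA; do !apply: faddP.
Qed.

Lemma faddC : commutative fadd.
Proof.
move=> q r; have [x [a [b [x0 qa rb]]]] := fval_pick2 q r.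
by apply: (fval_eq x0 (y := a + b)); [|rewrite addrC]; exact: faddP.
Qed.

Lemma fadd0 : left_id (fcst 0) fadd.
Proof.
move=> q; have [x [a [x0 qa]]] := fval_pick q.
apply: (fval_eq x0 (y := a)) => //; rewrite -[a]add0r.
by apply: faddP => //; exact: fcst0P.
Qed.

Lemma faddN : left_inverse (fcst 0) (fscale (-1)) fadd.
Proof.
move=> q; have [x [a [x0 qa]]] := fval_pick q.
apply: (fval_eq x0 (y := 0)); last exact: fcst0P.
rewrite -(addNr a) -scaleN1r; apply: faddP => //; exact: fscaleP.
Qed.

HB.instance Definition _ := GRing.isZmodule.Build fraction faddA faddC fadd0 faddN.

Lemma fmulA : associative fmul.
Proof.
move=> q r s; have [x [a [x0 sa]]] := fval_pick s.
have [t [b [t0 rb]]] := fval_dense r a; have [u [d [u0 qd]]] := fval_dense q b.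
have xtu0 : x * t * u != 0 by rewrite !dom_neq0.
have sx : fval s (x * t * u) (a * t * u) by do 2!apply: fval_mul.
have rx : fval r (a * t * u) (b * u) by exact: fval_mul.
apply: (fval_eq xtu0 (y := d)); apply: fmulP.
- exact: (fmulP sx rx).
- exact: qd.
- exact: sx.
- exact: (fmulP rx qd).
Qed.

Lemma fmul1 : left_id (fcst 1) fmul.
Proof.
move=> q; have [x [a [x0 qa]]] := fval_pick q.
by apply: (fval_eq x0 (y := a)) => //; apply: (fmulP qa); exact: fcst1P.
Qed.

Lemma fmulr1 : right_id (fcst 1) fmul.
Proof.
move=> q; have [x [a [x0 qa]]] := fval_pick q.
by apply: (fval_eq x0 (y := a)) => //; apply: fmulP qa; exact: fcst1P.
Qed.

Lemma fmulDl : left_distributive fmul fadd.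
Proof.
move=> q r s; have [x [a [x0 sa]]] := fval_pick s.
have [t [b [t0 qb]]] := fval_dense q a; have [u [d [u0 rd]]] := fval_dense r (a * t).
have xtu0 : x * t * u != 0 by rewrite !dom_neq0.
have sx : fval s (x * t * u) (a * t * u) by do 2!apply: fval_mul.
have qx : fval q (a * t * u) (b * u) by exact: fval_mul.
apply: (fval_eq xtu0 (y := b * u + d)).
  by apply: (fmulP sx); exact: faddP.
by apply: faddP; apply: (fmulP sx).
Qed.

Lemma fmulDr : right_distributive fmul fadd.
Proof.
move=> q r s; have [x [a [b [x0 ra sb]]]] := fval_pick2 r s.
have [t [d [t0 qd]]] := fval_dense q a; have [u [e [u0 qe]]] := fval_dense q (b * t).
have xtu0 : x * t * u != 0 by rewrite !dom_neq0.
have rx : fval r (x * t * u) (a * t * u) by do 2!apply: fval_mul.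
have sx : fval s (x * t * u) (b * t * u) by do 2!apply: fval_mul.
have qx : fval q (a * t * u) (d * u) by exact: fval_mul.
apply: (fval_eq xtu0 (y := d * u + e)).
  apply: fmulP; first exact: (faddP rx sx).
  rewrite -[a * t * u]opprK -[d * u]opprK addrC [X in fval q _ X]addrC.
  apply: fr_sub => //; first exact: fvalP.
  rewrite -sub0r -[X in fval q _ X]sub0r; apply: fr_sub => //; first exact: fvalP.
  by have := fval_mul 0 qx; rewrite !mulr0.
by apply: faddP; [exact: (fmulP rx)|exact: (fmulP sx)].
Qed.

Lemma fcst_inj : injective fcst.
Proof.
move=> a b E; rewrite -[a]mulr1 -[b]mulr1.
by apply: (fval_fun (q := fcst a) (x := 1)); [|rewrite E]; exact: fcstP.
Qed.

Lemma fone_neq0 : fcst 1 != 0 :> fraction.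
Proof. by apply/eqP => /fcst_inj/eqP; rewrite oner_eq0. Qed.

HB.instance Definition _ := GRing.Zmodule_isNzRing.Build fraction
  fmulA fmul1 fmulr1 fmulDl fmulDr fone_neq0.

Lemma fmulVr : {in [pred q : fraction | q != 0], left_inverse 1 finv *%R}.
Proof.
move=> q; rewrite inE => /eqP q0; have [x [a [x0 qa]]] := fval_pick q.
apply: (fval_eq x0 (y := x)); last exact: fcst1P.
by apply: (fmulP qa); exact: finvP.
Qed.

Lemma fmulrV : {in [pred q : fraction | q != 0], right_inverse 1 finv *%R}.
Proof.
move=> q; rewrite inE => /eqP q0; have [x [a [x0 qa]]] := fval_pick q.
have a0 : a != 0.
  by apply: contra_notN q0 => /eqP E; apply: (fval_eq x0 qa); rewrite E; exact: fcst0P.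
apply: (fval_eq a0 (y := a)); last exact: fcst1P.
exact: (fmulP (finvP q0 qa) qa).
Qed.

Lemma funitP (q r : fraction) : r * q = 1 /\ q * r = 1 -> q != 0.
Proof.
by case=> E _; apply: contra_eqN E => /eqP ->; rewrite mulr0 eq_sym oner_neq0.
Qed.

Lemma finv_out : {in [predC [pred q : fraction | q != 0]], finv =1 id}.
Proof. by move=> q; rewrite !inE negbK => /eqP ->; exact: finv0. Qed.

HB.instance Definition _ := GRing.NzRing_hasMulInverse.Build fraction
  fmulVr fmulrV funitP finv_out.

Lemma fscaleA (k l : F) q : fscale k (fscale l q) = fscale (k * l) q.
Proof.
have [x [a [x0 qa]]] := fval_pick q; apply: (fval_eq x0 (y := k *: (l *: a))).
  by do 2!apply: fscaleP.
by rewrite scalerA; exact: fscaleP.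
Qed.

Lemma fscale1 : left_id 1 fscale.
Proof.
move=> q; have [x [a [x0 qa]]] := fval_pick q.
by apply: (fval_eq x0 (y := a)) => //; rewrite -[a]scale1r; exact: fscaleP.
Qed.

Lemma fscaleDr : right_distributive fscale +%R.
Proof.
move=> k q r; have [x [a [b [x0 qa rb]]]] := fval_pick2 q r.
apply: (fval_eq x0 (y := k *: (a + b))); first by apply: fscaleP; exact: faddP.
by rewrite scalerDr; apply: faddP; exact: fscaleP.
Qed.

Lemma fscaleDl q : {morph fscale^~ q : k l / k + l}.
Proof.
move=> k l; have [x [a [x0 qa]]] := fval_pick q.
apply: (fval_eq x0 (y := (k + l) *: a)); first exact: fscaleP.
by rewrite scalerDl; apply: faddP; exact: fscaleP.
Qed.

HB.instance Definition _ := GRing.Zmodule_isLmodule.Build F fraction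
  fscaleA fscale1 fscaleDr fscaleDl.

Lemma fscaleAl (k : F) (q r : fraction) : k *: (q * r) = (k *: q : fraction) * r.
Proof.
have [x [a [x0 ra]]] := fval_pick r; have [t [b [t0 qb]]] := fval_dense q a.
have xt0 : x * t != 0 by rewrite dom_neq0.
have rt : fval r (x * t) (a * t) by exact: fval_mul.
apply: (fval_eq xt0 (y := k *: b)).
  by apply: fscaleP; exact: (fmulP rt qb).
by apply: (fmulP rt); exact: fscaleP.
Qed.

HB.instance Definition _ := GRing.Lmodule_isLalgebra.Build F fraction fscaleAl.

Lemma fval_scale q (k : F) x a : fval q x a -> fval q (k *: x) (k *: a).
Proof.
by move=> qa; rewrite -[x]mulr1 -[a]mulr1 !scalerAr; exact: fval_mul.
Qed.

Lemma fscaleAr (k : F) (q r : fraction) : k *: (q * r) = q * (k *: r : fraction).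
Proof.
have [x [a [x0 ra]]] := fval_pick r; have [t [b [t0 qb]]] := fval_dense q a.
have xt0 : x * t != 0 by rewrite dom_neq0.
have rt : fval r (x * t) (a * t) by exact: fval_mul.
apply: (fval_eq xt0 (y := k *: b)).
  by apply: fscaleP; exact: (fmulP rt qb).
by apply: fmulP; [exact: (fscaleP k rt)|exact: fval_scale].
Qed.

HB.instance Definition _ := GRing.Lalgebra_isAlgebra.Build F fraction fscaleAr.

Lemma fcst_linear : linear fcst.
Proof.
move=> k a b; apply: (fval_eq (oner_neq0 A) (y := (k *: a + b) * 1)).
  exact: fcstP.
rewrite mulrDl -scalerAl; apply: faddP; last exact: fcstP.
by apply: fscaleP; exact: fcstP.
Qed.

Lemma fcst_monoid : monoid_morphism fcst.
Proof.
split=> // a b; apply: (fval_eq (oner_neq0 A) (y := a * b * 1)).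
  exact: fcstP.
by apply: fmulP; [exact: fcstP|rewrite -mulrA; exact: fcstP].
Qed.

HB.instance Definition _ := GRing.isLinear.Build F A fraction _ fcst fcst_linear.
HB.instance Definition _ := GRing.isMonoidMorphism.Build A fraction fcst fcst_monoid.

Lemma fraction_skew_field :
  is_skew_field_of_fractions (fcst : {lrmorphism A -> fraction}).
Proof.
split=> [q //||q]; first exact: fcst_inj.
have [x [y [x0 qy]]] := fval_pick q; exists y, x; split=> //.
have x0' : fcst x != 0 :> fraction.
  by apply: contraNneq x0 => /fcst_inj ->.
apply: (canRL (mulrK _)); first by [].
apply: (fval_eq (oner_neq0 A) (y := y * 1)); last exact: fcstP.
by apply: fmulP; [exact: fcstP|rewrite !mulr1].
Qed.

End OreLocalization.

Theorem ore_localization (F : fieldType) (A : algType F) :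
  (forall a b : A, a * b = 0 -> a = 0 \/ b = 0) ->
  (forall a s : A, s != 0 -> exists t b, t != 0 /\ a * t = s * b) ->
  exists (D : unitAlgType F) (i : {lrmorphism A -> D}),
    is_skew_field_of_fractions i.
Proof.
move=> dom ore; exists (fraction_of dom ore : unitAlgType F), (fcst dom ore).
exact: fraction_skew_field.
Qed.

(** * Growth of subalgebras of a skew field of fractions *)

Lemma exp_growth N M C D :
  (forall q, q.+1 ^ N <= C * (D * q).+1 ^ M)%N -> (N <= M)%N.
Proof.
(* With this [q], the right side is at most C((D+1)(q+1))^M = q(q+1)^M, which is less than
   (q+1)^(M+1). *)
move=> H; rewrite leqNgt; apply/negP => MN; pose q := (C * D.+1 ^ M)%N.
have := H q; apply/negP; rewrite -ltnNge.
apply: (@leq_ltn_trans (C * (D.+1 * q.+1) ^ M)).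
  by apply: leq_mul => //; case: (M) => // k; rewrite leq_exp2r //; nia.
rewrite expnMn mulnA -/q; apply: (@leq_trans (q.+1 ^ M.+1)).
  by rewrite expnS ltn_mul2r expn_gt0 ltnS leqnn.
exact: leq_pexp2l.
Qed.

(** Such an [a] is determined by an index [i] with [a i < b i], the value [a i], for which at most
    [mdeg b] choices remain, and the other [n.-1] coordinates. The growth thus loses one
    dimension. *)
Lemma card_not_above n k (b : 'X_{1..n}) :
  (#|[set a : 'X_{1..n < k.+1} | ~~ (b <= a)%MM]|
     <= n * (mdeg b).+1 * k.+1 ^ n.-1)%N.
Proof.
case: n b => [|n] b.
  rewrite mul0n mul0n leqn0 cards_eq0; apply/eqP/setP => a.
  by rewrite !inE; apply/negbTE; rewrite negbK; apply/mnm_lepP => -[].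
pose i (a : 'X_{1..n.+1 < k.+1}) : 'I_n.+1 := odflt ord0 [pick i | (a i < b i)%N].
pose f (a : 'X_{1..n.+1 < k.+1}) : 'I_n.+1 * 'I_(mdeg b).+1 * {ffun 'I_n -> 'I_k.+1} :=
  (i a, inord (a (i a)), [ffun j => inord (a (lift (i a) j))]).
have coord m (m' : 'X_{1..n.+1}) j : (mdeg m' < m)%N -> (m' j < m)%N.
  by apply: leq_ltn_trans; rewrite mdegE (bigD1 j) //=; exact: leq_addr.
have iP (a : 'X_{1..n.+1 < k.+1}) : ~~ (b <= a)%MM -> (a (i a) < b (i a))%N.
  move=> ba; rewrite /i; case: pickP => //= H; case/negP: ba.
  by apply/mnm_lepP => j; rewrite leqNgt H.
rewrite -[X in (_ * X * _)%N]card_ord -[X in (X * _ * _)%N]card_ord -card_prod.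
rewrite -[X in (_ * X ^ _)%N]card_ord -[X in (_ * _ ^ X)%N]card_ord -card_ffun.
rewrite -card_prod.
apply: (@leq_card_in _ _ f) => a a'; rewrite !inE => /iP Ha /iP Ha' E.
pose T := ('I_n.+1 * 'I_(mdeg b).+1 * {ffun 'I_n -> 'I_k.+1})%type.
have Ei : i a = i a' := congr1 (fun x : T => x.1.1) E.
have := congr1 (fun x : T => val x.1.2) E.
have /ffunP E3 := congr1 (fun x : T => x.2) E.
have bb (m : 'X_{1..n.+1}) : (m (i a') < b (i a'))%N -> (m (i a') < (mdeg b).+1)%N.
  by move=> /ltnW/leq_ltn_trans; apply; exact: coord.
rewrite /= !inordK ?Ei; [|exact: bb|by apply: bb; rewrite -Ei].
move=> E2; apply/val_inj/mnmP => j; case: (unliftP (i a') j) => [l ->|-> //].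
have := congr1 val (E3 l); rewrite !ffunE /= Ei.
by rewrite !inordK //; apply/coord/bmdeg.
Qed.

Section Growth.
Variables (F : fieldType) (D : unitAlgType F).
Hypothesis skew : forall x : D, x != 0 -> x \is a GRing.unit.

Section Valuation.
Variables (a : sconst) (iA : {lrmorphism pbw a F -> D}).
Notation n := (rk a).
Hypothesis iA_inj : injective iA.
Implicit Types (p s : pbw a F) (x y : D) (u v : 'X_{1..n}).

Lemma iA_neq0 p : p != 0 -> iA p != 0.
Proof. by move=> p0; rewrite -(rmorph0 iA) (inj_eq iA_inj). Qed.

(* The leading exponent of the fraction [x] is the formal difference [u - v]. *)
Definition has_lead x u v := exists p s,
  [/\ p != 0, s != 0, x * iA s = iA p & (plead p + v = plead s + u)%MM].

Lemma has_lead_pbw p : p != 0 -> has_lead (iA p) (plead p) 0.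
Proof.
move=> p0; exists p, 1; split; rewrite ?oner_neq0 ?rmorph1 ?mulr1 //.
by rewrite /plead mlead1 addm0 add0m.
Qed.

(** If x = p/s, y = q/t and qw = sz, then xy = (pz)/(tw), and the leading exponents add up as they
    would for commuting fractions. *)
Lemma has_lead_mul x y u v u' v' : has_lead x u v -> has_lead y u' v' ->
  has_lead (x * y) (u + u') (v + v').
Proof.
move=> [p [s [p0 s0 E L]]] [q [t [q0 t0 E' L']]].
have [w [z [w0 Ez]]] := pbw_ore q s0.
have z0 : z != 0.
  apply: contraNneq q0 => z0; move: Ez; rewrite z0 mulr0 => /pmul_eq0[->//|/eqP].
  by rewrite (negPf w0).
have [[pz0 Lpz] [tw0 Ltw]] := (pmul_lead p0 z0, pmul_lead t0 w0).
have [[_ Lqw] [_ Lsz]] := (pmul_lead q0 w0, pmul_lead s0 z0).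
exists (p * z), (t * w); split=> //.
  rewrite !rmorphM mulrA -[x * y * _]mulrA E' -mulrA.
  by rewrite -[iA q * _]rmorphM Ez rmorphM mulrA E.
rewrite Lpz Ltw; rewrite Ez Lsz in Lqw.
apply/mnmP => i; move: (congr1 (fun m : 'X_{1..n} => m i) L).
move: (congr1 (fun m : 'X_{1..n} => m i) L') (congr1 (fun m : 'X_{1..n} => m i) Lqw).
by rewrite !mnmDE; lia.
Qed.

Lemma has_lead_unique x u v p s : has_lead x u v -> p != 0 -> s != 0 ->
  x * iA s = iA p -> (plead p + v = plead s + u)%MM.
Proof.
move=> [p' [s' [p'0 s'0 E' L']]] p0 s0 E.
have [w [z [w0 Ez]]] := pbw_ore s s'0.
have z0 : z != 0.
  apply: contraNneq s0 => z0; move: Ez; rewrite z0 mulr0 => /pmul_eq0[->//|/eqP].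
  by rewrite (negPf w0).
have Ep : p * w = p' * z.
  by apply: iA_inj; rewrite !rmorphM /= -E -E' -!mulrA -!rmorphM Ez.
have [[_ L1] [_ L2]] := (pmul_lead p0 w0, pmul_lead p'0 z0).
have [[_ L3] [_ L4]] := (pmul_lead s0 w0, pmul_lead s'0 z0).
rewrite Ep L2 in L1; rewrite Ez L4 in L3.
apply/mnmP => i; move: (congr1 (fun m : 'X_{1..n} => m i) L').
move: (congr1 (fun m : 'X_{1..n} => m i) L1) (congr1 (fun m : 'X_{1..n} => m i) L3).
by rewrite !mnmDE; lia.
Qed.

Lemma has_lead_exp x u v k : has_lead x u v -> has_lead (x ^+ k) (u *+ k) (v *+ k).
Proof.
move=> xuv; elim: k => [|k IHk].
  have := has_lead_pbw (oner_neq0 (pbw a F)).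
  by rewrite rmorph1 /plead mlead1 !mulm0n.
by rewrite exprS !mulmS; exact: has_lead_mul.
Qed.

Hypothesis iA_frac : forall x : D, exists p s, s != 0 /\ x = iA p / iA s.

Lemma frac_mul x : exists p s, s != 0 /\ x * iA s = iA p.
Proof.
have [p [s [s0 ->]]] := iA_frac x; exists p, s; split=> //.
by rewrite divrK //; exact/skew/iA_neq0.
Qed.

Lemma common_denominator (l : seq D) :
  exists2 s, s != 0 & forall x, x \in l -> exists p, x * iA s = iA p.
Proof.
elim: l => [|x l [s s0 IHl]]; first by exists 1; rewrite ?oner_neq0.
have [p [t [t0 E]]] := frac_mul x; have [w [z [w0 Ez]]] := pbw_ore s t0.
have sw0 : s * w != 0 by have [] := pmul_lead s0 w0.
exists (s * w) => // y; rewrite inE => /orP[/eqP->|/IHl[q Eq]].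
  by exists (p * z); rewrite Ez !rmorphM mulrA E.
by exists (q * w); rewrite !rmorphM mulrA Eq.
Qed.

(** Over a common denominator the numerators have distinct leading monomials; the shifts [u0] and
    [v0], common to the family, do not affect this. *)
Lemma has_lead_free (I : finType) (e : I -> D) (u : I -> 'X_{1..n}) u0 v0 :
  injective u -> (forall i, has_lead (e i) (u i + u0) v0) ->
  forall t : I -> F, \sum_i t i *: e i = 0 -> forall i, t i = 0.
Proof.
move=> u_inj eu t et; have [s s0 eP] := common_denominator (codom e).
have /choice[p pP] : forall i, exists p, e i * iA s = iA p.
  by move=> i; apply: eP; exact: codom_f.
have p0 i : p i != 0.
  have [p' [s' [p'0 s'0 E _]]] := eu i.
  apply: contraNneq p'0 => pi0; have := pP i; rewrite pi0 rmorph0 => es0.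
  have e0 : e i = 0.
    by rewrite -(mulrK (skew (iA_neq0 s0)) (e i)) es0 mul0r.
  by rewrite -(inj_eq iA_inj) rmorph0 -E e0 mul0r.
apply: (mlead_free p0) => [i j Eij|].
  have := has_lead_unique (eu i) (p0 i) s0 (pP i).
  have := has_lead_unique (eu j) (p0 j) s0 (pP j).
  rewrite /plead Eij => -> /addmI; rewrite ![(_ + u0)%MM]addmC.
  by move=> /addmI/u_inj.
apply: iA_inj; rewrite rmorph0 -[RHS](mul0r (iA s)) -et.
rewrite -[LHS]/(iA (\sum_i t i *: (p i : pbw a F))) linear_sum mulr_suml.
by apply: eq_bigr => i _; rewrite linearZ_LR /= -pP scalerAl.
Qed.

End Valuation.

Section Comparison.
Variables (a b : sconst) (iA : {lrmorphism pbw a F -> D}).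
Variables (h : {lrmorphism pbw b F -> D}).
Hypothesis iA_frac : is_skew_field_of_fractions iA.
Variables (Q : pbw b F) (P : 'I_(rk a) -> pbw b F).
Hypothesis hQ : h Q != 0.
Hypothesis hP : forall i, iA (pgen F i) * h Q = h (P i).
Notation N := (rk a).
Notation M := (rk b).
Local Notation mp p := (p : {mpoly F[rk b]}).

Let iA_inj : injective iA. Proof. by case: iA_frac. Qed.
Let iA_fracP : forall x : D, exists p s, s != 0 /\ x = iA p / iA s.
Proof. by case: iA_frac. Qed.

Lemma zmon_size d m : (forall i, (msize (mp (P i)) <= d.+1)%N) ->
  (msize (mp (zmon P m)) <= (d * mdeg m).+1)%N.
Proof.
move=> Pd; elim/low_ind: m => [|j m jm IHm].
  by rewrite zmon0 msize1.
by rewrite zmonU // mdegD mdeg1 mulnDr muln1; exact: pmul_size.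
Qed.

Lemma exp_size d k : (msize (mp Q) <= d.+1)%N ->
  (msize (mp (Q ^+ k)) <= (d * k).+1)%N.
Proof.
move=> Qd; elim: k => [|k IHk]; first by rewrite msize1.
by rewrite exprS mulnS; exact: pmul_size.
Qed.

(* The elements [(x_1 f)^(e_1) ... (x_N f)^(e_N) f^(Nq - |e|)], where [f = h Q]
   and each [e_i <= q], are linearly independent, and they are images of
   elements of degree linear in [q]. *)
Lemma growth_bound : exists d, forall q (J : finType) (S : {set J}) (w : J -> D),
  (forall p, (msize (mp p) <= (d * q).+1)%N ->
     exists t : J -> F, h p = \sum_(j in S) t j *: w j) ->
  (q.+1 ^ N <= #|S|)%N.
Proof.
pose d := maxn (msize (mp Q)) (\max_i msize (mp (P i))).
(* Each element [E f] below is a product of [N * q] factors taken among the [P i] and [Q], all of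
   degree at most [d]. *)
exists (d * N)%N => q J S w spanS.
have Qd : (msize (mp Q) <= d.+1)%N by rewrite leqW // leq_maxl.
have Pd i : (msize (mp (P i)) <= d.+1)%N.
  by rewrite leqW // leq_max (leq_bigmax i) orbT.
pose ex (f : {ffun 'I_N -> 'I_q.+1}) : 'X_{1..N} := [multinom val (f i) | i < N].
have ex_deg f : (mdeg (ex f) <= N * q)%N.
  rewrite mdegE -[X in (_ <= X * _)%N]card_ord -sum_nat_const.
  by apply: leq_sum => i _; rewrite mnmE -ltnS ltn_ord.
(* The power of [Q] makes the total number of factors [h Q] equal to [N * q] for every [f], so that
   the leading exponents are the [ex f] up to one common shift. *)
pose E f := zmon P (ex f) * Q ^+ (N * q - mdeg (ex f)).
have E_size f : (msize (mp (E f)) <= (d * N * q).+1)%N.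
  rewrite -mulnA -[X in (d * X)%N](subnKC (ex_deg f)) mulnDr.
  by apply: pmul_size; [exact: zmon_size|exact: exp_size].
have /choice[t tP] f : exists t : J -> F, h (E f) = \sum_(j in S) t j *: w j.
  exact: spanS.
rewrite -[X in (_ ^ X <= _)%N]card_ord -[X in (X ^ _ <= _)%N]card_ord -card_ffun.
apply: (steinitz (e := fun f => h (E f)) (w := w) (a := t)) => //.
have [p [s [s0 Ef]]] := frac_mul iA_inj iA_fracP (h Q).
have p0 : p != 0.
  apply: contraNneq hQ => p0; rewrite -(mulrK (skew (iA_neq0 iA_inj s0)) (h Q)).
  by rewrite Ef p0 rmorph0 mul0r.
have Qlead : has_lead iA (h Q) (plead p) (plead s).
  by exists p, s; split=> //; rewrite addmC.
have mon_lead m :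
    has_lead iA (h (zmon P m)) (m + plead p *+ mdeg m) (plead s *+ mdeg m).
  elim/low_ind: m => [|j m jm IHm].
    have := has_lead_exp 0 Qlead.
    by rewrite zmon0 rmorph1 mdeg0 !mulm0n addm0.
  rewrite zmonU // rmorphM /= -hP mdegD mdeg1 add1n !mulmS.
  have Xlead : has_lead iA (iA (pgen F j)) U_(j) 0.
    have := @has_lead_pbw _ iA (pgen F j); rewrite /plead mleadXm; apply.
    by rewrite -msize_poly_eq0 msizeX.
  have := has_lead_mul (has_lead_mul Xlead Qlead) IHm; rewrite add0m.
  suff -> : (U_(j) + plead p + (m + plead p *+ mdeg m) =
             U_(j) + m + (plead p + plead p *+ mdeg m))%MM by [].
  by rewrite !addmA; congr (_ + _)%MM; rewrite -!addmA; congr (_ + _)%MM; rewrite addmC.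
apply: (has_lead_free iA_inj iA_fracP (u := ex) (u0 := (plead p *+ (N * q))%MM)
         (v0 := (plead s *+ (N * q))%MM)) => [f g|f].
  move=> /mnmP fg; apply/ffunP => i; apply/val_inj.
  by have := fg i; rewrite !mnmE.
have := has_lead_mul (mon_lead (ex f)) (has_lead_exp (N * q - mdeg (ex f)) Qlead).
rewrite -rmorphXn -rmorphM -addmA.
have mulD (m : 'X_{1..N}) : (m *+ mdeg (ex f) + m *+ (N * q - mdeg (ex f)) =
    m *+ (N * q))%MM.
  by apply/mnmP => i; rewrite mnmDE !mulmnE -mulnDr subnKC.
by rewrite !mulD.
Qed.

Theorem rank_le : (N <= M)%N.
Proof.
have [d growth] := growth_bound.
apply: (@exp_growth _ _ 1 d) => q; rewrite mul1n.
apply: leq_trans (card_bmultinom _ _).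
rewrite -cardsT; apply: (growth q _ _ (fun m => h (pmon F (val m)))) => p pd.
exists (fun m : 'X_{1..M < (d * q).+1} => (mp p)@_m).
rewrite [in LHS](pbw_spanE pd) linear_sum /=.
by under eq_bigr => m _ do rewrite linearZ_LR /=; apply: eq_bigl => m; rewrite inE.
Qed.

(** A leading monomial above that of [f] is cancelled by a left multiple of [f], which [h] kills;
    any other leading term is set aside and added back. Degrees do not grow, so monomials not above
    [plead f] span the image in each degree. *)
Lemma reduce_lead (f : pbw b F) m (p : pbw b F) : f != 0 -> h f = 0 ->
  (msize (mp p) <= m.+1)%N ->
  exists p' : pbw b F, [/\ h p' = h p, (msize (mp p') <= m.+1)%N &
    forall u, u \in msupp (mp p') -> ~~ (plead f <= u)%MM].
Proof.
move=> f0 hf; elim/mleadrect: p => p IHp pm.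
have [->|p0] := eqVneq p 0.
  by exists 0; split=> //; rewrite ?msize0 // => u; rewrite msupp0.
have p_deg : (mdeg (mlead (mp p)) <= m)%N by rewrite -ltnS mlead_deg.
have drop (g : pbw b F) : g != 0 -> plead g = mlead (mp p) ->
    (mp p)@_(mlead (mp p)) = (mp g)@_(mlead (mp p)) ->
    p - g = 0 \/ (mlead (mp (p - g)) < mlead (mp p))%O.
  move=> g0 Lg Eg; have [->|pg0] := eqVneq (p - g) 0; [by left|right].
  rewrite lt_neqAle; apply/andP; split.
    apply: contraTneq (mlead_supp pg0) => ->.
    by rewrite mcoeff_msupp mcoeffB Eg subrr eqxx.
  by apply: (le_trans (mleadB_le _ _)); rewrite -/(plead g) Lg joinxx.
have step (g : pbw b F) : g != 0 -> plead g = mlead (mp p) ->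
    (mp p)@_(mlead (mp p)) = (mp g)@_(mlead (mp p)) ->
    exists p' : pbw b F, [/\ h p' = h (p - g), (msize (mp p') <= m.+1)%N &
    forall u, u \in msupp (mp p') -> ~~ (plead f <= u)%MM].
  move=> g0 Lg Eg; have [pg0|/IHp] := drop g g0 Lg Eg.
    by exists 0; rewrite pg0; split=> //; rewrite ?msize0 // => u; rewrite msupp0.
  apply; rewrite (leq_trans (msizeD_le _ _)) // geq_max pm msizeN.
  by rewrite -mlead_deg // -/(plead g) Lg ltnS.
set lc := (mp p)@_(mlead (mp p)) in drop step.
have lc0 : lc != 0 by rewrite mleadc_eq0.
have [fp|nfp] := boolP (plead f <= mlead (mp p))%MM.
  pose g0 : pbw b F := pmon F (mlead (mp p) - plead f) * f.
  have [g00 Lg0] : g0 != 0 /\ plead g0 = mlead (mp p).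
    have X0 : pmon F (mlead (mp p) - plead f) != 0 :> pbw b F.
      by rewrite -msize_poly_eq0 msizeX.
    have [? ->] := pmul_lead X0 f0.
    by split=> //; rewrite {1}/plead mleadXm submK.
  have lcg0 : (mp g0)@_(mlead (mp p)) != 0 by rewrite -Lg0 mleadc_eq0.
  pose k := lc / (mp g0)@_(mlead (mp p)).
  have k0 : k != 0 by rewrite mulf_neq0 ?invr_eq0.
  have [||| p' [E ? ?]] := step (k *: g0).
  - by rewrite scaler_eq0 negb_or k0.
  - by rewrite /plead mleadZ_proper // mulf_neq0 // mleadc_eq0.
  - by rewrite mcoeffZ /k divfK.
  exists p'; split=> //; rewrite E linearB linearZ_LR /= rmorphM /= hf mulr0.
  by rewrite scaler0 subr0.
pose g : pbw b F := lc *: pmon F (mlead (mp p)).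
have g0 : g != 0 by rewrite scaler_eq0 negb_or lc0 -msize_poly_eq0 msizeX.
have [||| p' [E p'm p'P]] := step g.
- by [].
- by rewrite /plead /g mleadZ_proper mleadXm // mcoeffX eqxx mulr1.
- by rewrite mcoeffZ mcoeffX eqxx mulr1.
exists (p' + g); split.
- by rewrite linearD /= E linearB /= subrK.
- rewrite (leq_trans (msizeD_le _ _)) // geq_max p'm.
  by rewrite (leq_trans (msizeZ_le _ _)) // msizeX ltnS.
move=> u /msuppD_le; rewrite mem_cat => /orP[/p'P //|].
by move=> /msuppZ_le; rewrite msuppX inE => /eqP ->.
Qed.

Theorem rank_lt_of_ker (f : pbw b F) : f != 0 -> h f = 0 -> (N < M)%N.
Proof.
move=> f0 hf; have [d growth] := growth_bound.
have bound q : (q.+1 ^ N <= M * (mdeg (plead f)).+1 * (d * q).+1 ^ M.-1)%N.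
  apply: leq_trans (card_not_above (d * q) (plead f)).
  apply: (growth q _ _ (fun m => h (pmon F (val m)))) => p pd.
  have [p' [<- p'd p'P]] := reduce_lead f0 hf pd.
  exists (fun m : 'X_{1..M < (d * q).+1} => (mp p')@_m).
  rewrite [in LHS](pbw_spanE p'd) linear_sum /=.
  rewrite (bigID (fun m => m \in
    [set u : 'X_{1..M < (d * q).+1} | ~~ (plead f <= u)%MM])) /=.
  rewrite [X in _ + X]big1 ?addr0 => [|m].
    by apply: eq_bigr => m _; rewrite linearZ_LR.
  rewrite inE negbK => fm; have /negPn : ~~ ~~ (plead f <= m)%MM by rewrite negbK.
  move=> nfm; rewrite memN_msupp_eq0 ?scale0r ?linear0 //.
  by apply/negP => /p'P; rewrite fm.
have NM : (N <= M.-1)%N by apply: (exp_growth bound).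
(* [M.-1] hides the case [M = 0], which the bound at [q = 0] excludes since it would read 1 <= 0. *)
have M0 : M <> 0%N.
  by move=> M0; have := bound 0%N; rewrite [X in (_ <= X * _ * _)%N]M0 !mul0n exp1n.
lia.
Qed.

End Comparison.
End Growth.

(** * Specialization of finitely generated domains *)

(* A finitely generated subring of [K] is presented by a morphism [e], and a
   specialization of it by a morphism [phi] killing the kernel of [e]. *)
Definition specializable (K : fieldType) (R : comNzRingType)
    (e : {rmorphism R -> K}) := forall f : R, e f != 0 ->
  exists p0 : nat, forall p, prime p -> (p0 <= p)%N ->
  forall k : closedFieldType, p \in [pchar k] ->
  exists phi : {rmorphism R -> k}, (forall x, e x = 0 -> phi x = 0) /\ phi f != 0.

Lemma specializable_int (K : fieldType) : [pchar K] =i pred0 ->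
  specializable (intmul 1 : {rmorphism int -> K}).
Proof.
move=> char0 f ef; exists (absz f).+1 => p p_prime fp k kp.
have abs_eq0 (L : fieldType) : (f%:~R == 0 :> L) = ((absz f)%:R == 0 :> L).
  rewrite [in LHS](intEsign f) rmorphM rmorph_sign mulf_eq0 signr_eq0 /=.
  by rewrite -pmulrn.
exists (intmul 1 : {rmorphism int -> k}); split=> [x /eqP|].
  have [/(_ _) E _] := pcharf0P K.
  rewrite (intEsign x) rmorphM rmorph_sign mulf_eq0 signr_eq0 /= -pmulrn.
  by rewrite (E char0) => /eqP ->; rewrite mulr0.
rewrite /= abs_eq0 -(dvdn_pcharf kp) gtnNdvd // lt0n absz_eq0.
by apply: contraNneq ef => ->.
Qed.

Section AdjoinOne.
Variables (K : fieldType) (R : comNzRingType) (e : {rmorphism R -> K}) (c : K).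
Hypothesis eS : specializable e.
Implicit Types f g m q r A : {poly R}.

Definition adjoin f := (map_poly e f).[c].

HB.instance Definition _ :=
  GRing.RMorphism.copy adjoin (horner_eval c \o map_poly e).

Local Notation ev := adjoin.
Local Notation esize f := (size (map_poly e f)).

Lemma evE f : ev f = (map_poly e f).[c]. Proof. by []. Qed.

Lemma ev_const a : ev a%:P = e a.
Proof. by rewrite evE map_polyC hornerC. Qed.

(** [e] may have a kernel, so the size of [f] can exceed that of its image; top coefficients killed
    by [e] are dropped. *)
Lemma trim f : map_poly e f != 0 ->
  exists f', map_poly e f' = map_poly e f /\ e (lead_coef f') != 0.
Proof.
move=> f0; exists (\poly_(i < esize f) f`_i).
have E : map_poly e (\poly_(i < esize f) f`_i) = map_poly e f.
  apply/polyP => i; rewrite !coef_map coef_poly; case: ltnP => //= fi.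
  by rewrite rmorph0 -coef_map nth_default.
split=> //; have : lead_coef (map_poly e f) != 0 by rewrite lead_coef_eq0.
have s0 : (0 < esize f)%N by rewrite size_poly_gt0.
rewrite lead_coefE coef_map /= => lc.
have sz : size (\poly_(i < esize f) f`_i) = esize f.
  by apply: size_poly_eq; apply: contraNneq lc => ->; rewrite rmorph0.
by rewrite lead_coefE sz coef_poly prednK // leqnn.
Qed.

Lemma esize_lead f : e (lead_coef f) != 0 -> esize f = size f.
Proof. exact: size_map_poly_id0. Qed.

Lemma pseudo_division f m : m != 0 -> exists q r j,
  (size r < size m)%N /\ lead_coef m ^+ j *: f = q * m + r.
Proof.
move=> m0; exists (Pdiv.Ring.rdivp f m), (Pdiv.Ring.rmodp f m).
exists (Pdiv.Ring.rscalp f m); split; first exact: Pdiv.Ring.ltn_rmodpN0.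
exact: Pdiv.ComRing.rdivp_eq.
Qed.

Lemma ev_scale a f : ev (a *: f) = e a * ev f.
Proof. by rewrite -mul_polyC rmorphM /= ev_const. Qed.

Lemma esize_le f : (esize f <= size f)%N.
Proof. by rewrite (leq_trans (size_poly _ _)). Qed.

Lemma specializable_transcendental : (forall g, ev g = 0 -> map_poly e g = 0) ->
  specializable (adjoin : {rmorphism {poly R} -> K}).
Proof.
move=> trans f /= evf.
have : map_poly e f != 0.
  by apply: contraNneq evf => f0; rewrite evE f0 horner0.
rewrite -lead_coef_eq0 lead_coefE coef_map => /eS[p0 p0P].
exists p0 => p p_prime pp k kp; have [phi [ker nz]] := p0P p p_prime pp k kp.
have q0 : map_poly phi f != 0.
  apply: contraNneq nz => /polyP/(_ (esize f).-1).
  by rewrite coef_map coef0 /= => ->.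
(* A root [t] of X f - 1, with [f] mapped to [k], satisfies t f(t) = 1, which forces f(t) to be
   nonzero. *)
have /closed_rootP[t] : size ('X * map_poly phi f - 1) != 1%N.
  have sX : size ('X * map_poly phi f) = (size (map_poly phi f)).+1.
    by rewrite mulrC size_mulX.
  rewrite size_polyDl sX ?eqSS ?size_poly_eq0 // size_polyN size_poly1 ltnS.
  by rewrite size_poly_gt0.
rewrite /root !hornerE subr_eq0 => /eqP tE.
exists (horner_eval t \o map_poly phi : {rmorphism {poly R} -> k}).
split=> [g /trans g0|]; rewrite /= horner_evalE.
  suff -> : map_poly phi g = 0 by rewrite horner0.
  apply/polyP => i; rewrite coef_map coef0; apply: ker.
  by rewrite -coef_map g0 coef0.
by apply: contra_eqN tE => /eqP ->; rewrite mulr0 eq_sym oner_eq0.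
Qed.

Section Algebraic.
Variable m : {poly R}.
Hypotheses (evm : ev m = 0) (lcm : e (lead_coef m) != 0).
Hypothesis m_min : forall g, ev g = 0 -> (esize g < size m)%N -> map_poly e g = 0.

Let m0 : m != 0.
Proof. by apply: contraNneq lcm => ->; rewrite lead_coef0 rmorph0. Qed.

(** A Euclidean algorithm with pseudo-division: [h] plays the role of a resultant of [f] and [m],
    and keeping it nonzero will keep [f] nonzero at the root chosen for [m]. *)
Lemma ev_inverse f : ev f != 0 -> exists A h, e h != 0 /\ ev A * ev f = e h.
Proof.
elim: {f}(esize f).+1 {-2}f (ltnSn (esize f)) => // s IHs f fs evf.
have f0 : map_poly e f != 0.
  by apply: contraNneq evf => f0; rewrite evE f0 horner0.
have [mf|fm] := leqP (size m) (esize f).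
  have [q [r [j [rm E]]]] := pseudo_division f m0.
  have Er : ev r = e (lead_coef m) ^+ j * ev f.
    by rewrite -rmorphXn -ev_scale E rmorphD rmorphM /= evm mulr0 add0r.
  have [|| A [h [h0 Eh]]] := IHs r.
  - rewrite ltnS in fs; apply: leq_trans fs.
    by apply: leq_ltn_trans (esize_le r) _; exact: leq_trans mf.
  - by rewrite Er mulf_neq0 // expf_neq0.
  exists (lead_coef m ^+ j *: A), h; split=> //.
  by rewrite ev_scale rmorphXn -Eh Er; ring.
have [f' [Ef lcf]] := trim f0; have evf' : ev f' = ev f by rewrite !evE Ef.
have sf' : size f' = esize f by rewrite -Ef esize_lead.
have f'0 : f' != 0 by apply: contraNneq lcf => ->; rewrite lead_coef0 rmorph0.
have [q [r [j [rf E]]]] := pseudo_division m f'0.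
have Er : ev r = - ev q * ev f.
  apply/eqP; rewrite mulNr -addr_eq0 addrC -evf' -rmorphM -rmorphD -E /= ev_scale.
  by rewrite evm mulr0.
have [er0|er0] := eqVneq (ev r) 0; last first.
  have [|| A [h [h0 Eh]]] := IHs r => //.
    rewrite ltnS in fs; apply: leq_trans fs.
    by apply: leq_ltn_trans (esize_le r) _; rewrite -sf'.
  by exists (- A * q), h; split=> //; rewrite -Eh Er rmorphM rmorphN; ring.
(* Over [K], [f] now divides [m] up to a scalar with a cofactor [q] vanishing at [c]; the minimality
   of [m] leaves only a constant [f]. *)
have r0 : map_poly e r = 0.
  apply: m_min er0 _; rewrite (leq_ltn_trans (esize_le r)) // (leq_trans rf) //.
  by rewrite sf' ltnW.
have evq : ev q = 0.
  by move/eqP: Er; rewrite er0 eq_sym mulNr oppr_eq0 mulf_eq0 (negPf evf) orbF => /eqP.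
have Emap : e (lead_coef f') ^+ j *: map_poly e m = map_poly e q * map_poly e f.
  by rewrite -rmorphXn -map_polyZ E rmorphD rmorphM /= r0 addr0 Ef.
have q0 : map_poly e q != 0.
  apply/eqP => q0; move: Emap; rewrite q0 mul0r => /eqP.
  rewrite scaler_eq0 expf_eq0 (negPf lcf) andbF /= -size_poly_eq0 esize_lead //.
  by rewrite size_poly_eq0 (negPf m0).
have mq : (size m <= esize q)%N.
  by rewrite leqNgt; apply: contra q0 => /(m_min evq) ->.
have := congr1 (fun p : {poly K} => size p) Emap.
rewrite /= size_scale ?expf_neq0 // size_mul // esize_lead // => Es.
have f1 : (size f' <= 1)%N.
  have := size_poly_gt0 (map_poly e q); rewrite q0 sf'; move: mq Es.
  by move: (size (map_poly e q)) (esize f) (size m) => u v w; lia.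
exists 1, f'`_0; rewrite rmorph1 mul1r -evf' {2}(size1_polyC f1) ev_const; split=> //.
by rewrite -ev_const -(size1_polyC f1) evf'.
Qed.

(** [lead_coef m] is kept nonzero for two reasons: [m] still has a root in [k], and pseudo-division
    by [m] shows that evaluation at this root kills the kernel. *)
Lemma specializable_algebraic : specializable (adjoin : {rmorphism {poly R} -> K}).
Proof.
move=> f /= evf; have [A [h [h0 Eh]]] := ev_inverse evf.
have /eS[p0 p0P] : e (h * lead_coef m) != 0 by rewrite rmorphM mulf_neq0.
exists p0 => p p_prime pp k kp; have [phi [ker]] := p0P p p_prime pp k kp.
rewrite rmorphM mulf_eq0 negb_or => /andP[phih philc].
have /closed_rootP[t /eqP rt] : size (map_poly phi m) != 1%N.
  rewrite size_map_poly_id0 //; apply/negP => /eqP m1.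
  have mC : m = (m`_0)%:P by apply: size1_polyC; rewrite m1.
  move: evm; rewrite mC ev_const => em0; move: lcm.
  by rewrite mC lead_coefC em0 eqxx.
pose phi' : {rmorphism {poly R} -> k} := horner_eval t \o map_poly phi.
have ker' g : ev g = 0 -> phi' g = 0.
  move=> evg; have [q [r [j [rm E]]]] := pseudo_division g m0.
  have evr : ev r = 0.
    have := congr1 ev E.
    by rewrite ev_scale evg mulr0 rmorphD rmorphM /= evm mulr0 add0r.
  have r0 := m_min evr (leq_ltn_trans (esize_le r) rm).
  have phir : map_poly phi r = 0.
    apply/polyP => i; rewrite coef_map coef0; apply: ker.
    by rewrite -coef_map r0 coef0.
  have := congr1 phi' E; rewrite rmorphD rmorphM /= !horner_evalE rt phir.
  rewrite map_polyZ hornerZ horner0 mulr0 addr0 => /eqP.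
  by rewrite mulf_eq0 rmorphXn expf_eq0 (negPf philc) andbF => /eqP.
exists phi'; split=> //.
have : phi' (A * f - h%:P) = 0.
  by apply: ker'; rewrite rmorphB rmorphM /= ev_const Eh subrr.
rewrite rmorphB rmorphM => /eqP; rewrite subr_eq0 => /eqP E.
apply: contraNneq phih => f0; move: E; rewrite f0 mulr0.
by rewrite /= horner_evalE map_polyC hornerC => <-.
Qed.

End Algebraic.

Lemma specializable_adjoin : specializable (adjoin : {rmorphism {poly R} -> K}).
Proof.
have [trans|] := pselect (forall g, ev g = 0 -> map_poly e g = 0).
  exact: specializable_transcendental.
move=> /existsNP[g /not_implyP[evg /eqP g0]].
pose P n := `[< exists f, [/\ ev f = 0, map_poly e f != 0 & esize f = n] >].
have exP : exists n, P n by exists (esize g); apply/asboolP; exists g.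
case: (ex_minnP exP) => n /asboolP[f [evf f0 fn]] n_min.
have [m [Em lcm]] := trim f0.
apply: (@specializable_algebraic m) => // [|q evq qm].
  by rewrite evE Em -evE.
apply: contrapT => /eqP q0; have : (n <= esize q)%N.
  by apply: n_min; apply/asboolP; exists q.
by rewrite leqNgt -fn -Em (esize_lead lcm) qm.
Qed.

End AdjoinOne.

Lemma specialization (K : fieldType) (l : seq K) : [pchar K] =i pred0 ->
  exists (R : comNzRingType) (e : {rmorphism R -> K}),
    specializable e /\ forall x, x \in l -> exists r, e r = x.
Proof.
move=> char0; elim: l => [|c l [R [e [eS IHl]]]].
  by exists int, (intmul 1); split=> //; exact: specializable_int.
exists {poly R}, (adjoin e c : {rmorphism {poly R} -> K}); split; first exact: specializable_adjoin.
move=> x; rewrite inE => /orP[/eqP->|/IHl[r <-]].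
  by exists 'X; rewrite /= evE map_polyX hornerX.
by exists r%:P; rewrite /= ev_const.
Qed.

(* [phi] is a total function, but only its values on the subring [S] matter. *)
Definition specializes (K k : fieldType) (l : seq K) (phi : K -> k) :=
  exists S : K -> Prop,
  [/\ [/\ S 1, forall x y, S x -> S y -> S (x - y) & forall x y, S x -> S y -> S (x * y)],
      [/\ phi 1 = 1, forall x y, S x -> S y -> phi (x - y) = phi x - phi y
        & forall x y, S x -> S y -> phi (x * y) = phi x * phi y],
      forall x, x \in l -> S x & forall x, x \in l -> x != 0 -> phi x != 0].

Theorem specialization_exists (K : fieldType) (l : seq K) : [pchar K] =i pred0 ->
  exists p0 : nat, forall p, prime p -> (p0 <= p)%N ->
  forall k : closedFieldType, p \in [pchar k] ->
  exists phi : K -> k, specializes l phi.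
Proof.
move=> char0; have [R [e [eS lS]]] := specialization l char0.
(* [f] is a product of lifts of the nonzero elements of [l], so that one nonvanishing condition
   takes care of all of them. *)
have [f [ef fP]] : exists f, e f != 0 /\
    forall x, x \in l -> x != 0 -> exists r s, e r = x /\ f = r * s.
  elim: l lS => [|x l IHl] lS; first by exists 1; rewrite rmorph1 oner_neq0.
  have [|f [ef fP]] := IHl; first by move=> y yl; apply: lS; rewrite inE yl orbT.
  have [r Er] : exists r, e r = x by apply: lS; rewrite inE eqxx.
  have [x0|x0] := eqVneq x 0.
    exists f; split=> // y; rewrite inE => /orP[/eqP->|]; last exact: fP.
    by rewrite x0 eqxx.
  exists (r * f); rewrite rmorphM mulf_neq0 ?Er //; split=> // y.
  rewrite inE => /orP[/eqP->|yl y0]; first by exists r, f.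
  have [r' [s [Er' Ef]]] := fP y yl y0.
  by exists r', (r * s); split=> //; rewrite Ef mulrCA.
have [p0 p0P] := eS f ef; exists p0 => p p_prime pp k kp.
have [phi [ker nz]] := p0P p p_prime pp k kp.
have phiE r s : e r = e s -> phi r = phi s.
  move=> rs; apply/eqP; rewrite -subr_eq0 -rmorphB; apply/eqP/ker.
  by rewrite rmorphB rs subrr.
(* A preimage is chosen for each element of the image of [e], with 0 as default elsewhere. Its value
   under [phi] does not depend on the choice, as [phi] kills the kernel of [e]. *)
have /choice[inv invP] x : exists r, (exists r, e r = x) -> e r = x.
  have [[r E]|nE] := pselect (exists r, e r = x); first by exists r.
  by exists 0 => /nE.
have psiE r : phi (inv (e r)) = phi r by apply: phiE; apply: invP; exists r.
exists (phi \o inv), (fun x => exists r, e r = x); split.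
- split; first by exists 1; rewrite rmorph1.
    by move=> _ _ [r <-] [s <-]; exists (r - s); rewrite rmorphB.
  by move=> _ _ [r <-] [s <-]; exists (r * s); rewrite rmorphM.
- split=> /=; first by rewrite -(rmorph1 e) psiE rmorph1.
    by move=> _ _ [r <-] [s <-]; rewrite -rmorphB !psiE rmorphB.
  by move=> _ _ [r <-] [s <-]; rewrite -rmorphM !psiE rmorphM.
- exact: lS.
move=> x xl /(fP x xl)[r [s [<- Ef]]] /=; rewrite psiE.
by apply: contraNneq nz => r0; rewrite Ef rmorphM r0 mul0r.
Qed.

(** * Reduction of skew fields of fractions *)

Section SkewFieldOfFractions.
Variables (F : fieldType) (D : unitAlgType F).
Hypothesis skew : forall x : D, x != 0 -> x \is a GRing.unit.

(* By the Ore condition the fractions of the image of [h] form a skew field. *)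
Lemma fractions_of_generators (a b : sconst) (iA : {lrmorphism pbw a F -> D})
    (h : {lrmorphism pbw b F -> D}) :
  is_skew_field_of_fractions iA -> injective h ->
  (forall i, exists p s, s != 0 /\ iA (pgen F i) * h s = h p) ->
  is_skew_field_of_fractions h.
Proof.
move=> [_ iA_inj iA_frac] h_inj genP.
have h0 p : p != 0 -> h p != 0 by move=> p0; exact: iA_neq0.
pose fr x := exists p s, s != 0 /\ x * h s = h p.
have fr_h p : fr (h p) by exists p, 1; rewrite oner_neq0 rmorph1 mulr1.
have frD x y : fr x -> fr y -> fr (x + y).
  move=> [p [s [s0 E]]] [q [t [t0 E']]]; have [u [v [u0 Euv]]] := pbw_ore s t0.
  exists (p * u + q * v), (s * u); split; first by case: (pmul_lead s0 u0).
  by rewrite mulrDl {2}Euv !rmorphM !mulrA E E' rmorphD !rmorphM.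
have frM x y : fr x -> fr y -> fr (x * y).
  move=> [p [s [s0 E]]] [q [t [t0 E']]]; have [u [v [u0 Euv]]] := pbw_ore q s0.
  exists (p * v), (t * u); split; first by case: (pmul_lead t0 u0).
  rewrite !rmorphM mulrA -[x * y * _]mulrA E' -mulrA -[h q * _]rmorphM Euv.
  by rewrite rmorphM mulrA E.
have frZ k x : fr x -> fr (k *: x).
  by move=> [p [s [s0 E]]]; exists (k *: p), s; rewrite -scalerAl E linearZ_LR.
have frV x : x != 0 -> fr x -> fr x^-1.
  move=> x0 [p [s [s0 E]]]; exists s, p; split; last first.
    by rewrite -E mulKr // skew.
  apply: contraNneq x0 => p0; rewrite -(mulrK (skew (h0 _ s0)) x).
  by rewrite E p0 rmorph0 mul0r.
have fr_iA p : fr (iA p).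
  rewrite pbw_homE /pev /mext; elim/big_ind: _ => //.
    by have := fr_h 0; rewrite rmorph0.
  move=> m _; apply: frZ; elim/low_ind: m => [|j m jm IHm].
    by rewrite zmon0; have := fr_h 1; rewrite rmorph1.
  by rewrite zmonU //; apply: frM => //=; exact: genP.
split=> // x; have [p [s [s0 ->]]] := iA_frac x.
have [|q [t [t0 E]]] := frM _ _ (fr_iA p) (frV _ _ (fr_iA s)).
  exact: (iA_neq0 iA_inj).
by exists q, t; split=> //; apply: (canRL (mulrK _)) E; exact/skew/h0.
Qed.

End SkewFieldOfFractions.

Lemma specializes_sub (K k : fieldType) (l l' : seq K) (phi : K -> k) :
  {subset l' <= l} -> specializes l phi -> specializes l' phi.
Proof.
by move=> ll' [S [? ? lS nz]]; exists S; split=> // x /ll'; [exact: lS|exact: nz].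
Qed.

Section Specialized.
Variables (K k : fieldType) (S : K -> Prop) (phi : K -> k).
Hypotheses (S1 : S 1) (SB : forall x y, S x -> S y -> S (x - y))
  (SM : forall x y, S x -> S y -> S (x * y)).
Hypotheses (phi1 : phi 1 = 1)
  (phiB : forall x y, S x -> S y -> phi (x - y) = phi x - phi y)
  (phiM : forall x y, S x -> S y -> phi (x * y) = phi x * phi y).

Lemma spec0 : S 0. Proof. by rewrite -(subrr 1); exact: SB. Qed.

Lemma spec_phi0 : phi 0 = 0. Proof. by rewrite -(subrr 1) phiB // subrr. Qed.

Lemma specN x : S x -> S (- x).
Proof. by move=> Sx; rewrite -sub0r; apply: SB => //; exact: spec0. Qed.

Lemma specD x y : S x -> S y -> S (x + y).
Proof. by move=> Sx Sy; rewrite -[y]opprK; apply/SB/specN. Qed.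

Lemma spec_phiD x y : S x -> S y -> phi (x + y) = phi x + phi y.
Proof.
move=> Sx Sy; have Ny := specN Sy; rewrite -[y in LHS]opprK phiB // -sub0r phiB //.
  by rewrite spec_phi0 sub0r opprK.
exact: spec0.
Qed.

Lemma spec_sum (I : eqType) (r : seq I) (f : I -> K) :
  (forall i, i \in r -> S (f i)) ->
  S (\sum_(i <- r) f i) /\ phi (\sum_(i <- r) f i) = \sum_(i <- r) phi (f i).
Proof.
elim: r => [|i r IHr] fS; first by rewrite !big_nil spec_phi0; split=> //; exact: spec0.
have [|Sr Er] := IHr; first by move=> j jr; apply: fS; rewrite inE jr orbT.
have Si : S (f i) by apply: fS; rewrite inE eqxx.
by rewrite !big_cons spec_phiD // Er; split=> //; exact: specD.
Qed.

Lemma spec_int n : S n%:~R /\ phi n%:~R = n%:~R.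
Proof.
have nat m : S m%:R /\ phi m%:R = m%:R.
  elim: m => [|m [Sm Em]]; first by rewrite spec_phi0; split=> //; exact: spec0.
  by rewrite !mulrS spec_phiD // Em phi1; split=> //; exact: specD.
case: n => m; first exact: nat.
have [Sm Em] := nat m.+1; rewrite NegzE !mulrNz; split; first exact: specN.
by rewrite -sub0r phiB // ?spec_phi0 ?sub0r -?pmulrn ?Em //; exact: spec0.
Qed.

End Specialized.

Section Reduction.
Variables (K : fieldType) (c : sconst).

Definition red (k : fieldType) (phi : K -> k) (p : pbw c K) : pbw c k :=
  mcoefmap phi (p : {mpoly K[rk c]}).

Local Notation mp p := (p : {mpoly K[rk c]}).

Definition reduction_property := forall (k : fieldType) (phi : K -> k)
  (Dk : unitAlgType k) (ik : {lrmorphism pbw c k -> Dk}), Prop.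

(* The properties that hold "for almost all specializations" form a filter, so
   that finitely many requirements can be imposed independently. *)
Definition eventually (P : reduction_property) :=
  exists l : seq K, forall (k : fieldType) (phi : K -> k), specializes l phi ->
  forall (Dk : unitAlgType k) (ik : {lrmorphism pbw c k -> Dk}),
  is_skew_field_of_fractions ik -> P k phi Dk ik.

Implicit Types P Q R : reduction_property.

Lemma ev_mono2 P Q R : eventually P -> eventually Q ->
  (forall (k : fieldType) (phi : K -> k) (Dk : unitAlgType k)
       (ik : {lrmorphism pbw c k -> Dk}), is_skew_field_of_fractions ik ->
     P k phi Dk ik -> Q k phi Dk ik -> R k phi Dk ik) -> eventually R.
Proof.
move=> [l lP] [l' lQ] H; exists (l ++ l') => k phi spec Dk ik fr.
apply: H => //; [apply: lP => //|apply: lQ => //];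
  by apply: specializes_sub spec => x; rewrite mem_cat => ->; rewrite ?orbT.
Qed.

Lemma ev_mono P R : eventually P ->
  (forall (k : fieldType) (phi : K -> k) (Dk : unitAlgType k)
       (ik : {lrmorphism pbw c k -> Dk}), is_skew_field_of_fractions ik ->
     P k phi Dk ik -> R k phi Dk ik) -> eventually R.
Proof. by move=> lP H; apply: (ev_mono2 lP lP) => *; exact: H. Qed.

Lemma ev_and P Q : eventually P -> eventually Q ->
  eventually (fun k phi Dk ik => P k phi Dk ik /\ Q k phi Dk ik).
Proof. by move=> lP lQ; apply: (ev_mono2 lP lQ). Qed.

Lemma ev_all (I : finType) (P : I -> reduction_property) : (forall i, eventually (P i)) ->
  eventually (fun k phi Dk ik => forall i, P i k phi Dk ik).
Proof.
move=> /choice[l lP]; exists (flatten (codom l)) => k phi spec Dk ik fr i.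
apply: lP => //; apply: specializes_sub spec => x xl.
by apply/flattenP; exists (l i) => //; exact: codom_f.
Qed.

Lemma red_mcoeff (k : fieldType) (phi : K -> k) p m : phi 0 = 0 ->
  (red phi p : {mpoly k[rk c]})@_m = phi (mp p)@_m.
Proof. exact: mcoeff_coefmap. Qed.

(** It suffices that the coefficients of [p] and [q] lie in the subring: the structure constants are
    integers, which every specialization sends to themselves. *)
Lemma ev_red_mul p q :
  eventually (fun k phi _ _ => red phi (p * q) = red phi p * red phi q).
Proof.
exists ([seq (mp p)@_m | m <- msupp (mp p)] ++ [seq (mp q)@_m | m <- msupp (mp q)]).
move=> k phi [S [[S1 SB SM] [phi1 phiB phiM] lS _]] _ _ _.
have phi0 := spec_phi0 S1 phiB.
have pS m : m \in msupp (mp p) -> S (mp p)@_m.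
  by move=> mp; apply: lS; rewrite mem_cat; apply/orP; left; apply/mapP; exists m.
have qS m : m \in msupp (mp q) -> S (mp q)@_m.
  by move=> mq; apply: lS; rewrite mem_cat; apply/orP; right; apply/mapP; exists m.
have E : red phi p * red phi q = \sum_(a <- msupp (mp p)) \sum_(b <- msupp (mp q))
    (phi (mp p)@_a * phi (mp q)@_b) *: star_mon k a b :> {mpoly k[rk c]}.
  rewrite -[LHS]/(star (mcoefmap phi (mp p)) (mcoefmap phi (mp q))).
  rewrite {1}/mcoefmap (zmorph_sum (starBl _)); apply: eq_bigr => a _.
  by rewrite /mcoefmap (zmorph_sum (starBr _)); apply: eq_bigr => b _; rewrite starZX.
apply/mpolyP => m; rewrite red_mcoeff // E -[p * q]/(star (mp p) (mp q)).
rewrite /star /mext !raddf_sum /=.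
have term a b : a \in msupp (mp p) -> b \in msupp (mp q) ->
    S ((mp p)@_a * (mp q)@_b * (star_mon K a b)@_m) /\
    phi ((mp p)@_a * (mp q)@_b * (star_mon K a b)@_m) =
    phi (mp p)@_a * phi (mp q)@_b * (star_mon k a b)@_m.
  move=> /pS Sa /qS Sb; rewrite !mcoeff_star_mon.
  have [Sn En] := spec_int S1 SB phi1 phiB ((omon (@pbw_op c) a 'X_[b])@_m).
  by have Sab := SM _ _ Sa Sb; rewrite !phiM // En; split=> //; exact: SM.
have inner a : a \in msupp (mp p) ->
    S (\sum_(b <- msupp (mp q)) (mp p)@_a * (mp q)@_b * (star_mon K a b)@_m) /\
    phi (\sum_(b <- msupp (mp q)) (mp p)@_a * (mp q)@_b * (star_mon K a b)@_m) =
    \sum_(b <- msupp (mp q)) phi (mp p)@_a * phi (mp q)@_b * (star_mon k a b)@_m.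
  move=> ap; have [b /(term a b ap)[] //|? ->] := spec_sum S1 SB phiB
    (f := fun b => (mp p)@_a * (mp q)@_b * (star_mon K a b)@_m) (r := msupp (mp q)).
  by split=> //; rewrite [LHS]big_seq [RHS]big_seq; apply: eq_bigr => b /(term a b ap)[].
under eq_bigr => a _ do (rewrite raddf_sum /=; under eq_bigr => b _ do rewrite mcoeffZ).
have [a /inner[] //|_ ->] := spec_sum S1 SB phiB (r := msupp (mp p))
  (f := fun a => \sum_(b <- msupp (mp q)) (mp p)@_a * (mp q)@_b * (star_mon K a b)@_m).
rewrite [LHS]big_seq [RHS]big_seq; apply: eq_bigr => a /inner[_ ->].
by rewrite raddf_sum; apply: eq_bigr => b _; rewrite /= mcoeffZ.
Qed.

Lemma ev_red_add p q :
  eventually (fun k phi _ _ => red phi (p + q) = red phi p + red phi q).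
Proof.
exists ([seq (mp p)@_m | m <- msupp (mp p)] ++ [seq (mp q)@_m | m <- msupp (mp q)]).
move=> k phi [S [[S1 SB SM] [phi1 phiB phiM] lS _]] _ _ _.
have phi0 := spec_phi0 S1 phiB.
have pS m : S (mp p)@_m.
  have [mp|/memN_msupp_eq0 ->] := boolP (m \in msupp (mp p)); last exact: spec0.
  by apply: lS; rewrite mem_cat; apply/orP; left; apply/mapP; exists m.
have qS m : S (mp q)@_m.
  have [mq|/memN_msupp_eq0 ->] := boolP (m \in msupp (mp q)); last exact: spec0.
  by apply: lS; rewrite mem_cat; apply/orP; right; apply/mapP; exists m.
apply/mpolyP => m; rewrite mcoeffD !red_mcoeff // mcoeffD.
exact: (spec_phiD S1 SB phiB).
Qed.

Lemma ev_red_scale a p : eventually (fun k phi _ _ => red phi (a *: p) = phi a *: red phi p).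
Proof.
exists (a :: [seq (mp p)@_m | m <- msupp (mp p)]).
move=> k phi [S [[S1 SB SM] [phi1 phiB phiM] lS _]] _ _ _.
have phi0 := spec_phi0 S1 phiB.
apply/mpolyP => m; rewrite mcoeffZ !red_mcoeff // mcoeffZ phiM //.
  by apply: lS; rewrite inE eqxx.
have [mp|/memN_msupp_eq0 ->] := boolP (m \in msupp (mp p)).
  by apply: lS; rewrite inE; apply/orP; right; apply/mapP; exists m.
exact: (spec0 S1 SB).
Qed.

Lemma ev_red_mon m : eventually (fun k phi _ _ => red phi (pmon K m) = pmon k m).
Proof.
exists [::] => k phi [S [[S1 SB _] [phi1 phiB _] _ _]] _ _ _.
have phi0 := spec_phi0 S1 phiB; apply/mpolyP => u.
by rewrite red_mcoeff // !mcoeffX; case: (m == u).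
Qed.

Lemma ev_red_neq0 p : p != 0 -> eventually (fun k phi _ _ => red phi p != 0).
Proof.
move=> p0; exists [:: (mp p)@_(mlead (mp p))].
move=> k phi [S [[S1 SB _] [phi1 phiB _] _ nz]] _ _ _.
have := nz _ (mem_head _ _); rewrite mleadc_eq0 => /(_ p0).
by apply: contraNneq => E; rewrite -red_mcoeff ?E ?mcoeff0 //; exact: (spec_phi0 S1 phiB).
Qed.

End Reduction.

(** * Reduction of elements of a skew field of fractions *)

Section ReductionOfFractions.
Variables (K : fieldType) (c : sconst) (D : unitAlgType K).
Variable iC : {lrmorphism pbw c K -> D}.
Hypothesis iC_frac : is_skew_field_of_fractions iC.
Local Notation mp p := (p : {mpoly K[rk c]}).
Implicit Types (x y : D) (p q a s : pbw c K).

Let skew : forall x : D, x != 0 -> x \is a GRing.unit.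
Proof. by case: iC_frac. Qed.
Let iC_inj : injective iC. Proof. by case: iC_frac. Qed.
Let iC_fracP : forall x : D, exists a s, s != 0 /\ x = iC a / iC s.
Proof. by case: iC_frac. Qed.

Lemma num_den_ex x : exists ns : pbw c K * pbw c K,
  ns.2 != 0 /\ x * iC ns.2 = iC ns.1.
Proof.
by have [p [s [s0 E]]] := frac_mul skew iC_inj iC_fracP x; exists (p, s).
Qed.

Definition num x := (projT1 (cid (num_den_ex x))).1.
Definition den x := (projT1 (cid (num_den_ex x))).2.

Lemma den_neq0 x : den x != 0.
Proof. by rewrite /den; case: cid => ns /= []. Qed.

Lemma num_den x : x * iC (den x) = iC (num x).
Proof. by rewrite /den /num; case: cid => ns /= []. Qed.

(** Meaningful only when the chosen denominator does not reduce to 0. This is not a morphism, but it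
    respects any given operation for almost all specializations. *)
Definition redD (k : fieldType) (phi : K -> k) (Dk : unitAlgType k)
    (ik : {lrmorphism pbw c k -> Dk}) x : Dk :=
  ik (red phi (num x)) / ik (red phi (den x)).

Lemma frac_cancel (k : fieldType) (Dk : unitAlgType k)
    (ik : {lrmorphism pbw c k -> Dk}) (u v : Dk) (r : pbw c k) :
  is_skew_field_of_fractions ik -> r != 0 -> u * ik r = v * ik r -> u = v.
Proof.
move=> [sk ik_inj _] r0 E; have rU : ik r \is a GRing.unit.
  by apply/sk/iA_neq0.
by rewrite -(mulrK rU u) E mulrK.
Qed.

(** Two fractions for the same element agree after passing to a common right multiple of the
    denominators; the comparison costs finitely many products and nonvanishing conditions. *)
Lemma redD_frac x a s : s != 0 -> x * iC s = iC a ->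
  eventually (fun k phi Dk ik => redD phi ik x * ik (red phi s) = ik (red phi a)).
Proof.
move=> s0 E; have [u [v [u0 Ev]]] := pbw_ore s (den_neq0 x).
have Ea : a * u = num x * v.
  by apply: iC_inj; rewrite !rmorphM /= -E -num_den -!mulrA -!rmorphM Ev.
have := ev_and (ev_red_neq0 (den_neq0 x)) (ev_red_neq0 u0).
move=> /(ev_and (ev_and (ev_red_mul s u) (ev_red_mul (den x) v))).
move=> /(ev_and (ev_and (ev_red_mul a u) (ev_red_mul (num x) v))).
move/ev_mono; apply => k phi Dk ik fr [[Eau Env] [[Esu Edv] [d0 u0']]].
have [sk ik_inj _] := fr.
apply: (frac_cancel fr u0'); rewrite -mulrA -!rmorphM -Esu Ev Edv -Eau Ea Env.
by rewrite !rmorphM /redD -!mulrA mulKr //; apply/sk/iA_neq0.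
Qed.

Definition reduction_value := forall (k : fieldType) (phi : K -> k)
  (Dk : unitAlgType k) (ik : {lrmorphism pbw c k -> Dk}), Dk.

(** [T] is a family because the target [Dk] varies with the specialization. Reductions are computed
    operation by operation, and two values for one element yield an identity valid in almost all
    [Dk]. *)
Definition reduces x (T : reduction_value) :=
  eventually (fun k phi Dk ik => redD phi ik x = T k phi Dk ik).

Lemma reduces_frac x a s T : s != 0 -> x * iC s = iC a ->
  eventually (fun k phi Dk ik => T k phi Dk ik * ik (red phi s) = ik (red phi a)) ->
  reduces x T.
Proof.
move=> s0 E HT; apply: (ev_mono2 (ev_and (redD_frac s0 E) HT) (ev_red_neq0 s0)).
by move=> k phi Dk ik fr [E1 E2] sn0; apply: (frac_cancel fr sn0); rewrite E1 E2.
Qed.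

Lemma reduces_refl x : reduces x (fun k phi Dk ik => redD phi ik x).
Proof. by exists [::]. Qed.

Lemma reduces_iC p : reduces (iC p) (fun k phi Dk ik => ik (red phi p)).
Proof.
apply: (@reduces_frac _ p 1); rewrite ?oner_neq0 ?rmorph1 ?mulr1 //.
have := ev_red_mon K (c := c) 0%MM; rewrite !pmon0 => /ev_mono; apply.
by move=> k phi Dk ik _; rewrite pmon0 => ->; rewrite rmorph1 mulr1.
Qed.

Lemma reduces_mono x (T U : reduction_value) : reduces x T ->
  eventually (fun k phi Dk ik => T k phi Dk ik = U k phi Dk ik) -> reduces x U.
Proof.
by move=> xT TU; apply: (ev_mono2 xT TU) => k phi Dk ik _ -> ->.
Qed.

Lemma reduces_add x y (T U : reduction_value) : reduces x T -> reduces y U ->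
  reduces (x + y) (fun k phi Dk ik => T k phi Dk ik + U k phi Dk ik).
Proof.
move=> xT yU.
have [s s0 sP] := common_denominator skew iC_inj iC_fracP [:: x; y].
have [|a Ea] := sP x; first by rewrite !inE eqxx.
have [|b Eb] := sP y; first by rewrite !inE eqxx orbT.
apply: (reduces_frac s0 (a := a + b)); first by rewrite mulrDl Ea Eb rmorphD.
have := ev_and (ev_and xT yU) (ev_red_add a b).
move=> /(ev_and (ev_and (redD_frac s0 Ea) (redD_frac s0 Eb))) /ev_mono; apply.
by move=> k phi Dk ik _ [[E1 E2] [[<- <-] ->]]; rewrite mulrDl E1 E2 rmorphD.
Qed.

Lemma reduces_mul x y (T U : reduction_value) : reduces x T -> reduces y U ->
  reduces (x * y) (fun k phi Dk ik => T k phi Dk ik * U k phi Dk ik).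
Proof.
move=> xT yU; have [a [s [s0 Ea]]] := frac_mul skew iC_inj iC_fracP x.
have [b [t [t0 Eb]]] := frac_mul skew iC_inj iC_fracP y.
have [u [v [u0 Euv]]] := pbw_ore b s0.
have tu0 : t * u != 0 by case: (pmul_lead t0 u0).
apply: (reduces_frac tu0 (a := a * v)).
  rewrite !rmorphM mulrA -[x * y * _]mulrA Eb -mulrA -[iC b * _]rmorphM Euv.
  by rewrite rmorphM mulrA Ea.
have := ev_and (ev_and xT yU) (ev_and (ev_red_mul b u) (ev_red_mul s v)).
move=> /(ev_and (ev_and (redD_frac s0 Ea) (redD_frac t0 Eb))).
move=> /(ev_and (ev_and (ev_red_mul t u) (ev_red_mul a v))) /ev_mono; apply.
move=> k phi Dk ik _ [[Etu Eav] [[E1 E2] [[<- <-] [Ebu Esv]]]].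
rewrite Etu Eav !rmorphM mulrA -[_ * _ * ik (red phi t)]mulrA E2 -mulrA.
by rewrite -[ik (red phi b) * _]rmorphM -Ebu Euv Esv rmorphM mulrA E1.
Qed.

Lemma reduces_scale e x (T : reduction_value) : reduces x T ->
  reduces (e *: x) (fun k phi Dk ik => phi e *: T k phi Dk ik).
Proof.
move=> xT; have [a [s [s0 Ea]]] := frac_mul skew iC_inj iC_fracP x.
apply: (reduces_frac s0 (a := e *: a)); first by rewrite -scalerAl Ea linearZ_LR.
have := ev_and (ev_and xT (redD_frac s0 Ea)) (ev_red_scale e a).
move=> /ev_mono; apply.
by move=> k phi Dk ik _ [[<- E] ->]; rewrite -scalerAl E linearZ_LR.
Qed.

Lemma reduces0 : reduces 0 (fun k phi Dk ik => 0).
Proof.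
have := reduces_iC 0; rewrite rmorph0 => /reduces_mono; apply.
exists [::] => k phi _ Dk ik _.
by rewrite /red /mcoefmap msupp0 big_nil; exact: (rmorph0 ik).
Qed.

Lemma reduces1 : reduces 1 (fun k phi Dk ik => 1).
Proof.
have := reduces_iC 1; rewrite rmorph1 => /reduces_mono; apply.
have := ev_red_mon K (c := c) 0%MM; rewrite !pmon0 => /ev_mono; apply.
by move=> k phi Dk ik _; rewrite pmon0 => ->; rewrite rmorph1.
Qed.

Lemma reduces_sum (I : Type) (r : seq I) (f : I -> D) (T : I -> reduction_value) :
  (forall i, reduces (f i) (T i)) ->
  reduces (\sum_(i <- r) f i) (fun k phi Dk ik => \sum_(i <- r) T i k phi Dk ik).
Proof.
move=> fT; elim: r => [|i r IHr].
  rewrite big_nil; apply: (reduces_mono reduces0); exists [::] => *.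
  by rewrite big_nil.
rewrite big_cons; apply: (reduces_mono (reduces_add (fT i) IHr)).
by exists [::] => *; rewrite big_cons.
Qed.

Lemma reduces_Mz x (T : reduction_value) n : reduces x T ->
  reduces (x *~ n) (fun k phi Dk ik => T k phi Dk ik *~ n).
Proof.
move=> xT; rewrite -scaler_int; apply: (reduces_mono (reduces_scale n%:~R xT)).
exists [::] => k phi [S [[S1 SB _] [phi1 phiB _] _ _]] Dk ik _.
by have [_ ->] := spec_int S1 SB phi1 phiB n; rewrite scaler_int.
Qed.

Lemma reduces_unique x (T U : reduction_value) : reduces x T -> reduces x U ->
  eventually (fun k phi Dk ik => T k phi Dk ik = U k phi Dk ik).
Proof. by move=> xT xU; apply: (ev_mono2 xT xU) => k phi Dk ik _ <- <-. Qed.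

Lemma redD_neq0 x : x != 0 -> eventually (fun k phi Dk ik => redD phi ik x != 0).
Proof.
move=> x0; have n0 : num x != 0.
  apply: contraNneq x0 => n0; rewrite -(mulrK (skew (iA_neq0 iC_inj (den_neq0 x))) x).
  by rewrite num_den n0 rmorph0 mul0r.
apply: (ev_mono2 (ev_red_neq0 n0) (ev_red_neq0 (den_neq0 x))).
move=> k phi Dk ik [sk ik_inj _] n0' d0'.
rewrite /redD; apply: contraNneq (iA_neq0 ik_inj n0') => E.
by rewrite -[ik _](divrK (sk _ (iA_neq0 ik_inj d0'))) E mul0r.
Qed.

Section Generators.
Variables (d : sconst) (iW : {lrmorphism pbw d K -> D}).

Definition redgen (k : fieldType) (phi : K -> k) (Dk : unitAlgType k)
  (ik : {lrmorphism pbw c k -> Dk}) (i : 'I_(rk d)) : Dk :=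
  redD phi ik (iW (pgen K i)).

Lemma ev_redgen_srel : eventually (fun k phi Dk ik => srel (redgen phi ik)).
Proof.
apply: ev_all => i; apply: ev_all => j.
pose w i := iW (pgen K i).
(* The commutator is written as a sum with a (-1)-multiple to fit [reduces_add] and [reduces_Mz]. *)
have comm : reduces (w i * w j + (w j * w i) *~ (-1)) (fun k phi Dk ik =>
    redgen phi ik i * redgen phi ik j + (redgen phi ik j * redgen phi ik i) *~ (-1)).
  apply: reduces_add; [|apply: reduces_Mz]; apply: reduces_mul; exact: reduces_refl.
have rhs : reduces (\sum_k w k *~ cc i j k + 1 *~ cd i j) (fun k phi Dk ik =>
    \sum_l redgen phi ik l *~ cc i j l + 1 *~ cd i j).
  apply: reduces_add; last exact/reduces_Mz/reduces1.
  by apply: reduces_sum => l; apply: reduces_Mz; exact: reduces_refl.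
have E : w i * w j + (w j * w i) *~ (-1) = \sum_k w k *~ cc i j k + 1 *~ cd i j.
  by rewrite mulrNz mulr1z; exact: (hom_srel iW (@pgen_srel d K)).
rewrite E in comm; apply: (ev_mono (reduces_unique comm rhs)).
by move=> k phi Dk ik _; rewrite mulrNz mulr1z.
Qed.

Lemma reduces_pbw (p : pbw d K) :
  reduces (iW p) (fun k phi Dk ik => pev (redgen phi ik) (red phi p)).
Proof.
have monP m : reduces (zmon (iW \o @pgen d K) m)
    (fun k phi Dk ik => zmon (redgen phi ik) m).
  elim/low_ind: m => [|j m jm IHm].
    rewrite zmon0; apply: (reduces_mono reduces1); exists [::] => *.
    by rewrite zmon0.
  rewrite zmonU //; apply: (reduces_mono (reduces_mul (reduces_refl _) IHm)).
  by exists [::] => *; rewrite zmonU.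
rewrite pbw_homE /pev /mext.
have := reduces_sum (msupp (p : {mpoly K[rk d]}))
  (fun m => reduces_scale (p : {mpoly K[rk d]})@_m (monP m)).
move/reduces_mono; apply; exists [::] => k phi _ Dk ik _.
rewrite -[RHS]/(pev (redgen phi ik) (red phi p)) /red /mcoefmap.
rewrite (zmorph_sum (pevB (redgen phi ik))); apply: eq_bigr => m _.
by rewrite -[X in pev _ X]/(_ *: pmon k m) pevZ.
Qed.

End Generators.
End ReductionOfFractions.

(** The generators of the second algebra are sent to their reductions [redgen]. The numerators [P i]
    and the denominator [Q], evaluated there, still express the generators of the first algebra. *)
Theorem transfer (K : fieldType) (c d : sconst) (D : unitAlgType K)
    (iC : {lrmorphism pbw c K -> D}) (iW : {lrmorphism pbw d K -> D}) :
  [pchar K] =i pred0 ->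
  is_skew_field_of_fractions iC -> is_skew_field_of_fractions iW ->
  exists p0 : nat, forall p, prime p -> (p0 <= p)%N ->
  forall k : closedFieldType, p \in [pchar k] ->
  forall (Dk : unitAlgType k) (ik : {lrmorphism pbw c k -> Dk}),
  is_skew_field_of_fractions ik ->
  exists h : {lrmorphism pbw d k -> Dk}, is_skew_field_of_fractions h.
Proof.
move=> char0 fC fW; have [skew iC_inj iC_frac] := fC; have [_ iW_inj iW_frac] := fW.
(* Over [K] the comparison is made in the other direction: the generators of the second algebra are
   fractions over the first. *)
have rank_dc : (rk d <= rk c)%N.
  have [s s0 sP] := common_denominator skew iC_inj iC_frac (codom (iW \o @pgen d K)).
  have /choice[P PP] : forall i, exists p, iW (pgen K i) * iC s = iC p.
    by move=> i; apply: sP; exact: (codom_f (iW \o @pgen d K)).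
  exact: (rank_le skew fW (iA_neq0 iC_inj s0) PP).
have [Q Q0 QP] := common_denominator skew iW_inj iW_frac (codom (iC \o @pgen c K)).
have /choice[P PP] : forall i, exists p, iC (pgen K i) * iW Q = iW p.
  by move=> i; apply: QP; exact: (codom_f (iC \o @pgen c K)).
have evQ : eventually (fun k phi Dk ik =>
    pev (redgen fC iW phi ik) (red phi Q) != 0).
  apply: (ev_mono2 (reduces_pbw fC iW Q) (redD_neq0 fC (iA_neq0 iW_inj Q0))).
  by move=> k phi Dk ik _ <-.
have evP : eventually (fun k phi Dk ik => forall i,
    ik (pgen k i) * pev (redgen fC iW phi ik) (red phi Q) =
    pev (redgen fC iW phi ik) (red phi (P i))).
  apply: ev_all => i.
  have := reduces_mul (reduces_iC fC (pgen K i)) (reduces_pbw fC iW Q).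
  rewrite PP => /reduces_unique/(_ (reduces_pbw fC iW (P i))).
  move=> /(ev_mono2 (ev_red_mon K U_(i)%MM)); apply.
  by move=> k phi Dk ik _ E <-; rewrite -[red phi (pgen K i)]/(red phi (pmon K _)) E.
(* All requirements are gathered in one finite list of elements of [K] before any prime is
   chosen. *)
have [l lP] := ev_and (ev_redgen_srel fC iW) (ev_and evQ evP).
have [p0 p0P] := specialization_exists l char0.
exists p0 => p p_prime pp k kp Dk ik fk; have [phi spec] := p0P p p_prime pp k kp.
have [wrel [hQ hP]] := lP k phi spec Dk ik fk.
have [h hE] := pev_hom wrel; rewrite -hE in hQ.
have {}hP i : ik (pgen k i) * h (red phi Q) = h (red phi (P i)).
  by rewrite !hE hP.
have [skewk _ _] := fk.
(* A kernel would give [rk c < rk d], against the comparison made over [K]. *)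
have h_inj : injective h.
  move=> x y xy; apply/eqP; rewrite -subr_eq0; apply/contraT => xy0.
  have hxy : h (x - y) = 0 by rewrite rmorphB /= xy subrr.
  by have := rank_lt_of_ker skewk fk hQ hP xy0 hxy; rewrite ltnNge rank_dc.
exists h; apply: (fractions_of_generators skewk fk h_inj) => i.
exists (red phi (P i)), (red phi Q); split=> //.
by apply: contraNneq hQ => ->; rewrite rmorph0.
Qed.

(** * Weyl algebras *)

Section UniversalAlgebras.
Variables (F : fieldType) (X : Type).
Variable P : forall A : algType F, (X -> A) -> Prop.

Lemma universal_endo (A : algType F) (j : X -> A) (h : {lrmorphism A -> A}) :
  universal_algebra P j -> (forall x, h (j x) = j x) -> h =1 id.
Proof.
move=> [Pj univ] hj a; have [phi [_ uniq]] := univ A j Pj.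
by rewrite (uniq h hj) -(uniq idfun).
Qed.

Lemma universal_iso (A B : algType F) (j : X -> A) (j' : X -> B) :
  universal_algebra P j -> universal_algebra P j' ->
  exists (h : {lrmorphism A -> B}) (h' : {lrmorphism B -> A}),
    [/\ forall x, h (j x) = j' x, forall x, h' (j' x) = j x,
        cancel h h' & cancel h' h].
Proof.
move=> uj uj'; have [h [hj _]] := uj.2 B j' uj'.1.
have [h' [hj' _]] := uj'.2 A j uj.1.
exists h, h'; split=> //.
  by apply: (universal_endo (h := h' \o h) uj) => x /=; rewrite hj hj'.
by apply: (universal_endo (h := h \o h') uj') => x /=; rewrite hj' hj.
Qed.

Lemma universal_fractions (A B : algType F) (j : X -> A) (j' : X -> B)
    (D : unitAlgType F) (i : {lrmorphism A -> D}) :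
  universal_algebra P j -> universal_algebra P j' ->
  is_skew_field_of_fractions i ->
  exists i' : {lrmorphism B -> D}, is_skew_field_of_fractions i'.
Proof.
move=> uj uj' [skew inj frac]; have [h [h' [_ _ hK h'K]]] := universal_iso uj uj'.
exists (i \o h'); split=> //; first exact: inj_comp inj (can_inj h'K).
move=> x; have [a [s [s0 ->]]] := frac x; exists (h a), (h s).
by rewrite /= !hK -(rmorph0 h) (inj_eq (can_inj hK)).
Qed.

End UniversalAlgebras.

Lemma fractions_comp (F : fieldType) (A : algType F) (D E : unitAlgType F)
    (i : {lrmorphism A -> D}) (f : {lrmorphism D -> E}) :
  bijective f -> is_skew_field_of_fractions i ->
  exists i' : {lrmorphism A -> E}, is_skew_field_of_fractions i'.
Proof.
move=> [g fK gK] [skew inj frac]; exists (f \o i); split=> [x x0||x].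
- rewrite -(gK x); apply/rmorph_unit/skew; apply: contraNneq x0 => gx0.
  by rewrite -(gK x) gx0 rmorph0.
- exact: inj_comp (can_inj fK) inj.
have [a [s [s0 E']]] := frac (g x); exists a, s; split=> //=.
rewrite -(gK x) E' rmorphM rmorphV //; apply: skew.
by rewrite -(rmorph0 i) (inj_eq inj).
Qed.

Section CommutingEvaluation.
Variable F : fieldType.

Lemma comm_pev (c : sconst) (B : algType F) (z : 'I_(rk c) -> B) (b : B) p :
  (forall i, GRing.comm b (z i)) -> GRing.comm b (pev z p).
Proof.
move=> bz; rewrite /pev /mext; elim/big_ind: _ => [|x y|m _]; [exact: commr0|exact: commrD|].
rewrite /GRing.comm -scalerAl -scalerAr; congr (_ *: _).
elim/low_ind: m => [|j m jm IHm]; first by rewrite zmon0 mulr1 mul1r.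
by rewrite zmonU //; exact: commrM (bz j) IHm.
Qed.

Variable s : nat.

(** With zero constants, [zmon] and [pev] evaluate commutative polynomials at commuting elements of
    an arbitrary algebra. *)
Definition abelian_sconst : sconst.
Proof.
apply: (@SConst s (fun _ _ _ => 0) (fun _ _ => 0)) => // *; rewrite ?oppr0 //;
  by apply: big1 => *; rewrite !mul0r !addr0.
Defined.

Variables (B : algType F) (z : 'I_s -> B).
Hypothesis zC : forall i j, GRing.comm (z i) (z j).
Local Notation zmon := (@zmon abelian_sconst F B z).

Lemma zmonU_comm i m : zmon (U_(i) + m) = z i * zmon m.
Proof.
elim/low_ind: m => [|j m jm IHm].
  by rewrite (zmonU (c := abelian_sconst)) //; apply/belowP => j _; rewrite mnm0E.
have [ij|ji] := leqP i j.
  by rewrite (zmonU (c := abelian_sconst)) //; exact/below_add/below_le/jm.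
rewrite [(_ + _)%MM](_ : _ = U_(j) + (U_(i) + m))%MM; last first.
  by rewrite !addmA [(U_(i) + _)%MM]addmC.
rewrite (zmonU (c := abelian_sconst)); last by apply: below_add => //; exact: ltnW.
by rewrite IHm (zmonU (c := abelian_sconst)) // !mulrA zC.
Qed.

Lemma zmonD_comm a b : zmon (a + b) = zmon a * zmon b.
Proof.
elim/low_ind: a => [|j m jm IHm].
  by rewrite add0m (zmon0 (c := abelian_sconst)) mul1r.
by rewrite -addmA !zmonU_comm IHm mulrA.
Qed.

Lemma mpoly_eval : exists h : {lrmorphism {mpoly F[s]} -> B},
  forall i, h 'X_i = z i.
Proof.
pose ev (p : {mpoly F[s]}) := @pev abelian_sconst F B z p.
have evB : zmod_morphism ev by exact: (@pevB abelian_sconst F B z).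
have evZ a p : ev (a *: p) = a *: ev p by exact: (@pev_scalable abelian_sconst F B z).
have evX m : ev 'X_[m] = zmon m by exact: (@pev_mon abelian_sconst F B z).
have [|| h hE] := @lrmorphism_pack F {mpoly F[s]} B ev.
- exact: (@pev_linear abelian_sconst F B z).
(* The product of [{mpoly F[s]}] is not [star] by definition, so multiplicativity is derived from
   [zmonD_comm] instead of [pev_mul]. *)
- split=> [|p q]; first exact: (@pev1 abelian_sconst F B z).
  pose f x := ev (x * q); pose g x := ev x * ev q.
  apply: (eq_additive_mpoly (f := f) (g := g)) => [x y|x y|a m].
  + by rewrite /f mulrBl evB.
  + by rewrite /g evB mulrBl.
  rewrite /f /g {f g} -scalerAl !evZ -scalerAl; congr (_ *: _).
  pose f x := ev ('X_[m] * x); pose g x := ev 'X_[m] * ev x.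
  apply: (eq_additive_mpoly (f := f) (g := g)) => [x y|x y|b l].
  + by rewrite /f mulrBr evB.
  + by rewrite /g evB mulrBr.
  rewrite /f /g -scalerAr !evZ -scalerAr; congr (_ *: _).
  by rewrite -mpolyXD !evX zmonD_comm.
exists h => i; rewrite hE evX -[U_(i)%MM]addm0 zmonU_comm.
by rewrite (zmon0 (c := abelian_sconst)) mulr1.
Qed.

Lemma mpoly_homE (h : {lrmorphism {mpoly F[s]} -> B}) :
  (forall i, h 'X_i = z i) -> forall p, h p = @pev abelian_sconst F B z p.
Proof.
move=> hz p; rewrite [in LHS](mpolyE p) linear_sum /=; apply: eq_bigr => m _.
rewrite linearZ_LR /=; congr (_ *: _); elim/low_ind: m => [|j m jm IHm].
  by rewrite mpolyX0 rmorph1 (zmon0 (c := abelian_sconst)).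
by rewrite mpolyXD rmorphM /= hz IHm zmonU_comm.
Qed.

End CommutingEvaluation.

Section WeylPolynomial.
Variables (F : fieldType) (r s : nat).

(** The indices run through the [u_i], then the [v_i], then the central [y_i]. *)
Definition weyl_cd (a b : 'I_(r + r + s)) : int :=
  match split a, split b with
  | inl a', inl b' => match split a', split b' with
    | inl i, inr j => (i == j)%:Z
    | inr i, inl j => - (i == j)%:Z
    | _, _ => 0
    end
  | _, _ => 0
  end.

Definition weyl_sconst : sconst.
Proof.
apply: (@SConst (r + r + s) (fun _ _ _ => 0) weyl_cd) => [*|a b|*|*].
- by rewrite oppr0.
- rewrite /weyl_cd; case: (split a) => a'; case: (split b) => b'; rewrite ?oppr0 //.
  by case: (split a') => i; case: (split b') => j; rewrite ?oppr0 ?opprK // eq_sym.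
- by apply: big1 => *; rewrite !mul0r !addr0.
- by apply: big1 => *; rewrite !mul0r !addr0.
Defined.

Definition weyl_index (x : ('I_r + 'I_r) + 'I_s) : 'I_(r + r + s) :=
  match x with inl y => lshift s (unsplit y) | inr i => rshift (r + r) i end.

Definition weyl_unindex (a : 'I_(r + r + s)) : ('I_r + 'I_r) + 'I_s :=
  match split a with inl b => inl (split b) | inr i => inr i end.

Lemma weyl_indexK : cancel weyl_index weyl_unindex.
Proof.
case=> [y|i]; rewrite /weyl_unindex /weyl_index.
  by rewrite -[lshift _ _]/(unsplit (inl (unsplit y))) unsplitK unsplitK.
by rewrite -[rshift _ _]/(unsplit (inr i)) unsplitK.
Qed.

Lemma weyl_unindexK : cancel weyl_unindex weyl_index.
Proof.
move=> a; rewrite /weyl_unindex -[RHS]splitK.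
by case: (split a) => b //=; rewrite splitK.
Qed.

Definition weyl_poly_relations (A : algType F) (f : ('I_r + 'I_r) + 'I_s -> A) :=
  weyl_relations (f \o inl) /\ forall i x, GRing.comm (f (inr i)) (f x).

Lemma weyl_cdE x y : weyl_cd (weyl_index x) (weyl_index y) = match x, y with
  | inl (inl i), inl (inr j) => (i == j)%:Z
  | inl (inr i), inl (inl j) => - (i == j)%:Z
  | _, _ => 0
  end.
Proof.
rewrite /weyl_cd; have := weyl_indexK x; have := weyl_indexK y; rewrite /weyl_unindex.
case: (split (weyl_index x)) => a; case: (split (weyl_index y)) => b <- <- //=.
by case: (split a).
Qed.

Lemma weyl_srelP (A : algType F) (f : ('I_r + 'I_r) + 'I_s -> A) :
  srel (c := weyl_sconst) (f \o weyl_unindex) <-> weyl_poly_relations f.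
Proof.
have sumE (z : 'I_(r + r + s) -> A) : \sum_k z k *~ 0 = 0 by rewrite big1.
have srelE : srel (c := weyl_sconst) (f \o weyl_unindex) <->
    forall x y, f x * f y - f y * f x = (weyl_cd (weyl_index x) (weyl_index y))%:~R.
  split=> [H x y|H a b /=].
    by have := H (weyl_index x) (weyl_index y); rewrite /= !weyl_indexK sumE add0r.
  by rewrite sumE add0r H !weyl_unindexK.
split=> [/srelE H|[H C]].
  split=> [i j /=|i x]; first by rewrite !H !weyl_cdE.
  by apply/eqP; rewrite -subr_eq0 H weyl_cdE.
apply/srelE => x y; rewrite weyl_cdE.
have C' u v : GRing.comm u v -> u * v - v * u = 0 :> A by move=> ->; rewrite subrr.
case: x y => [x|i] [y|j].
- case: x y => [i|i] [j|j] /=.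
  + by have [E _ _] := H i j; exact: E.
  + by have [_ _ E] := H i j; exact: E.
  + by rewrite mulrNz -opprB eq_sym; have [_ _ E] := H j i; congr (- _); exact: E.
  + by have [_ E _] := H i j; exact: E.
- by rewrite C' ?[RHS]mulr0z; [case: x|exact/commr_sym/C].
- by rewrite C'; [case: y|exact: C].
- by rewrite C'; last exact: C.
Qed.

Lemma pbw_weyl_universal : universal_algebra weyl_poly_relations
  (fun x => @pgen weyl_sconst F (weyl_index x) ).
Proof.
have genE : (fun x => @pgen weyl_sconst F (weyl_index x)) \o weyl_unindex = @pgen weyl_sconst F.
  by apply/funext => a /=; rewrite weyl_unindexK.
split; first by apply/weyl_srelP; rewrite genE; exact: pgen_srel.
move=> B f /weyl_srelP frel; have [phi phiE] := pev_hom frel.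
have gen x : phi (@pgen weyl_sconst F (weyl_index x)) = f x.
  rewrite phiE pev_mon -[U_(_)%MM]addm0 zmonU; last first.
    by apply/belowP => *; rewrite mnm0E.
  by rewrite zmon0 mulr1 /= weyl_indexK.
exists phi; split=> // psi psiE p; rewrite !pbw_homE; apply: eq_pev => a /=.
by rewrite -(weyl_unindexK a) psiE gen.
Qed.

End WeylPolynomial.

Section WeylAlgebra.
Variables (F : fieldType) (r : nat).

Lemma pbw_weyl_algebra : is_weyl_algebra
  (fun x => @pgen (weyl_sconst r 0) F (@weyl_index r 0 (inl x))).
Proof.
have [[rel _] univ] := pbw_weyl_universal F r 0; split=> // B f frel.
pose f' (x : ('I_r + 'I_r) + 'I_0) : B := if x is inl y then f y else 1.
have f'rel : weyl_poly_relations f' by split=> // -[].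
have [phi [phiE uniq]] := univ B f' f'rel; exists phi; split=> [x|psi psiE].
  exact: (phiE (inl x)).
by apply: uniq => -[x|[]] //; exact: psiE.
Qed.

(** [A] is given by its universal property only; that the [w x] generate it is read off its
    isomorphism with the model [pbw]. *)
Lemma comm_weyl (A : algType F) (w : 'I_r + 'I_r -> A) (B : algType F)
    (f : {lrmorphism A -> B}) (b : B) :
  is_weyl_algebra w -> (forall x, GRing.comm b (f (w x))) ->
  forall a, GRing.comm b (f a).
Proof.
move=> wA bw a.
have [h [h' [hw h'w hK h'K]]] := universal_iso wA pbw_weyl_algebra.
rewrite -(hK a) -[f _]/((f \o h') (h a)) pbw_homE; apply: comm_pev => i /=.
rewrite -(weyl_unindexK i); case: (weyl_unindex i) => [x|[]//].
by rewrite h'w.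
Qed.

Lemma weyl_hom_ext (A : algType F) (w : 'I_r + 'I_r -> A) (B : algType F)
    (f g : {lrmorphism A -> B}) :
  is_weyl_algebra w -> (forall x, f (w x) = g (w x)) -> f =1 g.
Proof.
move=> [wrel univ] fg a.
have grel : weyl_relations (g \o w).
  move=> i j; have [E1 E2 E3] := wrel i j.
  by split; rewrite /= -!rmorphM -rmorphB ?E1 ?E2 ?E3 ?rmorph0 ?rmorph_nat.
have [phi [_ uniq]] := univ B _ grel.
by rewrite (uniq f fg) -(uniq g).
Qed.

End WeylAlgebra.

Section Tensor.
Variables (F : fieldType) (r s : nat).

Lemma mpoly_hom_ext (B : algType F) (f g : {lrmorphism {mpoly F[s]} -> B}) :
  (forall i, f 'X_i = g 'X_i) -> f =1 g.
Proof.
move=> fg p; have C i j : GRing.comm (g 'X_i) (g 'X_j).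
  by rewrite /GRing.comm -!rmorphM mulrC.
by rewrite (mpoly_homE C fg) (mpoly_homE (z := fun i => g 'X_i) C).
Qed.

Lemma comm_mpoly (B : algType F) (f : {lrmorphism {mpoly F[s]} -> B}) (b : B) :
  (forall i, GRing.comm b (f 'X_i)) -> forall p, GRing.comm b (f p).
Proof.
move=> bf p; have C i j : GRing.comm (f 'X_i) (f 'X_j).
  by rewrite /GRing.comm -!rmorphM mulrC.
rewrite (mpoly_homE (z := fun i => f 'X_i) C) //.
exact: (comm_pev (c := abelian_sconst s)).
Qed.

(** Turning the tensor product into one presentation by all the generators lets it be identified
    with [pbw (weyl_sconst r s) F] by uniqueness of universal objects. *)
Lemma weyl_poly_universal (T : algType F) : is_weyl_poly_algebra r s T ->
  exists j : ('I_r + 'I_r) + 'I_s -> T, universal_algebra (@weyl_poly_relations F r s) j.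
Proof.
move=> [A [w [iA [iP [wA [iC univ]]]]]].
exists (fun x => match x with inl y => iA (w y) | inr i => iP 'X_i end).
split.
  split=> [i j|i [y|j]].
  - have [E1 E2 E3] := wA.1 i j.
    by split; rewrite /= -!rmorphM -rmorphB ?E1 ?E2 ?E3 ?rmorph0 ?rmorph_nat.
  - exact/commr_sym/iC.
  - by rewrite /GRing.comm -!rmorphM mulrC.
move=> B f [frel fC].
have [fA [fAE _]] := wA.2 B _ frel.
have [|fP fPE] := @mpoly_eval F s B (f \o inr); first by move=> i j; exact: fC.
have fAP a b : GRing.comm (fA a) (fP b).
  apply: comm_mpoly => i; apply/commr_sym; apply: (comm_weyl wA) => x.
  by rewrite fPE fAE; exact: fC.
have [phi [[phiA phiP] uniq]] := univ B fA fP fAP.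
exists phi; split=> [[y|i]|psi psiE]; [by rewrite phiA fAE|by rewrite phiP fPE|].
apply: uniq => [a|b].
  apply: (weyl_hom_ext (f := psi \o iA) (g := fA) wA) => x.
  by rewrite /= (psiE (inl x)) fAE.
apply: (mpoly_hom_ext (f := psi \o iP) (g := fP)) => i.
by rewrite /= (psiE (inr i)) fPE.
Qed.

Lemma pbw_weyl_poly_algebra : is_weyl_poly_algebra r s (pbw (weyl_sconst r s) F).
Proof.
have [[rel relC] univ] := pbw_weyl_universal F r s.
pose gen x : pbw (weyl_sconst r s) F := @pgen (weyl_sconst r s) F (@weyl_index r s x).
have wA := pbw_weyl_algebra F r.
have [iA [iAE _]] := wA.2 _ (gen \o inl) rel.
have [|iP iPE] := @mpoly_eval F s _ (gen \o inr); first by move=> i j; exact: relC.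
exists (pbw (weyl_sconst r 0) F).
exists (fun x => @pgen (weyl_sconst r 0) F (@weyl_index r 0 (inl x))), iA, iP.
split=> //; split=> [a b|C f g fg].
  apply: comm_mpoly => i; apply/commr_sym; apply: (comm_weyl wA) => x.
  by rewrite iPE iAE; exact: relC.
pose u (x : ('I_r + 'I_r) + 'I_s) : C := match x with
  | inl y => f (@pgen (weyl_sconst r 0) F (@weyl_index r 0 (inl y)))
  | inr i => g 'X_i end.
have urel : weyl_poly_relations u.
  split=> [i j|i [y|j]].
  - have [E1 E2 E3] := wA.1 i j.
    by split; rewrite /= -!rmorphM -rmorphB ?E1 ?E2 ?E3 ?rmorph0 ?rmorph_nat.
  - exact/commr_sym/fg.
  - by rewrite /u /GRing.comm -!rmorphM mulrC.
have [phi [phiE uniq]] := univ C u urel; exists phi; split.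
  split=> [a|b].
    apply: (weyl_hom_ext (f := phi \o iA) wA) => x /=.
    by rewrite iAE (phiE (inl x)).
  apply: (mpoly_hom_ext (f := phi \o iP)) => i /=.
  by rewrite iPE (phiE (inr i)).
move=> psi psiA psiP; apply: uniq => -[y|i].
  by rewrite -[pgen F _]/((gen \o inl) y) -iAE psiA.
by rewrite -[pgen F _]/((gen \o inr) i) -iPE psiP.
Qed.

End Tensor.

(** * Lie algebras and Chevalley forms *)

Section LieBasics.
Variables (F : fieldType) (L : lieType F).
Implicit Types x y z : L.

Lemma brackBl y : zmod_morphism (brack^~ y).
Proof.
move=> u v; have /= := brack_linearl y (-1) v u.
by rewrite !scaleN1r => E; rewrite addrC E addrC.
Qed.

Lemma brackBr x : zmod_morphism (brack x).
Proof.
move=> u v; have /= := brack_linearr x (-1) v u.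
by rewrite !scaleN1r => E; rewrite addrC E addrC.
Qed.

Lemma brackZl a x y : brack (a *: x) y = a *: brack x y.
Proof.
by have /= := brack_linearl y a x 0; rewrite !addr0 (zmorph0 (brackBl y)) addr0.
Qed.

Lemma brackZr a x y : brack x (a *: y) = a *: brack x y.
Proof.
by have /= := brack_linearr x a y 0; rewrite !addr0 (zmorph0 (brackBr x)) addr0.
Qed.

Lemma brack_anti x y : brack x y = - brack y x.
Proof.
apply/eqP; rewrite -addr_eq0; apply/eqP.
have := brackxx (x + y).
rewrite (zmorphD (brackBl _)) !(zmorphD (brackBr _)) !brackxx add0r addr0.
by [].
Qed.

End LieBasics.

(** * Enveloping algebras of Lie algebras with integral structure constants *)

Section EnvelopingAlgebra.
Variables (F : fieldType) (L : lieType F) (c : sconst).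
Variables (e : 'I_(rk c) -> L) (co : 'I_(rk c) -> L -> F).
Hypothesis co_linear : forall i a x y, co i (a *: x + y) = a * co i x + co i y.
Hypothesis co_e : forall i j, co j (e i) = (i == j)%:R.
Hypothesis coE : forall x, x = \sum_i co i x *: e i.
Hypothesis brack_e : forall i j, brack (e i) (e j) = \sum_k e k *~ cc i j k.
Hypothesis cd0 : forall i j, cd (s := c) i j = 0.

Definition lie_embed (x : L) : pbw c F := \sum_i co i x *: pgen F i.

Lemma lie_embed_linear : linear lie_embed.
Proof.
move=> a x y; rewrite /lie_embed scaler_sumr -big_split; apply: eq_bigr => i _.
by rewrite co_linear scalerDl scalerA.
Qed.

Lemma lie_embed_e i : lie_embed (e i) = pgen F i.
Proof.
rewrite /lie_embed (bigD1 i) //= co_e eqxx scale1r big1 ?addr0 // => j ji.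
by rewrite co_e eq_sym (negPf ji) scale0r.
Qed.

Lemma lie_map_basis (B : algType F) (f : L -> B) : linear f ->
  srel (f \o e) <-> lie_map f.
Proof.
move=> fl; have fB : zmod_morphism f.
  by move=> x y; rewrite -scaleN1r addrC fl scaleN1r addrC.
have fZ a x : f (a *: x) = a *: f x.
  by rewrite -[a *: x]addr0 fl (zmorph0 fB) addr0.
have f_brack i j : f (brack (e i) (e j)) = \sum_k f (e k) *~ cc i j k.
  by rewrite brack_e (zmorph_sum fB); apply: eq_bigr => k _; rewrite (zmorphMz fB).
split=> [rel|[_ fbr] i j /=]; last by rewrite -fbr f_brack cd0 addr0.
split=> // x y.
have expand (x' y' : L) (b : L -> L -> B) :
    (forall v, zmod_morphism (b^~ v)) -> (forall u, zmod_morphism (b u)) ->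
    (forall a u v, b (a *: u) v = a *: b u v) ->
    (forall a u v, b u (a *: v) = a *: b u v) ->
    b x' y' = \sum_i \sum_j (co i x' * co j y') *: b (e i) (e j).
  move=> bl br bZl bZr; rewrite [in LHS](coE x') (zmorph_sum (bl _)).
  apply: eq_bigr => i _; rewrite bZl [in LHS](coE y') (zmorph_sum (br _)) scaler_sumr.
  by apply: eq_bigr => j _; rewrite bZr scalerA.
rewrite (expand _ _ (fun u v => f (brack u v))); first last.
- by move=> *; rewrite brackZr fZ.
- by move=> *; rewrite brackZl fZ.
- by move=> u v w; rewrite brackBr fB.
- by move=> u v w; rewrite brackBl fB.
have swap (p q r s : B) : p - q - (r - s) = p - r - (q - s) by zgroup.
rewrite (expand _ _ (fun u v => f u * f v - f v * f u)); first last.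
- by move=> a u v; rewrite fZ -scalerAl -scalerAr scalerBr.
- by move=> a u v; rewrite fZ -scalerAl -scalerAr scalerBr.
- by move=> u v w /=; rewrite !fB mulrBl mulrBr; exact: swap.
- by move=> u v w /=; rewrite !fB mulrBl mulrBr; exact: swap.
apply: eq_bigr => i _; apply: eq_bigr => j _; congr (_ *: _).
by rewrite f_brack; have := rel i j; rewrite /= cd0 addr0 => ->.
Qed.

Lemma pbw_enveloping : is_enveloping_algebra lie_embed.
Proof.
split.
  apply/lie_map_basis; first exact: lie_embed_linear.
  move=> i j /=; rewrite !lie_embed_e pgen_srel; congr (_ + _).
  by apply: eq_bigr => k _; rewrite lie_embed_e.
move=> B f fL; have fl := fL.1; have /lie_map_basis rel := fL.
have [phi phiE] := pev_hom (rel fl).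
have phi_gen i : phi (pgen F i) = f (e i).
  rewrite phiE pev_mon -[U_(_)%MM]addm0 zmonU ?zmon0 ?mulr1 //.
  by apply/belowP => *; rewrite mnm0E.
exists phi; split=> [x|psi psiE p].
  rewrite /lie_embed linear_sum [in RHS](coE x) /=.
  have fB : zmod_morphism f.
    by move=> u v; rewrite -scaleN1r addrC fl scaleN1r addrC.
  rewrite (zmorph_sum fB); apply: eq_bigr => i _; rewrite linearZ_LR /= phi_gen.
  by rewrite -[_ *: e i]addr0 fl (zmorph0 fB) addr0.
by rewrite !pbw_homE; apply: eq_pev => i /=; rewrite phi_gen -psiE lie_embed_e.
Qed.

End EnvelopingAlgebra.

(** * Integral forms and their extension of scalars *)

Section IntegralForm.
Variables (K : fieldType) (L : lieType K) (n : nat) (X : n.-tuple L).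
Hypothesis char0 : [pchar K] =i pred0.
Hypothesis X_basis : basis_of fullv X.
Hypothesis X_int : forall i j : 'I_n, inIntSpan X (brack X`_i X`_j).

Let X_free : free X. Proof. exact: basis_free X_basis. Qed.

Lemma int_inj (a b : int) : a%:~R = b%:~R :> K -> a = b.
Proof.
move=> E; apply/eqP; rewrite -subr_eq0; have : (a - b)%:~R == 0 :> K.
  by rewrite rmorphB /= E subrr.
rewrite [X in X%:~R](intEsign (a - b)) rmorphM rmorph_sign mulf_eq0 signr_eq0 /=.
by rewrite -pmulrn; have [/(_ _) -> // _] := pcharf0P K; rewrite absz_eq0.
Qed.

Lemma int_free (a b : 'I_n -> int) :
  \sum_(i < n) X`_i *~ a i = \sum_(i < n) X`_i *~ b i -> a =1 b.
Proof.
move=> E i; apply: int_inj; apply/eqP; rewrite -subr_eq0; apply/eqP.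
move: i; apply: (freeP X_free (fun i => (a i)%:~R - (b i)%:~R)).
rewrite -[RHS](subrr (\sum_(i < n) X`_i *~ b i)) -{1}E -sumrB; apply: eq_bigr => i _.
by rewrite scalerBl !scaler_int.
Qed.

(** The identities hold in [L] and descend to the integers, since coordinates in a basis are unique
    and the integers embed in [K]. *)
Lemma integral_constants : exists C : 'I_n -> 'I_n -> 'I_n -> int,
  [/\ forall i j k, C i j k = - C j i k,
      forall i j l m, \sum_k (C i j k * C k l m + C j l k * C k i m
        + C l i k * C k j m) = 0
    & forall i j : 'I_n, brack X`_i X`_j = \sum_(k < n) X`_k *~ C i j k].
Proof.
have /choice[a aP] : forall ij : 'I_n * 'I_n, exists a : int ^ n,
    brack X`_ij.1 X`_ij.2 = \sum_(k < n) X`_k *~ a k by case=> i j; exact: X_int.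
pose C i j k := a (i, j) k.
have CP (i j : 'I_n) : brack X`_i X`_j = \sum_(k < n) X`_k *~ C i j k by exact: (aP (i, j)).
have anti (i j k : 'I_n) : C i j k = - C j i k.
  apply: (int_free (b := fun k => - C j i k)); rewrite -CP brack_anti CP -sumrN.
  by apply: eq_bigr => l _; rewrite mulrNz.
have jac (i j l m : 'I_n) :
    \sum_k (C i j k * C k l m + C j l k * C k i m + C l i k * C k j m) = 0.
  move: m; apply: (int_free (b := fun=> 0)); rewrite [RHS]big1 //.
  have double (u v w : 'I_n) : brack (brack X`_u X`_v) X`_w =
      \sum_(m < n) X`_m *~ (\sum_k C u v k * C k w m).
    rewrite CP (zmorph_sum (brackBl _)).
    under eq_bigr => k _ do rewrite (zmorphMz (brackBl _)) CP mulrz_suml.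
    rewrite exchange_big; apply: eq_bigr => m _ /=; rewrite mulrz_sumr.
    by apply: eq_bigr => k _; rewrite -mulrzA mulrC.
  have := jacobi X`_i X`_j X`_l; rewrite brack_anti [brack X`_j (brack _ _)]brack_anti.
  rewrite [brack X`_l (brack _ _)]brack_anti !double -!sumrN -!big_split /= => J.
  apply/eqP; rewrite -oppr_eq0 -sumrN -[X in _ == X]J; apply/eqP.
  have rot (p q t : L) : - (p + q + t) = - q - t - p by zgroup.
  by apply: eq_bigr => m _; rewrite !big_split /= !mulrzDr; exact: rot.
by exists C.
Qed.

Lemma int_span_gen (j : 'I_n) : inIntSpan X X`_j.
Proof.
exists [ffun l => (j == l)%:Z]; rewrite (bigD1 j) //= ffunE eqxx mulr1z big1 ?addr0 //.
by move=> l lj; rewrite ffunE eq_sym (negPf lj).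
Qed.

(** Universality towards the row vectors gives the coordinates. Universality towards [gk] itself
    shows that rebuilding an element from its coordinates is the identity, as both maps agree on the
    image of the lattice. *)
Lemma scalar_extension_basis (k : fieldType) (gk : lieType k) (i : L -> gk) :
  is_scalar_extension (inIntSpan X) i ->
  exists co : 'I_n -> gk -> k,
  [/\ forall j a x y, co j (a *: x + y) = a * co j x + co j y,
      forall j l : 'I_n, co l (i X`_j) = (j == l)%:R,
      forall x, x = \sum_(j < n) co j x *: i X`_j
    & forall a : int ^ n, i (\sum_(j < n) X`_j *~ a j) = \sum_(j < n) i X`_j *~ a j].
Proof.
case=> iD _ univ.
have span0 : inIntSpan X 0.
  by exists [ffun=> 0]; rewrite big1 // => j _; rewrite ffunE.
have spanD x y : inIntSpan X x -> inIntSpan X y -> inIntSpan X (x + y).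
  move=> [a ->] [b ->]; exists [ffun j => a j + b j]; rewrite -big_split.
  by apply: eq_bigr => j _; rewrite ffunE mulrzDr.
have spanMz x m : inIntSpan X x -> inIntSpan X (x *~ m).
  move=> [a ->]; exists [ffun j => a j * m]; rewrite mulrz_suml.
  by apply: eq_bigr => j _; rewrite ffunE mulrzA.
have i0 : i 0 = 0 by apply: (addrI (i 0)); rewrite -iD // !addr0.
have iMz x m : inIntSpan X x -> i (x *~ m) = i x *~ m.
  move=> Xx; have nat d : i (x *~ d%:Z) = i x *~ d%:Z.
    elim: d => [|d IHd]; first by rewrite !mulr0z.
    by rewrite intS !mulrzDr !mulr1z iD // ?IHd //; exact: spanMz.
  case: m => d; first exact: nat.
  apply: (addIr (i (x *~ d.+1%:Z))); rewrite -iD; [|exact: spanMz..].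
  by rewrite nat -!mulrzDr NegzE addNr !mulr0z.
have i_comb (a : int ^ n) : i (\sum_(j < n) X`_j *~ a j) = \sum_(j < n) i X`_j *~ a j.
  suff [] : inIntSpan X (\sum_(j < n) X`_j *~ a j) /\
    i (\sum_(j < n) X`_j *~ a j) = \sum_(j < n) i X`_j *~ a j by [].
  elim/big_rec2: _ => [//|j y z _ [Xz Ez]].
  have Xj := spanMz _ (a j) (int_span_gen j).
  by split; [exact: spanD|rewrite iD // Ez iMz //; exact: int_span_gen].
have /choice[cf cfP] : forall x, exists a : int ^ n,
    inIntSpan X x -> x = \sum_(j < n) X`_j *~ a j.
  move=> x; have [[a E]|nx] := pselect (inIntSpan X x); first by exists a.
  by exists [ffun=> 0] => /nx.
(* Off the lattice [cf] is the default 0; additivity is required on the lattice only. *)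
pose f (x : L) : 'rV[k]_n := \row_j (cf x j)%:~R.
have fD x y : inIntSpan X x -> inIntSpan X y -> f (x + y) = f x + f y.
  move=> Xx Xy; apply/rowP => j; rewrite !mxE -intrD; congr (_%:~R); move: j.
  apply: (int_free (b := fun j => cf x j + cf y j)).
  rewrite -cfP; last exact: spanD.
  rewrite {1}(cfP x Xx) {1}(cfP y Xy) -big_split; apply: eq_bigr => j _.
  by rewrite mulrzDr.
have [phi [phiE _]] := univ 'rV[k]_n f fD.
have phi_gen (j l : 'I_n) : phi (i X`_j) 0 l = (j == l)%:R.
  rewrite phiE; last exact: int_span_gen.
  rewrite mxE -[RHS]/((j == l)%:Z%:~R); congr (_%:~R); move: l.
  apply: (int_free (b := fun l => (j == l)%:Z)).
  rewrite -cfP; last exact: int_span_gen.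
  rewrite [RHS](bigD1 j) //= eqxx mulr1z big1 ?addr0 // => l lj.
  by rewrite eq_sym (negPf lj).
pose psi (y : gk) : gk := \sum_(j < n) phi y 0 j *: i X`_j.
have psi_linear : linear psi.
  move=> a x y; rewrite /psi scaler_sumr -big_split; apply: eq_bigr => j _ /=.
  by rewrite linearP !mxE scalerDl scalerA.
pose psiM := GRing.isLinear.Build k gk gk _ psi psi_linear.
pose psiL : {linear gk -> gk} := HB.pack psi psiM.
have [chi [_ uniq]] := univ gk i iD.
have psiE : psi =1 id.
  move=> y; have idE : idfun y = chi y := uniq idfun (fun x _ => erefl (i x)) y.
  rewrite -[RHS]/(idfun y) idE; apply: (uniq psiL).
  move=> x [a ->] /=; rewrite i_comb.
  have psiB : zmod_morphism psi.
    by move=> u v; rewrite -scaleN1r addrC psi_linear scaleN1r addrC.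
  rewrite (zmorph_sum psiB); apply: eq_bigr => j _; rewrite (zmorphMz psiB).
  congr (_ *~ _); rewrite /psi (bigD1 j) //= phi_gen eqxx scale1r big1 ?addr0 //.
  by move=> l lj; rewrite phi_gen eq_sym (negPf lj) scale0r.
exists (fun j y => phi y 0 j); split=> // [j a x y|x].
  by rewrite linearP !mxE.
by rewrite -[LHS]psiE.
Qed.

End IntegralForm.

Definition lie_sconst n (C : 'I_n -> 'I_n -> 'I_n -> int)
    (anti : forall i j k, C i j k = - C j i k)
    (jac : forall i j l m, \sum_k (C i j k * C k l m + C j l k * C k i m
      + C l i k * C k j m) = 0) : sconst.
Proof.
apply: (@SConst n C (fun _ _ => 0) anti _ jac) => [*|*]; first by rewrite oppr0.
by apply: big1 => *; rewrite !mulr0 !addr0.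
Defined.

Theorem theorem2p1 (K : closedFieldType) (char0 : [pchar K] =i pred0)
    (g : lieType K) (g_simple : simple_lie g) (B : chevalley_basis g) :
  gelfand_kirillov g ->
  exists p0 : nat, forall p : nat, prime p -> (p0 <= p)%N ->
    forall k : closedFieldType, is_algebraic_closure_Fp p k ->
    forall (gk : lieType k) (i : g -> gk),
      is_scalar_extension (chevalley_form B) i ->
      gelfand_kirillov gk.
Proof.
move=> [r [s [DL [Drs [[U [j [iU [U_env iU_frac]]]] [T [iT [T_wp iT_frac]]] [f f_bij]]]]]].
set n := size (cb_seq B); pose X : n.-tuple g := in_tuple (cb_seq B).
have X_basis : basis_of fullv X by exact: cb_basis.
have X_int (a b : 'I_n) : inIntSpan X (brack X`_a X`_b).
  by apply: cb_integral; exact: mem_nth.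
have [C [anti jac brackC]] := integral_constants char0 X_basis X_int.
pose c := lie_sconst anti jac.
have c_env : is_enveloping_algebra
    (@lie_embed K g c (fun a x => coord X a x)).
  apply: (@pbw_enveloping K g c (fun a : 'I_n => X`_a)) => //.
  - by move=> a t x y; rewrite linearP.
  - by move=> a b; rewrite coord_free //; exact: basis_free X_basis.
  - by move=> x; exact: (coord_basis X_basis (memvf x)).
(* The isomorphism carries the enveloping algebra into [Drs], so that both algebras have the same
   skew field of fractions, as [transfer] requires. *)
have [iU' iU'_frac] := fractions_comp f_bij iU_frac.
have [iC iC_frac] := universal_fractions U_env c_env iU'_frac.
have [w wT] := weyl_poly_universal T_wp.
have [iW iW_frac] := universal_fractions wT (pbw_weyl_universal K r s) iT_frac.
have [p0 p0P] := transfer char0 iC_frac iW_frac.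
exists p0 => p p_prime pp k [Fpk _] gk i gk_ext.
have kp : p \in [pchar k] := rmorph_pchar Fpk (pchar_Fp p_prime).
have [Dk [ik ik_frac]] := ore_localization (@pmul_eq0 c k) (@pbw_ore c k).
have [h h_frac] := p0P p p_prime pp k kp Dk ik ik_frac.
have [co [co_lin co_gen coE i_comb]] := scalar_extension_basis char0 X_basis gk_ext.
(* One skew field serves on both sides: [Dk] is the localization of the enveloping algebra of [gk],
   and through [h] also that of the Weyl algebra with polynomials, so the isomorphism is the
   identity. *)
exists r, s, Dk, Dk; split.
- exists (pbw c k), (@lie_embed k gk c co), ik; split=> //.
  apply: (@pbw_enveloping k gk c (fun a : 'I_n => i X`_a)) => // a b.
  have [_ iB _] := gk_ext.
  rewrite -iB; [|exact: (int_span_gen X)..].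
  rewrite brackC; have := i_comb [ffun l => C a b l].
  under eq_bigr => l _ do rewrite ffunE.
  by move=> ->; apply: eq_bigr => l _; rewrite ffunE.
- exists (pbw (weyl_sconst r s) k), h; split=> //; exact: pbw_weyl_poly_algebra.
- by exists idfun; exists idfun.
Qed.
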